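(* Let $1\le p_0,p_1,q_0,q_1\le\infty$, let $U_0,U_1$ be positive weights on a measure space and $V_0,V_1$ positive weights on a (possibly different) measure space, and consider the Banach couples $\{L_{p_0}(U_0),L_{p_1}(U_1)\}$ and $\{L_{q_0}(V_0),L_{q_1}(V_1)\}$. Let $a\in L_{p_0}(U_0)+L_{p_1}(U_1)$ be such that the function $\varphi(s,t)=K(s,t,a;\{L_{p_0}(U_0),L_{p_1}(U_1)\})$ belongs to $\Phi_0$. Then $$ Orb\bigl(a,\{L_{p_0}(U_0),L_{p_1}(U_1)\}\to\{L_{q_0}(V_0),L_{q_1}(V_1)\}\bigr)=\varphi\bigl(L_{q_0}(V_0),L_{q_1}(V_1)\bigr)_{r_0,r_1}, $$ where $r_0^{-1}=(q_0^{-1}-p_0^{-1})_+$ and $r_1^{-1}=(q_1^{-1}-p_1^{-1})_+$.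
   Context: Conventions: $x_+=\max(x,0)$, $1/\infty=0$, $1/0=\infty$. $L_p(U)$ is the space of measurable functions $f$ on the measure space with $fU\in L_p$ and norm $\|f\|_{L_p(U)}=\|fU\|_{L_p}$. Equality of Banach spaces is understood as equality of sets with equivalence of norms. K-functional: for a Banach couple $\{X_0,X_1\}$, $x\in X_0+X_1$, $s,t>0$, $K(s,t,x;\{X_0,X_1\})=\inf_{x=x_0+x_1}\bigl(s\|x_0\|_{X_0}+t\|x_1\|_{X_1}\bigr)$, the infimum over all decompositions with $x_i\in X_i$. Orbit: a linear operator $T$ maps the couple $\{X_0,X_1\}$ into the couple $\{Y_0,Y_1\}$ if $T:X_0+X_1\to Y_0+Y_1$ is linear and its restrictions $X_i\to Y_i$ are bounded, $i=0,1$. For $a\in X_0+X_1$, $Orb(a,\{X_0,X_1\}\to\{Y_0,Y_1\})$ is the space of all $y\in Y_0+Y_1$ of the form $y=Ta$ with such $T$, with norm $\inf_T\max(\|T\|_{X_0\to Y_0},\|T\|_{X_1\to Y_1})$ over all $T$ with $y=Ta$. Interpolation functions: a function $\rho:(0,\infty)\to(0,\infty)$ is quasi-concave if $\rho(t)$ is nondecreasing and $\rho(t)/t$ is nonincreasing. An interpolation function is a positive function $\varphi(s,t)$, $s,t>0$, homogeneous of degree one with $\rho(t)=\varphi(1,t)$ quasi-concave. $\varphi\in\Phi_0$ means that $\varphi(1,t)\to0$ and $\varphi(t,1)\to0$ as $t\to0$. Balanced sequence: for $\varphi\in\Phi_0$, $\rho(t)=\varphi(1,t)$, fix $q>1$.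 A balanced sequence for $\rho$ is an increasing sequence $\{t_n\}$ of positive numbers, indexed by an interval of $\mathbb Z$, constructed by induction in both directions from some starting point, as long as possible, so that $$\min\left(\frac{\rho(t_{n+1})}{\rho(t_n)},\frac{t_{n+1}\rho(t_n)}{t_n\rho(t_{n+1})}\right)=q$$ for all consecutive indices. (It is two-sided when $\varphi(1,t)$ and $\varphi(t,1)$ are both unbounded; otherwise it terminates on one or both sides.) The space $\varphi(X_0,X_1)_{p_0,p_1}$: for $\varphi\in\Phi_0$, $1\le p_0,p_1\le\infty$ and a Banach couple $\{X_0,X_1\}$, it consists of all $x\in X_0+X_1$ that can be written as $x=\sum_n\rho(t_n)w_n$ (convergence in $X_0+X_1$) with $w_n\in X_0\cap X_1$, $\{\|w_n\|_{X_0}\}\in l_{p_0}$ and $\{t_n\|w_n\|_{X_1}\}\in l_{p_1}$, where $\{t_n\}$ is a balanced sequence for $\rho$; the norm is the infimum of $\max\bigl(\|\{\|w_n\|_{X_0}\}\|_{l_{p_0}},\|\{t_n\|w_n\|_{X_1}\}\|_{l_{p_1}}\bigr)$ over all such representations. *)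

(* Defs.v *)
From HB Require Import structures.
From mathcomp Require Import all_boot all_order all_algebra.
From mathcomp Require Import all_classical all_reals all_analysis.
From mathcomp Require Import measurable_realfun ess_sup_inf.

Set Implicit Arguments.
Unset Strict Implicit.
Unset Printing Implicit Defensive.
Import Order.TTheory GRing.Theory Num.Theory.
Import numFieldNormedType.Exports.

Local Open Scope classical_set_scope.
Local Open Scope ring_scope.

(* Classes of measurable real functions modulo equality almost everywhere,
   with the vector space structure induced by representatives. *)
Definition L0 d (T : measurableType d) (R : realType)
  (mu : {measure set T -> \bar R}) : Type := {mfun_ mu, T >-> R}.

Section L0_lmodule.
Context d (T : measurableType d) (R : realType).
Variable mu : {measure set T -> \bar R}.
Notation mfunT := {mfun T >-> R}.
Notation L := (L0 mu).
Local Open Scope quotient_scope.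

HB.instance Definition _ := Choice.on L.
HB.instance Definition _ := EqQuotient.on L.

Definition toL0 (f : {mfun T >-> R}) : L := \pi_L (f : mfunT).
Definition ofL0 (f : L) : {mfun T >-> R} := repr f.

Lemma ofL0K : cancel ofL0 toL0. Proof. by move=> f; rewrite /toL0 reprK. Qed.

Lemma eq_toL0 (f g : {mfun T >-> R}) : toL0 f = toL0 g <-> f = g %[ae mu].
Proof.
by split=> [/eqmodP/asboolP//|fg]; apply/eqmodP/asboolP.
Qed.

Lemma toL0K (f : {mfun T >-> R}) : ofL0 (toL0 f) = f %[ae mu].
Proof. by apply/eq_toL0; rewrite ofL0K. Qed.

Definition L0_zero : L := toL0 0.
Definition L0_opp (f : L) : L := toL0 (- ofL0 f).
Definition L0_add (f g : L) : L := toL0 (ofL0 f + ofL0 g).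
Definition L0_scale (c : R) (f : L) : L := toL0 (c *: ofL0 f).

Lemma toL0D (f g : {mfun T >-> R}) : L0_add (toL0 f) (toL0 g) = toL0 (f + g).
Proof.
apply/eq_toL0; apply: filterS2 (toL0K f) (toL0K g) => x /(_ I) fx /(_ I) gx _.
by rewrite !mfunD /= fx gx.
Qed.

Lemma toL0N (f : {mfun T >-> R}) : L0_opp (toL0 f) = toL0 (- f).
Proof.
by apply/eq_toL0; apply: filterS (toL0K f) => x /(_ I) fx _; rewrite !mfunN /= fx.
Qed.

Lemma toL0Z (c : R) (f : {mfun T >-> R}) :
  L0_scale c (toL0 f) = toL0 (c *: f).
Proof.
apply/eq_toL0; apply: filterS (toL0K f) => x /(_ I) fx _.
by change (c * ofL0 (toL0 f) x = c * f x); rewrite fx.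
Qed.

Lemma L0_addA : associative L0_add.
Proof.
move=> f g h; rewrite -[f]ofL0K -[g]ofL0K -[h]ofL0K.
by rewrite !toL0D addrA.
Qed.

Lemma L0_addC : commutative L0_add.
Proof. by move=> f g; rewrite /L0_add addrC. Qed.

Lemma L0_add0 : left_id L0_zero L0_add.
Proof. by move=> f; rewrite -[f]ofL0K toL0D add0r. Qed.

Lemma L0_addN : left_inverse L0_zero L0_opp L0_add.
Proof. by move=> f; rewrite -[f]ofL0K toL0N toL0D addNr. Qed.

Lemma L0_scaleA (a b : R) (f : L) :
  L0_scale a (L0_scale b f) = L0_scale (a * b) f.
Proof. by rewrite -[f]ofL0K !toL0Z scalerA. Qed.

Lemma L0_scale1 : left_id 1 L0_scale.
Proof. by move=> f; rewrite -[f]ofL0K toL0Z scale1r. Qed.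

Lemma L0_scaleDr : right_distributive L0_scale L0_add.
Proof.
by move=> a f g; rewrite -[f]ofL0K -[g]ofL0K !(toL0D, toL0Z) scalerDr.
Qed.

Lemma L0_scaleDl (f : L) (a b : R) :
  L0_scale (a + b) f = L0_add (L0_scale a f) (L0_scale b f).
Proof. by rewrite -[f]ofL0K !(toL0D, toL0Z) scalerDl. Qed.

HB.instance Definition _ :=
  GRing.isZmodule.Build L L0_addA L0_addC L0_add0 L0_addN.

HB.instance Definition _ := GRing.Zmodule_isLmodule.Build R L
  L0_scaleA L0_scale1 L0_scaleDr L0_scaleDl.

End L0_lmodule.

(* A couple {X_0, X_1} of normed spaces inside a common vector space: X_i is
   the set where the norm [cnormi], extended by +oo outside X_i, is finite.
   The definitions below need neither the completeness of the X_i nor the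
   topology of the ambient space. *)
Record couple (R : realType) := Couple {
  ambient :> lmodType R;
  cnorm0 : ambient -> \bar R;
  cnorm1 : ambient -> \bar R }.

Arguments cnorm0 {R} X x : rename.
Arguments cnorm1 {R} X x : rename.

Section Couples.
Context (R : realType).
Local Open Scope ereal_scope.
Implicit Types X Y : couple R.

Definition space0 X : set X := [set x | cnorm0 X x < +oo].
Definition space1 X : set X := [set x | cnorm1 X x < +oo].
Arguments space0 : clear implicits.
Arguments space1 : clear implicits.

Definition csum X : set X :=
  [set x | exists x0 x1 : X,
    [/\ (x = x0 + x1)%R, space0 X x0 & space1 X x1]].
Definition cinter X : set X := space0 X `&` space1 X.

Arguments csum : clear implicits.
Arguments cinter : clear implicits.

Definition Kfun X (s t : R) (x : X) : \bar R :=
  ereal_inf [set k | exists x0 x1 : X,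
    [/\ (x = x0 + x1)%R, space0 X x0, space1 X x1 &
        k = s%:E * cnorm0 X x0 + t%:E * cnorm1 X x1]].

Definition opnorm (V W : lmodType R) (NV : V -> \bar R) (NW : W -> \bar R)
    (T : V -> W) : \bar R :=
  ereal_sup [set NW (T x) | x in [set x | NV x <= 1]].

(* The values of T outside X_0 + X_1 are irrelevant. *)
Definition couple_operator X Y (T : X -> Y) : Prop :=
  [/\ forall x, csum X x -> csum Y (T x),
      forall (c : R) (x y : X), csum X x -> csum X y ->
        T (c *: x + y)%R = (c *: T x + T y)%R,
      opnorm (cnorm0 X) (cnorm0 Y) T < +oo
    & opnorm (cnorm1 X) (cnorm1 Y) T < +oo].

Definition Orb X (a : X) Y : set Y :=
  [set y | exists T : X -> Y, couple_operator T /\ y = T a].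

Definition Orb_norm X (a : X) Y (y : Y) : \bar R :=
  ereal_inf [set k | exists T : X -> Y, [/\ couple_operator T, y = T a &
    k = maxe (opnorm (cnorm0 X) (cnorm0 Y) T)
             (opnorm (cnorm1 X) (cnorm1 Y) T)]].

(* Equality of Banach spaces: same elements, equivalent norms. *)
Definition eq_normed_space (V : lmodType R) (A : set V) (NA : V -> \bar R)
    (B : set V) (NB : V -> \bar R) : Prop :=
  A = B /\ exists c C : R, [/\ (0 < c)%R, (0 < C)%R &
    forall x, A x -> c%:E * NA x <= NB x /\ NB x <= C%:E * NA x].

End Couples.
Arguments csum {R}.
Arguments cinter {R}.
Arguments Kfun {R}.
Arguments Orb {R}.
Arguments Orb_norm {R}.

Section InterpolationFunctions.
Context (R : realType).
Implicit Types (rho : R -> R) (phi : R -> R -> R).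

Definition quasi_concave rho : Prop :=
  [/\ forall t, 0 < t -> 0 < rho t,
      forall s t, 0 < s -> s <= t -> rho s <= rho t
    & forall s t, 0 < s -> s <= t -> rho t / t <= rho s / s].

Definition interpolation_function phi : Prop :=
  [/\ forall s t, 0 < s -> 0 < t -> 0 < phi s t,
      forall c s t, 0 < c -> 0 < s -> 0 < t ->
        phi (c * s) (c * t) = c * phi s t
    & quasi_concave (phi 1)].

Definition Phi0 phi : Prop :=
  [/\ interpolation_function phi,
      phi 1 t @[t --> 0^'+] --> (0 : R)
    & phi t 1 @[t --> 0^'+] --> (0 : R)].

Definition balance_ratio rho (s t : R) : R :=
  Num.min (rho t / rho s) ((t * rho s) / (s * rho t)).

(* The last two clauses say that the construction goes on as long as possible
   in both directions. *)
Definition balanced rho (q : R) (J : set int) (t : int -> R) : Prop :=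
  [/\ J !=set0 /\ is_interval J,
      (forall n, J n -> 0 < t n) /\
        (forall m n, J m -> J n -> m < n -> t m < t n),
      forall n, J n -> J (n + 1) -> balance_ratio rho (t n) (t (n + 1)) = q,
      forall n, J n -> ~ J (n + 1) ->
        ~ exists s, t n < s /\ balance_ratio rho (t n) s = q
    & forall n, J n -> ~ J (n - 1) ->
        ~ exists s, [/\ 0 < s, s < t n & balance_ratio rho s (t n) = q]].

End InterpolationFunctions.

Section PhiSpace.
Context (R : realType).
Local Open Scope ereal_scope.

Definition lnorm (J : set int) (p : \bar R) (x : int -> \bar R) : \bar R :=
  match p with
  | r%:E => (\esum_(n in J) `|x n| `^ r) `^ r^-1
  | _ => ereal_sup [set `|x n| | n in J]
  end.

Variables (rho : R -> R) (J : set int) (t : int -> R) (Y : couple R).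
Variables p0 p1 : \bar R.

Definition partial_sum (w : int -> Y) (M N : nat) : Y :=
  (\sum_(n \in J `&` [set n | (- M%:Z <= n <= N%:Z)%R])
     rho (t n) *: w n)%R.

Definition phi_norm0 (w : int -> Y) : \bar R :=
  lnorm J p0 (fun n => cnorm0 Y (w n)).
Definition phi_norm1 (w : int -> Y) : \bar R :=
  lnorm J p1 (fun n => (t n)%:E * cnorm1 Y (w n)).

Definition phi_representation (x : Y) (w : int -> Y) : Prop :=
  [/\ csum Y x,
      forall n, J n -> cinter Y (w n),
      Kfun Y 1%R 1%R (x - partial_sum w z.1 z.2)%R
        @[z --> filter_prod (\oo : set_system nat) (\oo : set_system nat)]
        --> (0 : \bar R),
      phi_norm0 w < +oo
    & phi_norm1 w < +oo].

Definition phi_space : set Y := [set x | exists w, phi_representation x w].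

Definition phi_space_norm (x : Y) : \bar R :=
  ereal_inf [set maxe (phi_norm0 w) (phi_norm1 w)
            | w in [set w | phi_representation x w]].

End PhiSpace.
Arguments phi_space {R}.
Arguments phi_space_norm {R}.

Section WeightedLp.
Context d (T : measurableType d) (R : realType).
Variable mu : {measure set T -> \bar R}.
Local Open Scope ereal_scope.

Definition weight (U : T -> R) : Prop :=
  measurable_fun [set: T] U /\ forall x, (0 < U x)%R.

Definition weighted_Lnorm (p : \bar R) (U : T -> R) (f : L0 mu) : \bar R :=
  'N[mu]_p[EFin \o (ofL0 f \* U)%R].

Definition Lp_couple (p0 p1 : \bar R) (U0 U1 : T -> R) : couple R :=
  Couple (weighted_Lnorm p0 U0) (weighted_Lnorm p1 U1).

End WeightedLp.

(* Main.v *)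
Require Import Defs.
From HB Require Import structures.
From mathcomp Require Import all_boot all_order all_algebra.
From mathcomp Require Import finmap.
From mathcomp Require Import all_classical all_reals all_analysis.
From mathcomp Require Import measurable_realfun ess_sup_inf ring lra zify.

Set Implicit Arguments.
Unset Strict Implicit.
Unset Printing Implicit Defensive.
Import Order.TTheory GRing.Theory Num.Theory.
Import numFieldNormedType.Exports.
Local Open Scope classical_set_scope.
Local Open Scope ring_scope.

(** The blocks.  Choose near-optimal decompositions of [a] for the K-functional at the
    balanced points [t n], and let [B n] be the set of points where [n] is the first
    index whose [L_{p_0}]-part is at least half of [a] in absolute value.  Since
    [K(1, t n, a)] and [K(1, t n, a) / t n] grow, resp. decay, geometrically, the block
    [cut (B n) a] has norms at most a multiple of [rho (t n)] and [rho (t n) / t n].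

    Orbits lie in the phi-space.  If [y = T a], the same selection, applied to the images
    under [T] of the parts of [a] below and above [n], gives disjoint sets [E n] on which
    [y] is dominated by [T] of either part.  For [xi] in the unit ball of [l_p], averaging
    the image under [T] of the blocks weighted by [xi n / rho (t n)] over random signs
    shows that [xi] multiplies the norms of the blocks of [y] into [l_q], and the converse
    Hoelder inequality places them in [l_r], [1/r = (1/q - 1/p)_+].

    Conversely, the selection turns a representation of [x] in the phi-space into a
    disjointly supported one, with sets [E n].  Some block of [a] near [n] carries a fixed
    proportion of [K(1, t n, a)], so the Hahn-Banach theorem gives a functional [f n] on
    that block with [f n a = rho (t n)], dominated by a multiple of [K(1, t n, .)].  The
    operator that sends [u] to [f n u / rho (t n)] times [x] on [E n] maps [a] to [x], and
    it is bounded by Hoelder's inequality. *)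

(** * Weighted norms *)

(** A balanced step fixes only the smaller of two growth ratios; the other may be arbitrarily large.
    Selection bounds the piece of [a] with index n by rho (t n) in the first norm, but by rho (t (n
    - 1)) / t (n - 1) in the second. Whichever ratio equals q decides whether this piece joins block
    n or block n - 1, where both bounds have the right order.

    The second obstacle is an end of the balanced sequence. There the balance ratio, continuous by
    quasi-concavity, never reaches q again; so rho (or rho (t) / t) stays within the factor q of its
    value at the end, and [a] itself belongs to one of the two spaces, by completeness in the sense
    of Gagliardo. Elements of the phi-space need the same argument at the ends.

    Every estimate is made for finite index sets and real bounds, with constants independent of the
    set; infinite sums are reached by monotone limits. The constants depend on q, on the blocks and
    on the ends of the sequence, never on the operator or the representation, as equivalence of
    norms demands. *)

Section WeightedNorm.
Context d (T : measurableType d) (R : realType).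
Variable mu : {measure set T -> \bar R}.
Implicit Types (p : \bar R) (U f g : T -> R) (E : set T) (c : R).

(** Stated for functions instead of classes, so that cutting and pointwise comparison need no
    representatives; [weighted_Lnorm] of a class is [wnorm] of its representative. *)
Definition wnorm p U f : \bar R := 'N[mu]_p[EFin \o (f \* U)%R].

Definition cut E f : T -> R := fun x => f x * \1_E x.

Lemma cutT E f x : E x -> cut E f x = f x.
Proof. by move=> Ex; rewrite /cut indicE mem_set// mulr1. Qed.

Lemma cutF E f x : ~ E x -> cut E f x = 0.
Proof. by move=> Ex; rewrite /cut indicE memNset// mulr0. Qed.

Lemma cut_or E f x : (cut E f x = f x) \/ (cut E f x = 0).
Proof. by have [/cutT|/cutF] := pselect (E x); [left|right]. Qed.

Lemma norm_cut E f x : `|cut E f x| <= `|f x|.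
Proof. by have [->|->] := cut_or E f x; rewrite ?normr0. Qed.

Lemma measurable_cut E f : measurable E -> measurable_fun setT f ->
  measurable_fun setT (cut E f).
Proof.
by move=> mE mf; apply: measurable_funM => //; exact: measurable_indic.
Qed.

Lemma measurable_wprod U f : weight U -> measurable_fun setT f ->
  measurable_fun setT (f \* U)%R.
Proof. by move=> [mU _] mf; exact: measurable_funM. Qed.

Lemma wnorm_ge0 p U f : (0 <= wnorm p U f)%E.
Proof. exact: Lnorm_ge0. Qed.

Lemma poweR_le_iff (x : \bar R) r c : (0 < r) -> (0 <= x)%E -> 0 <= c ->
  (x <= c%:E)%E <-> (x `^ r <= (c `^ r)%:E)%E.
Proof.
move=> r0; case: x => [x| |]//= x0 c0; last by rewrite (gt_eqF r0).
rewrite !lee_fin; rewrite lee_fin in x0; split => [xc|].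
  by apply: ge0_ler_powR => //; rewrite ?nnegrE// ltW.
move=> h; rewrite leNgt; apply/negP => cx.
have := gt0_ltr_powR r0 (_ : c \in Num.nneg) (_ : x \in Num.nneg) cx.
by rewrite !nnegrE => /(_ c0 x0); rewrite ltNge h.
Qed.

Lemma wnorm_finP r U f c : 1 <= r -> 0 <= c ->
  (wnorm r%:E U f <= c%:E)%E <->
  (\int[mu]_x (`|f x * U x| `^ r)%:E <= (c `^ r)%:E)%E.
Proof.
move=> r1 c0; have r0 : 0 < r by rewrite (lt_le_trans _ r1).
rewrite (poweR_le_iff r0 (wnorm_ge0 _ _ _) c0).
by rewrite /wnorm powR_Lnorm ?gt_eqF//.
Qed.

Lemma wnorm_ooP U f c : 0 <= c ->
  (wnorm +oo U f <= c%:E)%E <-> {ae mu, forall x, `|f x * U x| <= c}.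
Proof.
move=> c0; rewrite /wnorm unlock /=; case: ifPn => [mu0|].
  split=> [/ess_supP h|h]; last apply/ess_supP; apply: filterS h => x /=;
    by rewrite lee_fin.
(* On a space of measure zero the [+oo] norm is 0 by convention, and the whole space is an
   admissible exceptional set. *)
rewrite -leNgt => mu0; rewrite lee_fin c0; split => // _.
exists setT; split => //; apply/eqP; rewrite eq_le mu0/=.
by rewrite measure_ge0.
Qed.

Lemma measurable_wpow r U f : weight U -> measurable_fun setT f ->
  measurable_fun setT (fun x => (`|f x * U x| `^ r)%:E).
Proof.
move=> wU mf; apply/measurable_EFinP.
apply: (measurableT_comp (measurable_powR r)).
by apply: measurableT_comp => //; exact: measurable_wprod.
Qed.

Lemma wnorm_le p U f g : (1 <= p)%E -> weight U -> measurable_fun setT f ->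
  measurable_fun setT g -> {ae mu, forall x, `|f x| <= `|g x|} ->
  (wnorm p U f <= wnorm p U g)%E.
Proof.
move=> p1 wU mf mg fg.
suff H M : 0 <= M -> (wnorm p U g <= M%:E)%E -> (wnorm p U f <= M%:E)%E.
  have := wnorm_ge0 p U g.
  case gE : (wnorm p U g) => [M| |] //; try by rewrite !leey.
  by rewrite lee_fin => M0; apply: H; rewrite ?gE.
move=> M0 gM.
have fgU : {ae mu, forall x, `|f x * U x| <= `|g x * U x|}.
  by apply: filterS fg => x fgx; rewrite !normrM ler_wpM2r.
move: p1 gM; case: p => [r| |]//; rewrite ?lee_fin => r1 gM.
  apply/wnorm_finP => //; move/wnorm_finP : gM => /(_ r1 M0); apply: le_trans.
  apply: ae_ge0_le_integral => //; try by move=> *; rewrite lee_fin powR_ge0.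
  - exact: measurable_wpow.
  - exact: measurable_wpow.
  - apply: filterS fgU => x fgx _; rewrite lee_fin ge0_ler_powR//.
    by rewrite (le_trans _ r1).
apply/wnorm_ooP => //; move/wnorm_ooP : gM => /(_ M0).
by apply: filterS2 fgU => x; exact: le_trans.
Qed.

Lemma wnormD p U f g : (1 <= p)%E -> weight U -> measurable_fun setT f ->
  measurable_fun setT g -> (wnorm p U (f \+ g)%R <= wnorm p U f + wnorm p U g)%E.
Proof.
move=> p1 wU mf mg; rewrite /wnorm.
have -> : ((f \+ g) \* U = (f \* U) \+ (g \* U))%R.
  by apply/funext => x /=; rewrite mulrDl.
by apply: eminkowski => //; exact: measurable_wprod.
Qed.

Lemma wnormZ p U f M c : (1 <= p)%E -> weight U -> measurable_fun setT f ->
  0 <= M -> (wnorm p U f <= M%:E)%E ->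
  (wnorm p U (fun x => c * f x)%R <= (`|c| * M)%:E)%E.
Proof.
move=> p1 wU mf M0; have cM0 : 0 <= `|c| * M by rewrite mulr_ge0.
case: p p1 => [r| |]//; rewrite ?lee_fin => r1.
  move/wnorm_finP => /(_ r1 M0) fM; apply/wnorm_finP => //.
  have -> : (\int[mu]_x (`|c * f x * U x| `^ r)%:E =
             \int[mu]_x ((`|c| `^ r)%:E * (`|f x * U x| `^ r)%:E))%E.
    by apply: eq_integral => x _; rewrite -mulrA normrM powRM// EFinM.
  rewrite ge0_integralZl_EFin ?powR_ge0//.
  - by rewrite powRM// EFinM lee_wpmul2l// lee_fin powR_ge0.
  - exact: measurable_wpow.
move/wnorm_ooP => /(_ M0) fM; apply/wnorm_ooP => //.
by apply: filterS fM => x fM; rewrite -mulrA normrM ler_wpM2l.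
Qed.

Lemma wnorm0 p U : (1 <= p)%E -> wnorm p U (fun=> 0) = 0%E.
Proof.
move=> p1; rewrite /wnorm -[RHS](@Lnorm0 _ _ _ mu p); last first.
  by rewrite gt_eqF// (lt_le_trans _ p1).
by apply: eq_Lnorm => x /=; rewrite mul0r.
Qed.

Lemma wnorm_eq0 p U f : (1 <= p)%E -> weight U -> measurable_fun setT f ->
  wnorm p U f = 0%E -> {ae mu, forall x, f x = 0}.
Proof.
move=> p1 wU mf f0; have p0 : (0 < p)%E by rewrite (lt_le_trans _ p1).
have mfU : measurable_fun setT (EFin \o (f \* U)%R).
  exact/measurable_EFinP/measurable_wprod.
have := Lnorm_eq0_eq0 mfU p0 f0; apply: filterS => x /(_ I) /= [].
by move/eqP; rewrite mulf_eq0 (gt_eqF (wU.2 x)) orbF => /eqP.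
Qed.

(** Fatou property: monotone convergence for finite p, a countable union of null sets for p = +oo.
    It carries bounds from finite unions of pieces to infinite ones. *)
Lemma wnorm_cut_lim p U f (F : (set T)^nat) M : (1 <= p)%E -> weight U ->
  measurable_fun setT f -> 0 <= M -> (forall k, measurable (F k)) ->
  {homo F : n m / (n <= m)%N >-> (n <= m)%O} ->
  (forall k, (wnorm p U (cut (F k) f) <= M%:E)%E) ->
  (wnorm p U (cut (\bigcup_k F k) f) <= M%:E)%E.
Proof.
move=> p1 wU mf M0 mF ndF; case: p p1 => [r| |]//; rewrite ?lee_fin => r1.
  have r0 : 0 < r by rewrite (lt_le_trans _ r1).
  have cutE E : measurable E -> (\int[mu]_x (`|cut E f x * U x| `^ r)%:E =
       \int[mu]_(x in E) (`|f x * U x| `^ r)%:E)%E.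
    move=> mE; rewrite [RHS]integral_mkcond; apply: eq_integral => x _.
    rewrite patchE; case: ifPn => [/set_mem Ex|/negP Ex]; first by rewrite cutT.
    rewrite cutF ?mul0r ?normr0 ?powR0 ?gt_eqF// => Ex'.
    by apply: Ex; rewrite inE.
  move=> fF; apply/wnorm_finP => //; rewrite cutE; last exact: bigcup_measurable.
  have cv := @ge0_nondecreasing_set_cvg_integral _ _ _ F
    (fun x => (`|f x * U x| `^ r)%:E) mu ndF mF
    (fun i => measurable_funS measurableT (@subsetT _ _) (measurable_wpow r wU mf))
    (fun i x _ => powR_ge0 _ _).
  rewrite -(cvg_lim _ cv)//; apply: lime_le; first by apply/cvg_ex; eexists; exact: cv.
  by apply: nearW => n /=; rewrite -cutE//; apply/wnorm_finP.
move=> fF; apply/wnorm_ooP => //.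
have : {ae mu, forall x, forall k, `|cut (F k) f x * U x| <= M}.
  by apply/ae_foralln => k; apply/wnorm_ooP.
apply: filterS => x h; have [[k _ Fk]|/cutF ->] := pselect ((\bigcup_k F k) x).
  by have := h k; rewrite !cutT//; exists k.
by rewrite mul0r normr0.
Qed.

End WeightedNorm.

(** * Multipliers between sequence spaces *)

Section FiniteSequences.
Context (R : realType).
Implicit Types (p q r : \bar R) (s : seq int) (x y : int -> R).

(** Unit ball of l_p on the finite set [s]; the p-th root is left out, being irrelevant for
    comparison with 1, and infinite sums never occur. *)
Definition lball p s x : Prop :=
  match p with
  | e%:E => \sum_(n <- s) `|x n| `^ e <= 1
  | _ => forall n, n \in s -> `|x n| <= 1
  end.

Lemma lball_le p s x y : (1 <= p)%E -> (forall n, n \in s -> `|x n| <= `|y n|) ->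
  lball p s y -> lball p s x.
Proof.
case: p => [e| |]//= e1 xy.
  apply: le_trans; rewrite big_seq [leRHS]big_seq; apply: ler_sum => n ns.
  by rewrite ge0_ler_powR ?xy//; rewrite lee_fin in e1; rewrite (le_trans _ e1).
by move=> h n ns; rewrite (le_trans (xy _ ns)) ?h.
Qed.

Lemma lball_le1 p s x n : (0 < p)%E -> lball p s x -> n \in s -> `|x n| <= 1.
Proof.
case: p => [e| |]//= p0; last by move=> h /h.
rewrite lte_fin in p0 => h ns.
have : `|x n| `^ e <= 1.
  by apply: le_trans h; rewrite (perm_big _ (perm_to_rem ns))/= big_cons lerDl
    sumr_ge0// => *; exact: powR_ge0.
apply: contraTT; rewrite -!ltNge => h1.
have := @gt0_ltr_powR _ e p0 1 `|x n|; rewrite !nnegrE powR1.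
by apply.
Qed.

(** The exponent r for which multiplication by y maps l_p into l_q exactly when y lies in l_r; it
    gives the r_0 and r_1 of the theorem. *)
Definition multiplier_exponent p q : \bar R :=
  ((maxe (q^-1 - p^-1) 0)^-1)%E.

(** Three regimes: l_p sits inside l_q and bounded multipliers suffice; p is infinite and the
    multiplier itself must lie in l_q; the genuine Hoelder case with three finite exponents. *)
Variant multiplier_exponent_spec p q : \bar R -> Prop :=
| MulExpInf of (p <= q)%E : multiplier_exponent_spec p q +oo%E
| MulExpSame e of p = +oo%E & q = e%:E & 1 <= e :
    multiplier_exponent_spec p q e%:E
| MulExpLt e f g of p = e%:E & q = f%:E & 1 <= f & f < e & 0 < g &
    f^-1 = e^-1 + g^-1 : multiplier_exponent_spec p q g%:E.

Lemma multiplier_exponentP p q : (1 <= p)%E -> (1 <= q)%E ->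
  multiplier_exponent_spec p q (multiplier_exponent p q).
Proof.
rewrite /multiplier_exponent.
case: p => [e| |]//; case: q => [f| |]//; rewrite ?lee_fin => e1 f1.
- have e0 : 0 < e by rewrite (lt_le_trans _ e1).
  have f0 : 0 < f by rewrite (lt_le_trans _ f1).
  rewrite !inver !gt_eqF//= -EFinB.
  have [ef|fe] := leP e f.
    have -> : (maxe (f^-1 - e^-1)%:E 0 = 0%:E)%E.
      by apply/max_idPr; rewrite lee_fin subr_le0 lef_pV2.
    by rewrite inve0; apply: MulExpInf; rewrite lee_fin.
  have fe0 : 0 < f^-1 - e^-1 by rewrite subr_gt0 ltf_pV2.
  have -> : (maxe (f^-1 - e^-1)%:E 0 = (f^-1 - e^-1)%:E)%E.
    by apply/max_idPl; rewrite lee_fin ltW.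
  rewrite inver gt_eqF//; apply: MulExpLt (erefl) (erefl) _ _ _ _ => //.
    by rewrite invr_gt0.
  by rewrite invrK subrKC.
- have e0 : 0 < e by rewrite (lt_le_trans _ e1).
  rewrite invey inver gt_eqF// sub0e.
  have -> : (maxe (- (e^-1)%:E) 0 = 0%:E)%E.
    by apply/max_idPr; rewrite -EFinN lee_fin oppr_le0 invr_ge0 ltW.
  by rewrite inve0; apply: MulExpInf; rewrite leey.
- have f0 : 0 < f by rewrite (lt_le_trans _ f1).
  rewrite invey inver gt_eqF// sube0.
  have -> : (maxe (f^-1)%:E 0 = (f^-1)%:E)%E.
    by apply/max_idPl; rewrite lee_fin invr_ge0 ltW.
  by rewrite inver gt_eqF ?invr_gt0// invrK; apply: MulExpSame.
- rewrite invey sube0 maxxx inve0; apply: MulExpInf.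
  by rewrite leey.
Qed.

Lemma multiplier_exponent_gt0 p q : (1 <= p)%E -> (1 <= q)%E ->
  (0 < multiplier_exponent p q)%E.
Proof.
move=> p1 q1; case: (multiplier_exponentP p1 q1) => //.
- by move=> e _ _ e1; rewrite lte_fin (lt_le_trans _ e1).
Qed.

(** For p <= q the entries of x are at most 1, so raising the exponent decreases the sum. For q < p
    finite this is Young's inequality with weights f / e + f / g = 1, summed over the two balls. *)
Lemma lball_mul p q s x y : (1 <= p)%E -> (1 <= q)%E ->
  lball p s x -> lball (multiplier_exponent p q) s y ->
  lball q s (fun n => x n * y n).
Proof.
move=> p1 q1; have p0 : (0 < p)%E by rewrite (lt_le_trans _ p1).
case: (multiplier_exponentP p1 q1).
- move=> pq xp yo; apply: (@lball_le _ _ _ x) => //.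
    move=> n ns; rewrite normrM ler_piMr//; exact: yo.
  have x1 n : n \in s -> `|x n| <= 1 by exact: lball_le1 xp.
  case: p q p0 p1 q1 pq xp => [e| |] [f| |]//= p0 p1 q1; rewrite ?lee_fin => ef.
  apply: le_trans; rewrite big_seq [leRHS]big_seq; apply: ler_sum => n ns.
  have [->|xn0] := eqVneq (x n) 0.
    rewrite normr0 !powR0//; first by rewrite gt_eqF// -lte_fin.
    by rewrite gt_eqF// -lte_fin (lt_le_trans _ q1).
  by apply: ger_powR => //; rewrite normr_gt0 xn0 x1.
- move=> e -> -> e1 /= x1; apply: le_trans.
  rewrite big_seq [leRHS]big_seq; apply: ler_sum => n ns.
  rewrite ge0_ler_powR ?nnegrE//; first by rewrite (le_trans _ e1).
  by rewrite normrM ler_piMl ?x1.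
- move=> e f g -> -> f1 fe g0 fE /= xe yg.
  have f0 : 0 < f by rewrite (lt_le_trans _ f1).
  have e0 : 0 < e by rewrite (lt_trans _ fe).
  have fge : f / e + f / g = 1 by rewrite -mulrDr -fE mulfV// gt_eqF.
  rewrite -fge; apply: (@le_trans _ _ (\sum_(n <- s) (f / e * `|x n| `^ e +
      f / g * `|y n| `^ g))).
    apply: ler_sum => n _; rewrite normrM powRM//.
    have cj : `|x n| `^ f * `|y n| `^ f <= (`|x n| `^ f) `^ (e / f) / (e / f) +
        (`|y n| `^ f) `^ (g / f) / (g / f).
      by apply: conjugate_powR; rewrite ?powR_ge0 ?divr_gt0// !invf_div.
    apply: (le_trans cj); rewrite -!powRrM !invf_div.
    have -> : f * (e / f) = e by rewrite mulrC divfK// gt_eqF.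
    have -> : f * (g / f) = g by rewrite mulrC divfK// gt_eqF.
    by rewrite mulrC [X in _ + X]mulrC.
  by rewrite big_split/= -!mulr_sumr lerD// ler_piMr// divr_ge0 ?ltW.
Qed.

(** The converse Hoelder inequality, tested on unit vectors for p <= q, on the constant 1 for p =
    +oo, and on the extremal sequence otherwise. *)
Lemma lball_mul_converse p q s y : (1 <= p)%E -> (1 <= q)%E -> uniq s ->
  (forall x, lball p s x -> lball q s (fun n => x n * y n)) ->
  lball (multiplier_exponent p q) s y.
Proof.
move=> p1 q1 us; case: (multiplier_exponentP p1 q1).
- move=> pq h n ns; pose x k : R := (k == n)%:R.
  have : lball p s x.
    case: p p1 {pq h} => [e| |]//=; last 1 first.
      by move=> _ k _; rewrite /x normr_nat; case: eqP.
    rewrite lee_fin => e1; rewrite (bigD1_seq n)//= big1 ?addr0.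
      by rewrite /x eqxx normr1 powR1.
    move=> k /negPf; rewrite /x => ->; rewrite normr0 powR0// gt_eqF//.
    by rewrite (lt_le_trans _ e1).
  move/h => {}h.
  have := lball_le1 (lt_le_trans _ q1) h ns.
  by rewrite /x eqxx mul1r; apply.
- move=> e -> -> e1 h; have := h (fun=> 1); rewrite /lball.
  rewrite (eq_bigr (fun n => `|y n| `^ e)).
    by apply => n _; rewrite normr1.
  by move=> n _; rewrite mul1r.
- move=> e f g -> -> f1 fe g0 fE /= h.
  have f0 : 0 < f by rewrite (lt_le_trans _ f1).
  have e0 : 0 < e by rewrite (lt_trans _ fe).
  have fge : f / e + f / g = 1 by rewrite -mulrDr -fE mulfV// gt_eqF.
  set S := \sum_(n <- s) _; have : 0 <= S by apply: sumr_ge0 => *; exact: powR_ge0.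
  rewrite le_eqVlt => /predU1P[<-//|S0].
  (* The extremal sequence of Hoelder's inequality, normalised by S. The f-th powers of its product
     with y are |y n|^g S^(-f/e); their sum S^(f/g) is at most 1, hence so is S. *)
  have := h (fun n => `|y n| `^ (g / e) * S `^ (- e^-1)).
  have -> : \sum_(n <- s) `|(`|y n| `^ (g / e) * S `^ (- e^-1))| `^ e = 1.
    rewrite (eq_bigr (fun n => `|y n| `^ g * S `^ (-1))).
      by rewrite -mulr_suml powR_inv1 ?mulfV ?gt_eqF// ltW.
    move=> n _; rewrite ger0_norm ?mulr_ge0 ?powR_ge0// powRM ?powR_ge0//.
    by rewrite -!powRrM mulNr mulVf ?divfK ?gt_eqF.
  move=> /(_ (lexx _)).
  rewrite (eq_bigr (fun n => `|y n| `^ g * S `^ (- (f / e)))); last first.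
    move=> n _; rewrite normrM ger0_norm ?mulr_ge0 ?powR_ge0//.
    rewrite mulrAC powRM ?mulr_ge0 ?powR_ge0// powRM ?powR_ge0// -!powRrM.
    rewrite (_ : - e^-1 * f = - (f / e)); last by rewrite mulNr mulrC.
    congr (_ * _); rewrite -powRD; last first.
      by rewrite gt_eqF //= addr_gt0 // mulr_gt0 // divr_gt0.
    by congr (_ `^ _); rewrite -[RHS]mulr1 -fge; field; rewrite !gt_eqF.
  rewrite -mulr_suml -/S -{1}(powRr1 (ltW S0)) -powRD; last first.
    by rewrite (gt_eqF S0) implybT.
  have -> : 1 - f / e = f / g by rewrite -fge addrC addKr.
  apply: contraTT; rewrite -!ltNge => S1.
  have := @gt0_ltr_powR _ (f / g) (divr_gt0 f0 g0) 1 S.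
  by rewrite !nnegrE powR1; apply => //; exact: ltW.
Qed.

(** An infinite sum of nonnegative terms is the supremum of its finite sums, so a bound over J is a
    bound for all finite families; [lball_lnorm] goes back. Finiteness is recorded because [fine]
    would hide infinite entries. *)
Lemma lnorm_lball (J : set int) r (u : int -> \bar R) c : (0 < r)%E -> 0 < c ->
  (forall n, J n -> (0 <= u n)%E) -> (lnorm J r u <= c%:E)%E ->
  (forall n, J n -> u n \is a fin_num) /\
  forall s, uniq s -> (forall n, n \in s -> J n) ->
    lball r s (fun n => fine (u n) / c).
Proof.
move=> r0 c0 u0.
have cV0 : 0 <= c^-1 by rewrite invr_ge0 ltW.
have finu n : J n -> (`|u n| < +oo)%E -> u n \is a fin_num.
  by move=> Jn h; rewrite ge0_fin_numE ?u0// -(gee0_abs (u0 _ Jn)).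
case: r r0 => [e| |]//=; last first.
  move=> _ h; have {}h n : J n -> (`|u n| <= c%:E)%E.
    by move=> Jn; apply: le_trans h; apply: ereal_sup_ubound; exists n.
  have fu n : J n -> u n \is a fin_num.
    by move=> Jn; apply: finu => //; rewrite (le_lt_trans (h _ Jn)) ?ltry.
  split => // s us sJ n ns; have Jn := sJ _ ns.
  rewrite normrM (ger0_norm cV0) ler_pdivrMr// mul1r -lee_fin.
  by rewrite -abse_EFin fineK ?fu// h.
rewrite lte_fin => e0 h.
have {}h : (\esum_(n in J) `|u n| `^ e <= (c `^ e)%:E)%E.
  move/(poweR_le_iff e0 (poweR_ge0 _ _) (ltW c0)) : h.
  by rewrite -poweRrM mulVf ?gt_eqF// poweRe1// esum_ge0// => *; exact: poweR_ge0.
have hs s : uniq s -> (forall n, n \in s -> J n) ->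
    (\sum_(n <- s) `|u n| `^ e <= (c `^ e)%:E)%E.
  move=> us sJ; apply: le_trans h; apply: ereal_sup_ubound.
  exists [set` s]; first by split => //; exact: finite_seq.
  by rewrite -fsbig_seq.
have fu n : J n -> u n \is a fin_num.
  move=> Jn; apply: finu => //; have := hs [:: n] isT.
  rewrite big_seq1 => /(_ _)/le_lt_trans -/(_ _ _ (ltry _)) hh.
  by apply: lty_poweRy (hh _); rewrite ?gt_eqF// => k; rewrite inE => /eqP ->.
split => // s us sJ.
have := hs s us sJ.
rewrite big_seq (eq_bigr (fun n => (`|fine (u n)| `^ e)%:E)); last first.
  by move=> n ns; rewrite -poweR_EFin -abse_EFin fineK//; apply: fu; exact: sJ.
rewrite -big_seq sumEFin lee_fin => hh.
rewrite (eq_bigr (fun n => `|fine (u n)| `^ e * (c^-1) `^ e)); last first.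
  by move=> n _; rewrite normrM (ger0_norm cV0) powRM.
rewrite -mulr_suml; apply: (@le_trans _ _ (c `^ e * c^-1 `^ e)).
  by rewrite ler_wpM2r// powR_ge0.
by rewrite -powRM ?mulfV ?gt_eqF// ?powR1// ltW.
Qed.

Lemma lball_lnorm (J : set int) r (u : int -> \bar R) c : (0 < r)%E -> 0 < c ->
  (forall n, J n -> u n \is a fin_num) ->
  (forall s, uniq s -> (forall n, n \in s -> J n) ->
    lball r s (fun n => fine (u n) / c)) ->
  (lnorm J r u <= c%:E)%E.
Proof.
move=> r0 c0 fu.
have cV0 : 0 <= c^-1 by rewrite invr_ge0 ltW.
case: r r0 => [e| |]//=; last first.
  move=> _ h; apply: ge_ereal_sup => _ [n Jn <-].
  have := h [:: n] isT _ n; rewrite inE eqxx => /(_ _ isT).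
  rewrite normrM (ger0_norm cV0) ler_pdivrMr// mul1r -lee_fin -abse_EFin.
  by rewrite fineK ?fu//; apply => k; rewrite inE => /eqP ->.
rewrite lte_fin => e0 h.
apply/(poweR_le_iff e0 (poweR_ge0 _ _) (ltW c0)).
rewrite -poweRrM mulVf ?gt_eqF// poweRe1; last first.
  by apply: esum_ge0 => *; exact: poweR_ge0.
apply: ge_ereal_sup => _ [A [fA AJ] <-]; rewrite fsbig_finite//=.
have sJ n : n \in fset_set A -> J n by rewrite in_fset_set// inE => /AJ.
have -> : (\sum_(n <- fset_set A) `|u n| `^ e =
    (\sum_(n <- fset_set A) `|fine (u n)| `^ e)%:E)%E.
  rewrite -sumEFin; apply: eq_big_seq => n ns.
  by rewrite -poweR_EFin -abse_EFin fineK//; apply: fu; exact: sJ.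
have := h (fset_set A) (fset_uniq _) sJ; rewrite lee_fin.
rewrite (eq_bigr (fun n => `|fine (u n)| `^ e * (c^-1) `^ e)); last first.
  by move=> n _; rewrite normrM (ger0_norm cV0) powRM.
rewrite -mulr_suml => hh.
have ce0 : 0 < c^-1 `^ e by rewrite powR_gt0// invr_gt0.
rewrite -(ler_pM2r ce0) (le_trans hh)// -powRM ?(ltW c0)// mulfV ?gt_eqF//.
by rewrite powR1.
Qed.

End FiniteSequences.

(** * Disjointly supported sums and selection *)

Section Disjoint.
Context d (T : measurableType d) (R : realType).
Variable mu : {measure set T -> \bar R}.
Implicit Types (p : \bar R) (U f y : T -> R) (E : int -> set T) (c M : R).

Definition disjoint_family E := forall m n x, E m x -> E n x -> m = n.

Lemma measurable_big (I : Type) (s : seq I) (f : I -> T -> R) :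
  (forall i, measurable_fun setT (f i)) ->
  measurable_fun setT (fun x => \sum_(i <- s) f i x).
Proof. by move=> mf; exact: measurable_sum. Qed.

(** At most one term is nonzero at a point. With F the map z |-> |z * U|^r this makes the r-th
    powers of disjoint pieces additive. *)
Lemma cut_sum_disjoint (F : R -> R) (s : seq int) E (g : int -> T -> R) x :
  uniq s -> disjoint_family E -> F 0 = 0 ->
  F (\sum_(n <- s) cut (E n) (g n) x) = \sum_(n <- s) F (cut (E n) (g n) x).
Proof.
move=> us dE F0; elim: s us => [|n s IH]; first by rewrite !big_nil.
move=> /= /andP[ns us]; rewrite !big_cons.
have [Ex|nEx] := pselect (E n x).
  have h k : k \in s -> cut (E k) (g k) x = 0.
    by move=> ks; rewrite cutF// => /dE /(_ Ex) kn; rewrite -kn ks in ns.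
  by rewrite !big1_seq ?addr0// => k /andP[_ ks]; rewrite h.
by rewrite (cutF _ nEx) add0r F0 add0r IH.
Qed.

Lemma wnorm_sum (I : Type) (s : seq I) p U (f : I -> T -> R) :
  (1 <= p)%E -> weight U -> (forall i, measurable_fun setT (f i)) ->
  (wnorm mu p U (fun x => (\sum_(i <- s) f i x)%R) <=
   \sum_(i <- s) wnorm mu p U (f i))%E.
Proof.
move=> p1 wU mf; elim: s => [|i s IH].
  rewrite big_nil (_ : (fun _ => _) = (fun=> 0)) ?wnorm0//.
  by apply/funext => x; rewrite big_nil.
rewrite big_cons (_ : (fun _ => _) = (f i \+ (fun x => \sum_(i <- s) f i x))%R).
  by apply: (le_trans (wnormD _ _ _ _ _)) => //; [exact: measurable_big|exact: leeD].
by apply/funext => x; rewrite big_cons.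
Qed.

Lemma wnorm_sum_le (I : eqType) (s : seq I) p U (f : I -> T -> R) (b : I -> R) :
  (1 <= p)%E -> weight U -> (forall i, measurable_fun setT (f i)) ->
  (forall i, i \in s -> wnorm mu p U (f i) <= (b i)%:E)%E ->
  (wnorm mu p U (fun x => (\sum_(i <- s) f i x)%R) <= (\sum_(i <- s) b i)%:E)%E.
Proof.
move=> p1 wU mf fb; apply: (le_trans (wnorm_sum _ _ _ _)) => //.
by rewrite -sumEFin big_seq [leRHS]big_seq; exact: lee_sum.
Qed.

(** For disjoint supports the p-th powers of the norms add, so a point of the l_p ball costs nothing
    beyond c; the triangle inequality would only allow l_1. *)
Lemma wnorm_sum_disjoint p U E (g : int -> T -> R) (s : seq int) (x : int -> R) c :
  (1 <= p)%E -> weight U -> uniq s -> disjoint_family E ->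
  (forall n, measurable (E n)) -> (forall n, measurable_fun setT (g n)) ->
  0 < c ->
  (forall n, n \in s -> wnorm mu p U (cut (E n) (g n)) <= (c * `|x n|)%:E)%E ->
  lball p s x ->
  (wnorm mu p U (fun t => (\sum_(n <- s) cut (E n) (g n) t)%R) <= c%:E)%E.
Proof.
move=> p1 wU us dE mE mg c0 gx; have c0' := ltW c0.
have mcut n := measurable_cut (mE n) (mg n).
case: p p1 gx => [r| |]//; rewrite ?lee_fin => r1 gx.
  have r0 : 0 < r by rewrite (lt_le_trans _ r1).
  move=> /= xp; apply/wnorm_finP => //.
  have -> : (\int[mu]_t (`|(\sum_(n <- s) cut (E n) (g n) t) * U t| `^ r)%:E =
      \int[mu]_t (\sum_(n <- s) (`|cut (E n) (g n) t * U t| `^ r)%:E))%E.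
    apply: eq_integral => t _; rewrite sumEFin; congr EFin.
    by rewrite (@cut_sum_disjoint (fun z => `|z * U t| `^ r))// mul0r normr0
      powR0// gt_eqF.
  rewrite ge0_integral_sum//; last by move=> n; exact: measurable_wpow.
  apply: (@le_trans _ _ (\sum_(n <- s) ((c `^ r) * (`|x n| `^ r))%:E)%E).
    rewrite big_seq [leRHS]big_seq; apply: lee_sum => n ns.
    by rewrite -powRM//; apply/wnorm_finP; rewrite ?mulr_ge0// gx.
  by rewrite sumEFin lee_fin -mulr_sumr ler_piMr// powR_ge0.
move=> /= xp; apply/wnorm_ooP => //.
(* Finitely many exceptional sets are merged as a family indexed by [nat]; indices past the end of
   [s] make the statement vacuous. *)
have : forall k : nat, {ae mu, forall t, `|cut (E (nth 0 s k)) (g (nth 0 s k)) t * U t| <= c \/ (size s <= k)%N}.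
  move=> k; have [ks|sk] := ltnP k (size s); last by apply: nearW; right.
  have ns : nth 0 s k \in s by exact: mem_nth.
  have /wnorm_ooP : (wnorm mu +oo U (cut (E (nth 0%R s k)) (g (nth 0%R s k))) <= c%:E)%E.
    by rewrite (le_trans (gx _ ns))// lee_fin ler_piMr// xp.
  by move=> /(_ c0'); apply: filterS => t; left.
move/ae_foralln; apply: filterS => t h.
rewrite (@cut_sum_disjoint (fun z => `|z * U t|))//; last by rewrite mul0r normr0.
have [[n ns Ent]|nE] := pselect (exists2 n, n \in s & E n t).
  rewrite (bigD1_seq n)//= big1 ?addr0; last first.
    move=> k /eqP kn; rewrite cutF ?mul0r ?normr0//.
    by move=> /dE /(_ Ent).
  by have [|] := h (index n s); [rewrite nth_index|rewrite leqNgt index_mem ns].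
rewrite big1_seq// => k /andP[_ ks]; rewrite cutF ?mul0r ?normr0// => Ekt.
by apply: nE; exists k.
Qed.

(** The opposite direction to [wnorm_sum_disjoint]: the integrals of one function over disjoint sets
    add up to at most its full integral. *)
Lemma wnorm_lball_disjoint p U E f (s : seq int) c :
  (1 <= p)%E -> weight U -> uniq s -> disjoint_family E ->
  (forall n, measurable (E n)) -> measurable_fun setT f ->
  0 < c -> (wnorm mu p U f <= c%:E)%E ->
  lball p s (fun n => fine (wnorm mu p U (cut (E n) f)) / c).
Proof.
move=> p1 wU us dE mE mf c0 fc; have c0' := ltW c0.
have mcut n := measurable_cut (mE n) mf.
have cutfc n : (wnorm mu p U (cut (E n) f) <= c%:E)%E.
  apply: le_trans fc; apply: wnorm_le => //.
  by apply: nearW => x; exact: norm_cut.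
have cutfin n : wnorm mu p U (cut (E n) f) \is a fin_num.
  by rewrite ge0_fin_numE ?wnorm_ge0// (le_lt_trans (cutfc n))// ltry.
have nE n : `|fine (wnorm mu p U (cut (E n) f)) / c| = fine (wnorm mu p U (cut (E n) f)) / c.
  by rewrite ger0_norm// divr_ge0// fine_ge0// wnorm_ge0.
case: p p1 fc cutfc cutfin nE => [r| |]//; rewrite ?lee_fin => r1 fc cutfc cutfin nE.
  have r0 : 0 < r by rewrite (lt_le_trans _ r1).
  rewrite /=; under eq_bigr do rewrite nE powRM ?invr_ge0 ?fine_ge0 ?wnorm_ge0//.
  rewrite -mulr_suml.
  have cr : c^-1 `^ r = (c `^ r)^-1 by rewrite -powR_inv1// -powRrM mulN1r powRN.
  rewrite cr ler_pdivrMr ?powR_gt0// mul1r -lee_fin -sumEFin.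
  move/wnorm_finP : fc => /(_ r1 c0'); apply: le_trans.
  have cutE n : ((fine (wnorm mu r%:E U (cut (E n) f)) `^ r)%:E =
     \int[mu]_t (`|cut (E n) f t * U t| `^ r)%:E)%E.
    rewrite -poweR_EFin fineK//; rewrite /wnorm powR_Lnorm ?gt_eqF//.
  under eq_bigr do rewrite cutE.
  rewrite -ge0_integral_sum//; last by move=> n; exact: measurable_wpow.
  apply: ge0_le_integral => //.
  - by move=> t _; apply: sume_ge0 => n _; rewrite lee_fin powR_ge0.
  - by apply: emeasurable_sum => n; exact: measurable_wpow.
  - exact: measurable_wpow.
  - move=> t _; rewrite sumEFin lee_fin.
    rewrite -(@cut_sum_disjoint (fun z => `|z * U t| `^ r))//; last first.
      by rewrite mul0r normr0 powR0// gt_eqF.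
    have [[n ns Ent]|nEt] := pselect (exists2 n, n \in s & E n t).
      rewrite (bigD1_seq n)//= big1 ?addr0 ?cutT//.
      by move=> k /eqP kn; rewrite cutF// => /dE /(_ Ent).
    rewrite big1_seq ?mul0r ?normr0 ?powR0 ?gt_eqF ?powR_ge0// => k /andP[_ ks].
    by rewrite cutF// => Ekt; apply: nEt; exists k.
move=> n ns /=; rewrite nE ler_pdivrMr// mul1r -lee_fin fineK//.
Qed.

End Disjoint.

Section Selection.
Context d (T : measurableType d) (R : realType).
Variable mu : {measure set T -> \bar R}.
Implicit Types (p : \bar R) (U f y : T -> R) (E : int -> set T) (c M : R).

Lemma sum_geometric_le (l : R) n : 0 < l -> l < 1 ->
  \sum_(i < n) l ^+ i <= (1 - l)^-1.
Proof.
move=> l0 l1; have l1' : 0 < 1 - l by rewrite subr_gt0.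
rewrite -[leRHS]mul1r ler_pdivlMr//; set S := \sum_(i < n) _.
have -> : S * (1 - l) = 1 - l ^+ n by rewrite -(opprB (l ^+ n)) subrX1 -/S; ring.
by rewrite gerBl exprn_ge0// ltW.
Qed.

Lemma geometric_small (l c : R) : 0 < l -> l < 1 -> 0 < c ->
  exists k, forall n, (k <= n)%N -> l ^+ n <= c.
Proof.
move=> l0 l1 c0; have : (l ^+ n @[n --> \oo] --> (0 : R)).
  by apply: cvg_expr; rewrite ger0_norm// ltW.
move/cvgrPdist_le => /(_ _ c0) [k _ h]; exists k => n kn.
by have := h n kn; rewrite sub0r normrN ger0_norm// exprn_ge0// ltW.
Qed.

Lemma measurable_abs_le y f : measurable_fun setT y -> measurable_fun setT f ->
  measurable [set x | `|y x| <= 2 * `|f x|].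
Proof.
move=> my mf; rewrite -[X in measurable X]setTI.
apply: measurable_fun_le => //; first exact: measurableT_comp.
by apply: measurable_funM => //; exact: measurableT_comp.
Qed.

Lemma wnorm_cut_dom p U y f c : (1 <= p)%E -> weight U -> measurable_fun setT y ->
  measurable_fun setT f -> forall A, measurable A -> 0 <= c ->
  (forall x, A x -> `|y x| <= 2 * `|f x|) -> (wnorm mu p U f <= c%:E)%E ->
  (wnorm mu p U (cut A y) <= (2 * c)%:E)%E.
Proof.
move=> p1 wU my mf A mA c0 yf fc.
have := wnormZ 2 p1 wU mf c0 fc; rewrite normr_nat; apply: le_trans.
apply: wnorm_le => //; first exact: measurable_cut.
  exact: measurable_funM.
apply: nearW => x; have [Ax|/cutF ->] := pselect (A x).
  by rewrite cutT// normrM normr_nat yf.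
by rewrite normr0.
Qed.

(** Triangle inequality on finite unions, whose pieces may overlap, then a monotone limit. The
    factor 2 is that of the domination, 1 / (1 - l) the sum of the series. *)
Lemma wnorm_cut_bigcup p U y (u : nat -> T -> R) (G : nat -> set T) M l :
  (1 <= p)%E -> weight U -> measurable_fun setT y ->
  (forall j, measurable_fun setT (u j)) -> (forall j, measurable (G j)) ->
  (forall j x, G j x -> `|y x| <= 2 * `|u j x|) ->
  0 <= M -> 0 < l -> l < 1 ->
  (forall j, wnorm mu p U (u j) <= (M * l ^+ j)%:E)%E ->
  (wnorm mu p U (cut (\bigcup_j G j) y) <= (2 * M / (1 - l))%:E)%E.
Proof.
move=> p1 wU my mu_ mG Gy M0 l0 l1 uM.
have l1' : 0 < 1 - l by rewrite subr_gt0.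
pose F k := \bigcup_(j in [set j | (j < k)%N]) G j.
have -> : \bigcup_j G j = \bigcup_k F k.
  apply/seteqP; split => [x [j _ Gj]|x [k _ [j _ Gj]]]; last by exists j.
  by exists j.+1 => //; exists j => /=.
have mF k : measurable (F k) by apply: bigcup_measurable => j _.
apply: wnorm_cut_lim => //.
- by rewrite divr_ge0 ?mulr_ge0// ltW.
- by move=> n m nm; apply/subsetPset => x [j /= jn Gj]; exists j => //=; exact: leq_trans nm.
move=> k; apply: (@le_trans _ _ (\sum_(j < k) (2 * (M * l ^+ j)))%:E); last first.
  rewrite lee_fin -mulr_sumr -mulr_sumr mulrA ler_wpM2l ?mulr_ge0//.
  exact: sum_geometric_le.
have mcut (j : 'I_k) := measurable_cut (mG j) my.
apply: (@le_trans _ _ (wnorm mu p U (fun x => \sum_(j < k) `|cut (G j) y x|))).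
  apply: wnorm_le => //; first exact: measurable_cut.
    by apply: measurable_big => j; exact: measurableT_comp.
  apply: nearW => x; have [[j /= jk Gj]|/cutF ->] := pselect (F k x); last by rewrite normr0.
  rewrite cutT; last by exists j.
  rewrite [leRHS]ger0_norm ?sumr_ge0// (bigD1 (Ordinal jk))//= cutT//.
  by rewrite lerDl sumr_ge0.
apply: wnorm_sum_le => //; first by move=> j; exact: measurableT_comp.
move=> j _; apply: (@le_trans _ _ (wnorm mu p U (cut (G j) y))).
  apply: wnorm_le => //; first exact: measurableT_comp.
  by apply: nearW => x; rewrite normr_id.
by apply: (wnorm_cut_dom p1 wU my (mu_ j)) => //; [rewrite mulr_ge0// exprn_ge0// ltW|exact: Gy].
Qed.

Lemma ae0_of_small p U y : (1 <= p)%E -> weight U -> measurable_fun setT y ->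
  (forall e : R, 0 < e -> (wnorm mu p U y <= e%:E)%E) -> {ae mu, forall x, y x = 0}.
Proof.
move=> p1 wU my ye; apply: (@wnorm_eq0 _ _ _ mu p U) => //; apply/eqP.
rewrite eq_le wnorm_ge0 andbT; apply/lee_addgt0Pr => e e0.
by rewrite add0e ye.
Qed.

(* The couple is relatively complete in the sense of Gagliardo, up to a factor 2. *)
Lemma wnorm_le_of_decompositions p0 p1 U0 U1 y M :
  (1 <= p0)%E -> (1 <= p1)%E -> weight U0 -> weight U1 ->
  measurable_fun setT y -> 0 <= M ->
  (forall e : R, 0 < e -> exists u v : T -> R,
    [/\ measurable_fun setT u, measurable_fun setT v,
        forall x, y x = u x + v x,
        (wnorm mu p0 U0 u <= e%:E)%E & (wnorm mu p1 U1 v <= M%:E)%E]) ->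
  (wnorm mu p1 U1 y <= (2 * M)%:E)%E.
Proof.
move=> hp0 hp1 w0 w1 my M0 H.
have half0 : (0 : R) < 2^-1 by rewrite invr_gt0.
have half1 : 2^-1 < 1 :> R by rewrite invf_lt1 ?ltr1n.
have /choice[u Hu] (k : nat) := H (2^-1 ^+ k) (exprn_gt0 k half0).
have /choice[v {}Hu] k := Hu k.
have mu_ k : measurable_fun setT (u k) by case: (Hu k).
have mv k : measurable_fun setT (v k) by case: (Hu k).
pose G k := [set x | ~ `|y x| <= 2 * `|v k x|].
have mG k : measurable (G k) by apply: measurableC; exact: measurable_abs_le.
have Gu k x : G k x -> `|y x| <= 2 * `|u k x|.
  move=> /negP; rewrite -ltNge => vy; case: (Hu k) => _ _ /(_ x) yE _ _.
  have := ler_normD (u k x) (v k x); rewrite -yE; lra.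
(* Borel-Cantelli: on [G k] the small part u k dominates, with norm at most 2^-k, so y vanishes
   almost everywhere on the points lying in infinitely many [G k]. Off [Z k] the part v k dominates,
   whence the factor 2. *)
pose Z k := \bigcup_j G (k + j)%N.
have mZ k : measurable (Z k) by exact: bigcup_measurable.
pose F k := ~` Z k.
have mF k : measurable (F k) by exact: measurableC.
have FZ : \bigcup_k F k = ~` \bigcap_k Z k by rewrite setC_bigcap.
have cF : (wnorm mu p1 U1 (cut (\bigcup_k F k) y) <= (2 * M)%:E)%E.
  apply: wnorm_cut_lim => //; first by rewrite mulr_ge0.
    move=> n m nm; apply/subsetPset; apply: subsetC => x [j _ Gj].
    by exists (m - n + j)%N => //; rewrite addnA subnKC.
  move=> k; apply: (wnorm_cut_dom hp1 w1 my (mv k)) => //.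
    move=> x Fx; rewrite leNgt; apply/negP => h; apply: Fx; exists 0%N => //.
    by rewrite addn0 /G /= => h'; rewrite ltNge h' in h.
  by case: (Hu k).
have mZZ : measurable (\bigcap_k Z k) by apply: bigcapT_measurable.
have zero : {ae mu, forall x, cut (\bigcap_k Z k) y x = 0}.
  apply: (ae0_of_small hp0 w0); first exact: measurable_cut.
  move=> e e0; have e4 : 0 < e / 4 by rewrite divr_gt0.
  have [k hk] := geometric_small half0 half1 e4.
  apply: (@le_trans _ _ (wnorm mu p0 U0 (cut (Z k) y))).
    apply: wnorm_le => //; [exact: measurable_cut..|].
    apply: nearW => x; have [Zx|/cutF ->] := pselect ((\bigcap_k Z k) x); last by rewrite normr0.
    by rewrite !cutT//; exact: Zx.
  apply: (le_trans (@wnorm_cut_bigcup p0 U0 y (fun j => u (k + j)%N) _ (2^-1 ^+ k) 2^-1 _ _ _ _ _ _ _ _ _ _)) => //.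
  - by move=> j x; exact: Gu.
  - by move=> j; rewrite -exprD; case: (Hu (k + j)%N).
  - rewrite lee_fin; have -> : (1 - 2^-1 : R)^-1 = 2 by rewrite (_ : 1 - 2^-1 = 2^-1 :> R) ?invrK //; lra.
    by have := hk k (leqnn k); lra.
apply: le_trans cF; apply: wnorm_le => //.
  by apply: measurable_cut => //; exact: bigcup_measurable.
apply: filterS zero => x; have [Fx _|nF] := pselect ((\bigcup_k F k) x); first by rewrite cutT.
rewrite cutT; first by move=> ->; rewrite normr0.
by apply: contrapT => nZ; apply: nF; rewrite FZ.
Qed.

Lemma geo_down (Q : int -> R) l m k : 0 < l -> (forall n, Q (n - 1) <= l * Q n) ->
  Q (m - k%:Z) <= l ^+ k * Q m.
Proof.
move=> l0 Ql; elim: k => [|k IH]; first by rewrite subr0 mul1r.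
have -> : m - k.+1%:Z = m - k%:Z - 1 by lia.
by rewrite (le_trans (Ql _))// exprS -mulrA ler_wpM2l// ltW.
Qed.

Lemma geo_up (Q : int -> R) l m k : 0 < l -> (forall n, Q (n + 1) <= l * Q n) ->
  Q (m + k%:Z) <= l ^+ k * Q m.
Proof.
move=> l0 Ql; elim: k => [|k IH]; first by rewrite addr0 mul1r.
have -> : m + k.+1%:Z = m + k%:Z + 1 by lia.
by rewrite (le_trans (Ql _))// exprS -mulrA ler_wpM2l// ltW.
Qed.

(* E n collects the points where n is the first index with |y| <= 2|h n|; there
   |y| <= 2|y - h m| for all m < n, so both halves of the decomposition dominate. *)
Lemma selection p0 p1 U0 U1 y (h : int -> T -> R) (Q S : int -> R) l C :
  (1 <= p0)%E -> (1 <= p1)%E -> weight U0 -> weight U1 ->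
  measurable_fun setT y -> (forall n, measurable_fun setT (h n)) ->
  0 < l -> l < 1 -> 0 < C -> (forall n, 0 < Q n) -> (forall n, 0 < S n) ->
  (forall n, Q (n - 1) <= l * Q n) -> (forall n, S (n + 1) <= l * S n) ->
  (forall n, wnorm mu p0 U0 (h n) <= (C * Q n)%:E)%E ->
  (forall n, wnorm mu p1 U1 (fun x => (y x - h n x)%R) <= (C * S n)%:E)%E ->
  exists E : int -> set T,
   [/\ forall n, measurable (E n), disjoint_family E,
       forall n x, E n x -> y x != 0 /\ `|y x| <= 2 * `|h n x|,
       forall n m x, m < n -> E n x -> `|y x| <= 2 * `|y x - h m x| &
   [/\ {ae mu, forall x, y x != 0 -> exists n, E n x},
       forall m, (wnorm mu p0 U0 (cut (\bigcup_j E (m - j%:Z)%R) y) <=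
          (2 * (C * Q m) / (1 - l))%:E)%E &
       forall m, (wnorm mu p1 U1 (cut (\bigcup_j E (m + 1 + j%:Z)%R) y) <=
          (2 * (C * S m))%:E)%E ]].
Proof.
move=> hp0 hp1 w0 w1 my mh l0 l1 C0 Q0 S0 Ql Sl hQ hS.
pose G n := [set x | y x != 0] `&` [set x | `|y x| <= 2 * `|h n x|].
pose E n := G n `\` \bigcup_j G (n - 1 - j%:Z).
have mG n : measurable (G n).
  apply: measurableI; last exact: measurable_abs_le.
  have -> : [set x | y x != 0] = y @^-1` (~` [set 0]).
    by apply/seteqP; split => x /= /eqP.
  by rewrite -[X in measurable X]setTI; apply: my => //; apply: measurableC.
have mE n : measurable (E n) by apply: measurableD => //; exact: bigcup_measurable.
have Elt n m x : m < n -> E n x -> ~ G m x.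
  move=> mn [_ nG] Gm; apply: nG; exists (absz (n - 1 - m)%R) => //.
  by have -> : n - 1 - (absz (n - 1 - m)%R)%:Z = m by lia.
have sm n x m : m < n -> E n x -> `|y x| <= 2 * `|y x - h m x|.
  move=> mn Ex; have nG := Elt _ _ _ mn Ex; case: Ex => [[y0 _] _].
  have : ~ `|y x| <= 2 * `|h m x| by move=> h'; exact: nG.
  move=> /negP; rewrite -ltNge => yh.
  have := ler_normD (y x - h m x) (h m x); rewrite subrK; lra.
have mB m : measurable (\bigcup_j E (m - j%:Z)%R) by exact: bigcup_measurable.
have low m : (wnorm mu p0 U0 (cut (\bigcup_j G (m - j%:Z)%R) y) <=
          (2 * (C * Q m) / (1 - l))%:E)%E.
  apply: (@wnorm_cut_bigcup _ _ _ (fun j => h (m - j%:Z))) => //.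
  - by move=> j x [].
  - by rewrite mulr_ge0// ltW.
  move=> j; apply: (le_trans (hQ _)); rewrite lee_fin -mulrA ler_wpM2l ?(ltW C0)//.
  by rewrite mulrC; exact: geo_down.
have mGB m : measurable (\bigcup_j G (m - j%:Z)%R) by exact: bigcup_measurable.
exists E; split => //.
- move=> m n x Em En; case: (ltgtP m n) => // mn; exfalso.
  + by apply: (Elt _ _ _ mn En); case: Em.
  + by apply: (Elt _ _ _ mn Em); case: En.
- by move=> n x [[]].
- by move=> n m x mn Ex; exact: (sm n).
split.
(* Two sets carry no part of y: the points of no [G n], where y is dominated by y - h k with norm of
   order S k for every k, and the points of [G n] for arbitrarily low n, where the bound of order Q
   (- k) holds for every k. Elsewhere there is a first index. *)
- pose Z1 := ~` (\bigcup_j G j%:Z `|` \bigcup_j G (- j%:Z)).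
  pose Z2 := \bigcap_k \bigcup_j G (- k%:Z - j%:Z).
  have mZ1 : measurable Z1.
    by apply: measurableC; apply: measurableU; exact: bigcup_measurable.
  have mZ2 : measurable Z2 by apply: bigcapT_measurable => k; exact: mGB.
  have z1 : {ae mu, forall x, cut Z1 y x = 0}.
    apply: (ae0_of_small hp1 w1); first exact: measurable_cut.
    move=> e e0; have e1 : 0 < e / (2 * (C * S 0)) by rewrite divr_gt0// !mulr_gt0.
    have [k /(_ k (leqnn k)) hk] := geometric_small l0 l1 e1.
    apply: (@le_trans _ _ (2 * (C * S k%:Z))%:E).
      apply: (wnorm_cut_dom hp1 w1 my _ mZ1 _ _ (hS k%:Z)).
      + exact: measurable_funB.
      + by rewrite mulr_ge0// ltW.
      move=> x Z1x; have [->|y0] := eqVneq (y x) 0; first by rewrite normr0 mulr_ge0.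
      have nG : ~ G k%:Z x by move=> Gk; apply: Z1x; left; exists k.
      have : ~ `|y x| <= 2 * `|h k%:Z x| by move=> h'; exact: nG.
      move=> /negP; rewrite -ltNge => yh.
      have := ler_normD (y x - h k%:Z x) (h k%:Z x); rewrite subrK; lra.
    rewrite lee_fin; have := @geo_up S l 0 k l0 Sl; rewrite add0r => Sk.
    move: hk; rewrite ler_pdivlMr ?mulr_gt0// => hk.
    apply: le_trans hk; rewrite [leRHS]mulrCA ler_wpM2l// [leRHS]mulrCA ler_wpM2l// ltW//.
  have z2 : {ae mu, forall x, cut Z2 y x = 0}.
    apply: (ae0_of_small hp0 w0); first exact: measurable_cut.
    have l1' : 0 < 1 - l by rewrite subr_gt0.
    move=> e e0; have e1 : 0 < e / (2 * (C * Q 0) / (1 - l)).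
      by rewrite !divr_gt0// !mulr_gt0.
    have [k /(_ k (leqnn k)) hk] := geometric_small l0 l1 e1.
    apply: (@le_trans _ _ (wnorm mu p0 U0 (cut (\bigcup_j G (- k%:Z - j%:Z)%R) y))).
      apply: wnorm_le => //; [exact: measurable_cut..|].
      apply: nearW => x; have [Zx|/cutF ->] := pselect (Z2 x); last by rewrite normr0.
      by rewrite !cutT//; exact: Zx.
    apply: (le_trans (low _)); rewrite lee_fin.
    have := @geo_down Q l 0 k l0 Ql; rewrite sub0r => Qk.
    move: hk; rewrite ler_pdivlMr ?divr_gt0 ?mulr_gt0// => hk; apply: le_trans hk.
    rewrite [leRHS]mulrA ler_wpM2r ?invr_ge0 ?(ltW l1')//.
    by rewrite [leRHS]mulrCA ler_wpM2l// [leRHS]mulrCA ler_wpM2l// ltW.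
  apply: filterS2 z1 z2 => x z1x z2x y0.
  have [n Gn] : exists n, G n x.
    apply: contrapT => nG; case/eqP: y0; rewrite -z1x cutT//.
    by move=> [] [j _ Gj]; apply: nG; eexists; exact: Gj.
  have [k nk] : exists k : nat, forall j : nat, ~ G (- k%:Z - j%:Z) x.
    apply: contrapT => nk; case/eqP: y0; rewrite -z2x cutT// => k _.
    by apply: contrapT => nGk; apply: nk; exists k => j Gj; apply: nGk; exists j.
  have nlt i : i <= - k%:Z -> ~ G i x.
    move=> ik; have := nk (absz (- k%:Z - i)%R).
    by have -> : - k%:Z - (absz (- k%:Z - i)%R)%:Z = i by lia.
  have exP : exists i : nat, `[< G (- k%:Z + i%:Z) x >].
    exists (absz (n + k%:Z)%R); apply/asboolP.
    have -> // : - k%:Z + (absz (n + k%:Z)%R)%:Z = n.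
    have : - k%:Z < n by rewrite ltNge; apply/negP => /nlt.
    lia.
  case: (ex_minnP exP) => i /asboolP Gi imin; exists (- k%:Z + i%:Z); split => //.
  move=> [j _ Gj]; have [|jk] := lerP (- k%:Z + i%:Z - 1 - j%:Z) (- k%:Z).
    by move/nlt.
  have := imin (i - 1 - j)%N; rewrite (_ : - k%:Z + (i - 1 - j)%N%:Z =
    - k%:Z + i%:Z - 1 - j%:Z); last by lia.
  by move=> /(_ (introT (asboolP _) Gj)); lia.
- move=> m; apply: le_trans (low m); apply: wnorm_le => //; [exact: measurable_cut..|].
  apply: nearW => x; have [[j _ [Gj _]]|/cutF ->] := pselect ((\bigcup_j E (m - j%:Z)%R) x); last by rewrite normr0.
  by rewrite [leRHS](_ : _ = `|y x|) ?norm_cut// cutT//; exists j.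
- move=> m; apply: (wnorm_cut_dom hp1 w1 my _ _ _ _ (hS m)).
  + exact: measurable_funB.
  + exact: bigcup_measurable.
  + by rewrite mulr_ge0// ltW.
  + by move=> x [j _ Ej]; apply: sm Ej; lia.
Qed.

End Selection.

(** * The Hahn-Banach theorem *)

Section HahnBanach.
Context (R : realType) (V : lmodType R) (D : set V) (p : V -> R) (b : V).
Hypothesis D0 : D 0.
Hypothesis D_lin : forall (c : R) x y, D x -> D y -> D (c *: x + y).
Hypothesis pD : forall x y, D x -> D y -> p (x + y) <= p x + p y.
Hypothesis pZ : forall (c : R) x, D x -> p (c *: x) = `|c| * p x.
Hypothesis Db : D b.

Let DZ (c : R) x : D x -> D (c *: x).
Proof. by move=> Dx; rewrite -[_ *: _]addr0; exact: D_lin. Qed.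

Let DD x y : D x -> D y -> D (x + y).
Proof. by move=> Dx Dy; rewrite -[x]scale1r; exact: D_lin. Qed.

Let p0 : p 0 = 0.
Proof. by have := pZ 0 D0; rewrite scale0r normr0 mul0r. Qed.

(** Partial functionals are kept as graphs, so that the union of a chain is again a candidate.
    Single-valuedness is not demanded: the difference of two values at one point is a value at 0,
    hence at most p 0 = 0. *)
Let dominated_graph (G : set (V * R)) :=
  [/\ G (b, p b),
      forall (c : R) x r y s, G (x, r) -> G (y, s) -> G (c *: x + y, c * r + s) &
      forall x r, G (x, r) -> D x /\ r <= p x].

Let graphZ G (c : R) x r : dominated_graph G -> G (x, r) -> G (c *: x, c * r).
Proof.
move=> [_ Glin _] Gx; have G0 : G (0, 0).
  by have := Glin (-1) _ _ _ _ Gx Gx; rewrite scaleN1r mulN1r !addNr.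
by have := Glin c _ _ _ _ Gx G0; rewrite !addr0.
Qed.

Let graph_fun G x r s : dominated_graph G -> G (x, r) -> G (x, s) -> r = s.
Proof.
move=> [_ Glin Gdom]; have le r' s' : G (x, r') -> G (x, s') -> s' <= r'.
  move=> Gr Gs; have := Glin (-1) _ _ _ _ Gr Gs; rewrite scaleN1r addNr mulN1r.
  by move=> /Gdom[_]; rewrite p0 addrC subr_le0.
by move=> Gr Gs; apply/eqP; rewrite eq_le !le.
Qed.

Let graph_extend G x0 : dominated_graph G -> D x0 ->
  exists G', [/\ dominated_graph G', G `<=` G' & exists r, G' (x0, r)].
Proof.
move=> gG Dx0; have [Gb Glin Gdom] := gG.
pose A := [set z : R | exists x r, G (x, r) /\ z = r - p (x - x0)].
have Asup x r y s : G (x, r) -> G (y, s) -> r - p (x - x0) <= p (y + x0) - s.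
  move=> Gx Gy; have := Glin 1 _ _ _ _ Gx Gy; rewrite scale1r mul1r => /Gdom[_ h].
  have [Dx _] := Gdom _ _ Gx; have [Dy _] := Gdom _ _ Gy.
  have h2 : p (x + y) <= p (x - x0) + p (y + x0).
    have -> : x + y = (x - x0) + (y + x0) by rewrite addrACA addNr addr0.
    by apply: pD; apply: DD => //; rewrite -scaleN1r; exact: DZ.
  by rewrite lerBlDr addrAC lerBrDr (le_trans h)// addrC.
have A0 : A !=set0 by exists (p b - p (b - x0)), b, (p b).
have Aub : has_ubound A.
  by exists (p (b + x0) - p b) => _ [x [r [Gx ->]]]; exact: Asup.
(* The value at x0 has to lie between all r - p (x - x0) and all p (y + x0) - s; subadditivity
   separates the two families, and the supremum of the first is taken. *)
pose al := sup A.
have al1 x r : G (x, r) -> r - p (x - x0) <= al.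
  by move=> Gx; apply: ub_le_sup => //; exists x, r.
have al2 y s : G (y, s) -> al <= p (y + x0) - s.
  by move=> Gy; apply: ge_sup => // _ [x [r [Gx ->]]]; exact: Asup.
exists [set z | exists x r (c : R), G (x, r) /\ z = (x + c *: x0, r + c * al)].
split.
- split.
  + by exists b, (p b), 0; rewrite scale0r mul0r !addr0.
  + move=> c _ _ _ _ [x [r [e [Gx [-> ->]]]]] [y [s [f [Gy [-> ->]]]]].
    exists (c *: x + y), (c * r + s), (c * e + f); split; first exact: Glin.
    congr pair; last by ring.
    by rewrite scalerDr scalerDl scalerA addrACA.
  + move=> _ _ [x [r [c [Gx [-> ->]]]]]; have [Dx rp] := Gdom _ _ Gx.
    split; first by rewrite addrC; exact: D_lin.
    have [c0|c0|->] := ltgtP c 0; last by rewrite scale0r mul0r !addr0.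
    * have Gx' := graphZ (- c)^-1 gG Gx.
      have := al1 _ _ Gx'; rewrite lerBlDr addrC.
      have -> : p ((- c)^-1 *: x - x0) = (- c)^-1 * p (x + c *: x0).
        rewrite -[(- c)^-1 in RHS]ger0_norm ?invr_ge0 ?oppr_ge0 ?ltW// -pZ; last first.
          by apply: DD => //; exact: DZ.
        rewrite scalerDr scalerA invrN mulNr mulVf ?lt_eqF//.
        by rewrite scaleN1r.
      rewrite -lerBlDr -(ler_pM2l (_ : 0 < - c)) ?oppr_gt0// mulrBr mulVKf ?oppr_eq0 ?lt_eqF//.
      rewrite mulVKf ?oppr_eq0 ?lt_eqF//.
      by rewrite mulNr opprK.
    * have Gx' := graphZ c^-1 gG Gx.
      have := al2 _ _ Gx'.
      have -> : p (c^-1 *: x + x0) = c^-1 * p (x + c *: x0).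
        rewrite -[c^-1 in RHS]ger0_norm ?invr_ge0 ?ltW// -pZ; last first.
          by apply: DD => //; exact: DZ.
        by rewrite scalerDr scalerA mulVf ?gt_eqF// scale1r.
      rewrite -(ler_pM2l c0) mulrBr !mulVKf ?gt_eqF//.
      by rewrite lerBrDr addrC.
- by move=> [x r] Gx; exists x, r, 0; rewrite scale0r mul0r !addr0.
- have := graphZ 0 gG Gb; rewrite scale0r mul0r => G0.
  by exists al, 0, 0, 1; rewrite scale1r mul1r !add0r.
Qed.

Let line_graph : dominated_graph [set z | exists c : R, z = (c *: b, c * p b)].
Proof.
split.
- by exists 1; rewrite scale1r mul1r.
- move=> c _ _ _ _ [e [-> ->]] [f [-> ->]]; exists (c * e + f).
  by rewrite scalerDl scalerA mulrDl mulrA.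
- move=> _ _ [c [-> ->]]; split; first exact: DZ.
  rewrite pZ// ler_wpM2r ?ler_norm//.
  have := pD Db (DZ (-1) Db); rewrite scaleN1r subrr p0.
  by rewrite -scaleN1r pZ// normrN1 mul1r; lra.
Qed.

(** Relative to a subspace D because the K-functional is finite, hence a seminorm, only on the sum
    of the couple; values of f outside D are junk. *)
Theorem hahn_banach : exists f : V -> R,
  [/\ forall (c : R) x y, D x -> D y -> f (c *: x + y) = c * f x + f y,
      forall x, D x -> `|f x| <= p x & f b = p b].
Proof.
pose P G := G = set0 \/ dominated_graph G.
have [] := @Zorn_bigcup _ P.
  move=> F FP Ftot; have [[G0 FG0 gG0]|nF] := pselect (exists2 G, F G & dominated_graph G).
    right; split.
    - by exists G0 => //; case: gG0.
    - move=> c x r y s [G1 F1 Gx] [G2 F2 Gy].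
      have gd G z : F G -> G z -> dominated_graph G.
        by move=> /FP[->|].
      have [G12|G21] := Ftot _ _ F1 F2.
        exists G2 => //; have [_ Glin _] := gd _ _ F2 Gy.
        by apply: Glin => //; exact: G12.
      exists G1 => //; have [_ Glin _] := gd _ _ F1 Gx.
      by apply: Glin => //; exact: G21.
    - move=> x r [G1 F1 Gx]; have [G10|[_ _ Gdom]] := FP _ F1; last exact: Gdom.
      by move: Gx; rewrite G10.
  left; apply/seteqP; split => // z [G FG Gz]; have [G10|gG] := FP _ FG.
    by move: Gz; rewrite G10.
  by apply: nF; exists G.
move=> G [PG Gmax]; have gG : dominated_graph G.
  case: PG => // G0; exfalso.
  apply: (Gmax [set z | exists c : R, z = (c *: b, c * p b)]); last by right; exact: line_graph.
  rewrite G0; split; first exact: sub0set.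
  by move=> /(_ (b, p b)); apply; exists 1; rewrite scale1r mul1r.
have Gtot x : D x -> exists r, G (x, r).
  move=> Dx; have [G' [gG' GG' [r G'r]]] := graph_extend gG Dx.
  exists r; apply: contrapT => nG; apply: (Gmax G'); last by right.
  by split => // /(_ (x, r) G'r).
have /choice[f fG] x : exists r, D x -> G (x, r).
  by have [/Gtot[r Gr]|nD] := pselect (D x); [exists r|exists 0].
have [Gb Glin Gdom] := gG; exists f; split.
- move=> c x y Dx Dy; apply: (graph_fun gG (fG _ _)); first exact: D_lin.
  by apply: Glin; exact: fG.
- move=> x Dx; rewrite ler_norml; have [_ ->] := Gdom _ _ (fG _ Dx).
  have := graphZ (-1) gG (fG _ Dx) => /Gdom[_].
  by rewrite mulN1r pZ// normrN1 mul1r lerNl => ->.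
- exact: (graph_fun gG (fG _ Db)).
Qed.

End HahnBanach.

(** * Random signs and restriction to the block diagonal *)

Section Diagonal.
Context d (T : measurableType d) (R : realType).
Variable mu : {measure set T -> \bar R}.
Implicit Types (p : \bar R) (U f y : T -> R) (E : int -> set T) (c M A : R).

(* Averaging over independent signs kills the off-diagonal blocks; the average is
   taken one index at a time. *)
Lemma wnorm_diagonal_aux p U E (s : seq int) (v0 : T -> R) (v : int -> T -> R) A :
  (1 <= p)%E -> weight U -> uniq s -> disjoint_family E ->
  (forall n, measurable (E n)) -> measurable_fun setT v0 ->
  (forall n, measurable_fun setT (v n)) -> 0 <= A ->
  (forall eps : int -> bool,
    wnorm mu p U (fun x => (v0 x + \sum_(n <- s) (-1) ^+ eps n * v n x)%R) <= A%:E)%E ->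
  (wnorm mu p U (fun x => ((v0 x - \sum_(n <- s) cut (E n) v0 x) +
     \sum_(n <- s) cut (E n) (v n) x)%R) <= A%:E)%E.
Proof.
move=> p1 wU us dE mE + + A0.
elim: s us v0 v => [_ v0 v mv0 mv /(_ xpredT)|n s IH /= /andP[ns us] v0 v mv0 mv H].
  rewrite (_ : (fun x => v0 x + _) = v0); last by apply/funext => x; rewrite big_nil addr0.
  by rewrite (_ : (fun x => v0 x - _ + _) = v0)//; apply/funext => x; rewrite !big_nil subr0 addr0.
have mEC : measurable (~` E n) by exact: measurableC.
(* The data once the sign at n has been averaged out: on [E n] only v n survives, off [E n] nothing
   changes. *)
pose v0' x := cut (~` E n) v0 x + cut (E n) (v n) x.
pose v' k := cut (~` E n) (v k).
have mv0' : measurable_fun setT v0'.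
  by apply: measurable_funD; exact: measurable_cut.
have mv' k : measurable_fun setT (v' k) by exact: measurable_cut.
have := IH us v0' v' mv0' mv' _; rewrite (_ : (fun x => v0' x - _ + _) =
  (fun x => ((v0 x - \sum_(n <- n :: s) cut (E n) v0 x) +
     \sum_(n <- n :: s) cut (E n) (v n) x))); last first.
  apply/funext => x; rewrite !big_cons.
  have [Ex|nEx] := pselect (E n x).
    have h k (f : T -> R) : k \in s -> cut (E k) f x = 0.
      by move=> ks; rewrite cutF// => /dE /(_ Ex) kn; rewrite -kn ks in ns.
    have hs (g : int -> T -> R) : \sum_(k <- s) cut (E k) (g k) x = 0.
      by apply: big1_seq => k /andP[_ ks]; exact: h.
    rewrite (hs (fun=> v0')) (hs v') (hs (fun=> v0)) (hs v).
    by rewrite /v0' cutF ?cutT//; ring.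
  have CEx : (~` E n) x by [].
  have v0x : v0' x = v0 x by rewrite /v0' cutT// cutF// addr0.
  have -> : \sum_(k <- s) cut (E k) v0' x = \sum_(k <- s) cut (E k) v0 x.
    by apply: eq_bigr => k _; rewrite /cut v0x.
  have -> : \sum_(k <- s) cut (E k) (v' k) x = \sum_(k <- s) cut (E k) (v k) x.
    by apply: eq_bigr => k _; rewrite {1}/cut /v' cutT.
  by rewrite v0x (cutF _ nEx) (cutF _ nEx) !add0r.
apply => eps.
pose F e x := v0 x + \sum_(k <- n :: s) (-1) ^+ (if k == n then e else eps k) * v k x.
have FA e : (wnorm mu p U (F e) <= A%:E)%E by exact: H.
have mF e : measurable_fun setT (F e).
  apply: measurable_funD => //; apply: measurable_big => k.
  exact: measurable_funM.
have mhF e : measurable_fun setT (fun x => 2^-1 * `|F e x|).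
  by apply: measurable_funM => //; exact: measurableT_comp.
have hF e : (wnorm mu p U (fun x => (2^-1 * `|F e x|)%R) <= (2^-1 * A)%:E)%E.
  rewrite -[X in (X * A)%:E]ger0_norm//; apply: wnormZ => //; first exact: measurableT_comp.
  apply: le_trans (FA e); apply: wnorm_le => //; first exact: measurableT_comp.
  by apply: nearW => x; rewrite normr_id.
apply: (@le_trans _ _ (wnorm mu p U ((fun x => 2^-1 * `|F false x|) \+ (fun x => 2^-1 * `|F true x|))%R)).
  apply: wnorm_le => //.
  - apply: measurable_funD => //; apply: measurable_big => k.
    exact: measurable_funM.
  - exact: measurable_funD.
  apply: nearW => x /=; rewrite [leRHS]ger0_norm ?addr_ge0 ?mulr_ge0//.
  have FE e : F e x = (v0 x + \sum_(k <- s) (-1) ^+ eps k * v k x) + (-1) ^+ e * v n x.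
    rewrite /F big_cons eqxx [X in _ + X]addrC addrA; congr (_ + _ + _).
    apply: eq_big_seq => k ks; case: eqP => // kn.
    by rewrite -kn ks in ns.
  rewrite !FE; set a := v0 x + \sum_(k <- s) (-1) ^+ eps k * v k x.
  rewrite expr0 expr1 mul1r mulN1r.
  (* Off [E n] the half-sum of the two sign choices gives a, on [E n] their half-difference gives v
     n; the mean of the two absolute values dominates either. *)
  suff : v0' x + \sum_(k <- s) (-1) ^+ eps k * v' k x = a \/
         v0' x + \sum_(k <- s) (-1) ^+ eps k * v' k x = v n x.
    case=> ->.
      have := ler_normD (a + v n x) (a - v n x).
      have -> : a + v n x + (a - v n x) = 2 * a by ring.
      by rewrite normrM normr_nat; lra.
    have := ler_normB (a + v n x) (a - v n x).
    have -> : a + v n x - (a - v n x) = 2 * v n x by ring.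
    by rewrite normrM normr_nat; lra.
  have [Ex|nEx] := pselect (E n x); [right|left].
    rewrite /v0' cutF ?cutT//.
    rewrite add0r big1 ?addr0// => k _; rewrite /v' cutF ?mulr0//.
  rewrite /v0' cutT// cutF// addr0; congr (_ + _).
  by apply: eq_bigr => k _; rewrite /v' cutT.
apply: (le_trans (wnormD _ _ _ _ _)) => //.
apply: (le_trans (leeD (hF _) (hF _))); rewrite -EFinD lee_fin; lra.
Qed.

Lemma wnorm_diagonal p U E (s : seq int) (v : int -> T -> R) A :
  (1 <= p)%E -> weight U -> uniq s -> disjoint_family E ->
  (forall n, measurable (E n)) ->
  (forall n, measurable_fun setT (v n)) -> 0 <= A ->
  (forall eps : int -> bool,
    wnorm mu p U (fun x => (\sum_(n <- s) (-1) ^+ eps n * v n x)%R) <= A%:E)%E ->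
  (wnorm mu p U (fun x => (\sum_(n <- s) cut (E n) (v n) x)%R) <= A%:E)%E.
Proof.
move=> p1 wU us dE mE mv A0 H.
have := @wnorm_diagonal_aux p U E s (fun=> 0) v A p1 wU us dE mE _ mv A0.
move=> /(_ (measurable_cst _))/(_ _).
rewrite (_ : (fun x => _ - _ + _) = (fun x => \sum_(n <- s) cut (E n) (v n) x)); last first.
  apply/funext => x; rewrite [X in _ - X]big1 ?subr0 ?add0r// => k _.
  by rewrite /cut mul0r.
apply => eps; apply: le_trans (H eps).
by rewrite (_ : (fun x => 0 + _) = (fun x => \sum_(n <- s) (-1) ^+ eps n * v n x))//;
  apply/funext => x; rewrite add0r.
Qed.

(** On each [E n] the function is dominated by a sum over shifts i plus a remainder. For a fixed
    shift the sum over n decays like l ^ i; the remainders need no cutting because their plain sum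
    is already controlled. *)
Lemma wnorm_sum_cut_dom p U E (s : seq int) (z : int -> T -> R) (I : nat)
    (v : nat -> int -> T -> R) (rest : int -> T -> R) c l :
  (1 <= p)%E -> weight U -> uniq s -> disjoint_family E ->
  (forall n, measurable (E n)) -> (forall n, measurable_fun setT (z n)) ->
  (forall i n, measurable_fun setT (v i n)) ->
  (forall n, measurable_fun setT (rest n)) -> 0 < l -> l < 1 -> 0 <= c ->
  {ae mu, forall x, forall n, n \in s -> E n x ->
     `|z n x| <= \sum_(i < I) `|v i n x| + `|rest n x|} ->
  (forall i, (i < I)%N ->
    wnorm mu p U (fun x => (\sum_(n <- s) cut (E n) (v i n) x)%R) <= (c * l ^+ i)%:E)%E ->
  (wnorm mu p U (fun x => (\sum_(n <- s) `|rest n x|)%R) <= c%:E)%E ->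
  (wnorm mu p U (fun x => (\sum_(n <- s) cut (E n) (z n) x)%R) <=
    (c / (1 - l) + c)%:E)%E.
Proof.
move=> p1 wU us dE mE mz mv mrest l0 l1 c0 zv hv hr.
have mcut (g : int -> T -> R) n : (forall n, measurable_fun setT (g n)) ->
  measurable_fun setT (cut (E n) (g n)) by move=> mg; exact: measurable_cut.
have msum (g : int -> T -> R) : (forall n, measurable_fun setT (g n)) ->
    measurable_fun setT (fun x => \sum_(n <- s) cut (E n) (g n) x).
  by move=> mg; apply: measurable_big => n; exact: mcut.
pose G x := \sum_(i < I) `|\sum_(n <- s) cut (E n) (v i n) x|.
have mG : measurable_fun setT G.
  by apply: measurable_big => i; apply: measurableT_comp => //; exact: msum.
pose H x := \sum_(n <- s) `|rest n x|.
have mH : measurable_fun setT H.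
  by apply: measurable_big => n; exact: measurableT_comp.
apply: (@le_trans _ _ (wnorm mu p U (G \+ H)%R)).
  apply: wnorm_le => //; [exact: msum|exact: measurable_funD|].
  apply: filterS zv => x zv /=.
  have H0 : 0 <= H x by apply: sumr_ge0.
  have G0 : 0 <= G x by apply: sumr_ge0.
  rewrite [leRHS]ger0_norm ?addr_ge0//.
  have [[n ns Ex]|nE] := pselect (exists2 n, n \in s & E n x); last first.
    rewrite big1_seq ?normr0 ?addr_ge0// => n /andP[_ ns]; rewrite cutF// => Ex.
    by apply: nE; exists n.
  have sumE (g : int -> T -> R) : \sum_(n <- s) cut (E n) (g n) x = g n x.
    rewrite (bigD1_seq n)//= big1 ?addr0 ?cutT//.
    by move=> k /eqP kn; rewrite cutF// => /dE /(_ Ex).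
  rewrite sumE (le_trans (zv n ns Ex))//; apply: lerD.
    by rewrite /G; apply: ler_sum => i _; rewrite sumE.
  by rewrite /H (bigD1_seq n)//= lerDl sumr_ge0.
apply: (le_trans (wnormD _ _ _ _ _)) => //; rewrite EFinD; apply: leeD => //.
apply: (@le_trans _ _ (\sum_(i < I) (c * l ^+ i))%:E).
  apply: wnorm_sum_le => //.
    by move=> i; apply: measurableT_comp => //; exact: msum.
  move=> i _; apply: le_trans (hv i (ltn_ord i)); apply: wnorm_le => //.
  - by apply: measurableT_comp => //; exact: msum.
  - exact: msum.
  - by apply: nearW => x; rewrite normr_id.
by rewrite lee_fin -mulr_sumr ler_wpM2l// sum_geometric_le.
Qed.

End Diagonal.

(** * The couple of weighted spaces *)

Section Classes.
Context d (T : measurableType d) (R : realType).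
Variable mu : {measure set T -> \bar R}.
Implicit Types (p : \bar R) (U f g : T -> R) (u v : L0 mu).

Definition mfun_of f (mf : measurable_fun setT f) : {mfun T >-> R} :=
  mfun_Sub (mem_set mf).

(* Junk value 0 when f is not measurable. *)
Definition cls f : L0 mu :=
  match pselect (measurable_fun setT f) with
  | left mf => toL0 mu (mfun_of mf)
  | right _ => 0
  end.

Lemma measurable_ofL0 u : measurable_fun setT (ofL0 u).
Proof. exact: measurable_funPT. Qed.
Hint Resolve measurable_ofL0 : core.

Lemma toL0_inj_ae u v : {ae mu, forall x, ofL0 u x = ofL0 v x} -> u = v.
Proof.
move=> uv; rewrite -[u]ofL0K -[v]ofL0K; apply/eq_toL0.
by apply: filterS uv => x.
Qed.

Lemma clsE f : measurable_fun setT f -> {ae mu, forall x, ofL0 (cls f) x = f x}.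
Proof.
rewrite /cls; case: pselect => // mf _.
by apply: filterS (toL0K mu (mfun_of mf)) => x /(_ I).
Qed.

Lemma ofL0_D u v : {ae mu, forall x, ofL0 (u + v) x = ofL0 u x + ofL0 v x}.
Proof. by apply: filterS (toL0K mu (ofL0 u + ofL0 v)) => x /(_ I). Qed.

Lemma ofL0_Z (c : R) u : {ae mu, forall x, ofL0 (c *: u) x = c * ofL0 u x}.
Proof. by apply: filterS (toL0K mu (c *: ofL0 u)) => x /(_ I). Qed.

Lemma ofL0_0 : {ae mu, forall x, ofL0 (0 : L0 mu) x = 0}.
Proof. by apply: filterS (toL0K mu 0) => x /(_ I). Qed.

Lemma ofL0_N u : {ae mu, forall x, ofL0 (- u) x = - ofL0 u x}.
Proof. by apply: filterS (toL0K mu (- ofL0 u)) => x /(_ I). Qed.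

Lemma ofL0_B u v : {ae mu, forall x, ofL0 (u - v) x = ofL0 u x - ofL0 v x}.
Proof. by apply: filterS2 (ofL0_D u (- v)) (ofL0_N v) => x -> ->. Qed.

Lemma ofL0_sum (I : Type) (s : seq I) (P : pred I) (f : I -> L0 mu) :
  {ae mu, forall x, ofL0 (\sum_(i <- s | P i) f i) x = \sum_(i <- s | P i) ofL0 (f i) x}.
Proof.
elim: s => [|i s IH].
  by rewrite big_nil; apply: filterS ofL0_0 => x ->; rewrite big_nil.
rewrite big_cons; case: ifPn => Pi; last first.
  by apply: filterS IH => x ->; rewrite big_cons (negbTE Pi).
by apply: filterS2 IH (ofL0_D (f i) (\sum_(i <- s | P i) f i)) => x E ->; rewrite E big_cons Pi.
Qed.

Lemma cls_ext f g : measurable_fun setT f -> measurable_fun setT g ->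
  {ae mu, forall x, f x = g x} -> cls f = cls g.
Proof.
move=> mf mg fg; apply: toL0_inj_ae.
by apply: filterS3 fg (clsE mf) (clsE mg) => x -> -> ->.
Qed.

Lemma cls_eqP f u : measurable_fun setT f -> {ae mu, forall x, f x = ofL0 u x} ->
  cls f = u.
Proof.
move=> mf fu; apply: toL0_inj_ae.
by apply: filterS2 fu (clsE mf) => x <- ->.
Qed.

Lemma clsD f g : measurable_fun setT f -> measurable_fun setT g ->
  cls (f \+ g) = cls f + cls g.
Proof.
move=> mf mg; apply: cls_eqP; first exact: measurable_funD.
apply: filterS3 (clsE mf) (clsE mg) (ofL0_D (cls f) (cls g)) => x E1 E2 ->.
by rewrite E1 E2.
Qed.

Lemma clsZ (c : R) f : measurable_fun setT f -> cls (fun x => c * f x) = c *: cls f.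
Proof.
move=> mf; apply: cls_eqP; first exact: measurable_funM.
by apply: filterS2 (clsE mf) (ofL0_Z c (cls f)) => x E1 ->; rewrite E1.
Qed.

Lemma wLnormE p U u : weighted_Lnorm p U u = wnorm mu p U (ofL0 u).
Proof. by []. Qed.

Lemma wLnorm_ge0 p U u : (0 <= weighted_Lnorm p U u)%E.
Proof. exact: wnorm_ge0. Qed.

Lemma eq_wnorm p U f g : (1 <= p)%E -> weight U -> measurable_fun setT f ->
  measurable_fun setT g -> {ae mu, forall x, f x = g x} ->
  wnorm mu p U f = wnorm mu p U g.
Proof.
move=> p1 wU mf mg fg; apply/eqP; rewrite eq_le; apply/andP; split;
  by apply: wnorm_le => //; apply: filterS fg => x ->.
Qed.

Lemma wLnorm_cls p U f : (1 <= p)%E -> weight U -> measurable_fun setT f ->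
  weighted_Lnorm p U (cls f) = wnorm mu p U f.
Proof. by move=> p1 wU mf; apply: eq_wnorm => //; exact: clsE. Qed.

Lemma wLnormD p U u v : (1 <= p)%E -> weight U ->
  (weighted_Lnorm p U (u + v)%R <= weighted_Lnorm p U u + weighted_Lnorm p U v)%E.
Proof.
move=> p1 wU; rewrite !wLnormE.
apply: le_trans (wnormD _ p1 wU (measurable_ofL0 u) (measurable_ofL0 v)).
rewrite (@eq_wnorm p U _ (ofL0 u \+ ofL0 v)%R)//.
exact: ofL0_D.
Qed.

Lemma wLnormZ_le p U (c M : R) u : (1 <= p)%E -> weight U -> 0 <= M ->
  (weighted_Lnorm p U u <= M%:E)%E ->
  (weighted_Lnorm p U (c *: u)%R <= (`|c| * M)%:E)%E.
Proof.
move=> p1 wU M0 uM; apply: le_trans (wnormZ c p1 wU (measurable_ofL0 u) M0 uM).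
rewrite wLnormE (@eq_wnorm p U _ (fun x => c * ofL0 u x)%R)//; last exact: ofL0_Z.
exact: measurable_funM.
Qed.

Lemma wLnorm0 p U : (1 <= p)%E -> weight U -> weighted_Lnorm p U (0 : L0 mu) = 0%E.
Proof.
move=> p1 wU; rewrite wLnormE (@eq_wnorm p U _ (fun=> 0)) ?wnorm0//.
exact: ofL0_0.
Qed.

Definition rcut (E : set T) u : L0 mu := cls (cut E (ofL0 u)).

Lemma measurable_rcut (E : set T) u : measurable E ->
  measurable_fun setT (cut E (ofL0 u)).
Proof. by move=> mE; exact: measurable_cut. Qed.

Lemma wLnorm_rcut p U E u : (1 <= p)%E -> weight U -> measurable E ->
  weighted_Lnorm p U (rcut E u) = wnorm mu p U (cut E (ofL0 u)).
Proof. by move=> p1 wU mE; apply: wLnorm_cls => //; exact: measurable_rcut. Qed.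

Lemma wLnorm_rcut_le p U E u : (1 <= p)%E -> weight U -> measurable E ->
  (weighted_Lnorm p U (rcut E u) <= weighted_Lnorm p U u)%E.
Proof.
move=> p1 wU mE; rewrite wLnorm_rcut//; apply: wnorm_le => //; first exact: measurable_rcut.
by apply: nearW => x; exact: norm_cut.
Qed.

Lemma rcut_lin E (c : R) u v : measurable E ->
  rcut E (c *: u + v) = c *: rcut E u + rcut E v.
Proof.
move=> mE; have mr w := measurable_rcut w mE.
rewrite /rcut -clsZ// -clsD//; last exact: measurable_funM.
apply: cls_ext => //; first by apply: measurable_funD => //; exact: measurable_funM.
apply: filterS2 (ofL0_D (c *: u) v) (ofL0_Z c u) => x E1 E2.
by rewrite /cut /= E1 E2; ring.
Qed.

End Classes.
#[global] Hint Resolve measurable_ofL0 : core.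

Section LpCouple.
Context d (T : measurableType d) (R : realType).
Variable mu : {measure set T -> \bar R}.
Variables (p0 p1 : \bar R) (U0 U1 : T -> R).
Hypothesis hp0 : (1 <= p0)%E.
Hypothesis hp1 : (1 <= p1)%E.
Hypothesis w0 : weight U0.
Hypothesis w1 : weight U1.
Let X := Lp_couple mu p0 p1 U0 U1.
Notation N0 := (weighted_Lnorm p0 U0).
Notation N1 := (weighted_Lnorm p1 U1).
Implicit Types (x y : X).

Lemma space0_lin (c : R) x y : space0 x -> space0 y -> space0 (c *: x + y : X).
Proof.
move=> x0 y0; apply: (le_lt_trans (wLnormD _ _ hp0 w0)).
rewrite lte_add_pinfty//; have fx : N0 x \is a fin_num by rewrite ge0_fin_numE ?wLnorm_ge0.
apply: (@le_lt_trans _ _ (`|c| * fine (N0 x))%:E); last exact: ltry.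
by apply: wLnormZ_le => //; [rewrite fine_ge0// wLnorm_ge0|rewrite fineK].
Qed.

Lemma space1_lin (c : R) x y : space1 x -> space1 y -> space1 (c *: x + y : X).
Proof.
move=> x0 y0; apply: (le_lt_trans (wLnormD _ _ hp1 w1)).
rewrite lte_add_pinfty//; have fx : N1 x \is a fin_num by rewrite ge0_fin_numE ?wLnorm_ge0.
apply: (@le_lt_trans _ _ (`|c| * fine (N1 x))%:E); last exact: ltry.
by apply: wLnormZ_le => //; [rewrite fine_ge0// wLnorm_ge0|rewrite fineK].
Qed.

Lemma space0_0 : space0 (0 : X).
Proof. by rewrite /space0 /= wLnorm0// ltry. Qed.

Lemma space1_0 : space1 (0 : X).
Proof. by rewrite /space1 /= wLnorm0// ltry. Qed.

Lemma space0_csum x : space0 x -> csum X x.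
Proof. by move=> x0; exists x, 0; split => //; [rewrite addr0|exact: space1_0]. Qed.

Lemma space1_csum x : space1 x -> csum X x.
Proof. by move=> x1; exists 0, x; split => //; [rewrite add0r|exact: space0_0]. Qed.

Lemma csum_lin (c : R) x y : csum X x -> csum X y -> csum X (c *: x + y).
Proof.
move=> [x0 [x1 [-> x00 x11]]] [y0 [y1 [-> y00 y11]]].
exists (c *: x0 + y0), (c *: x1 + y1); split; [|exact: space0_lin|exact: space1_lin].
by rewrite scalerDr addrACA.
Qed.

Lemma csum0 : csum X 0.
Proof. by apply: space0_csum; exact: space0_0. Qed.

Lemma csumD x y : csum X x -> csum X y -> csum X (x + y).
Proof. by move=> hx hy; rewrite -[x]scale1r; exact: csum_lin. Qed.

Lemma csumZ (c : R) x : csum X x -> csum X (c *: x).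
Proof. by move=> hx; rewrite -[_ *: _]addr0; apply: csum_lin => //; exact: csum0. Qed.

Lemma csum_rcut E x : measurable E -> csum X x -> csum X (rcut E x).
Proof.
move=> mE [x0 [x1 [-> x00 x11]]]; exists (rcut E x0), (rcut E x1); split.
- by rewrite -[x0 in LHS]scale1r rcut_lin// scale1r.
- exact: le_lt_trans (wLnorm_rcut_le _ _ _ _) x00.
- exact: le_lt_trans (wLnorm_rcut_le _ _ _ _) x11.
Qed.

Section Kfunctional.
Variables (s t : R).
Hypothesis s0 : 0 < s.
Hypothesis t0 : 0 < t.

Lemma Kfun_ge0 x : (0 <= Kfun X s t x)%E.
Proof.
apply: le_ereal_inf_tmp => _ [x0 [x1 [_ _ _ ->]]].
by rewrite adde_ge0// mule_ge0 ?lee_fin ?(ltW s0) ?(ltW t0)//; exact: wLnorm_ge0.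
Qed.

Lemma Kfun_le (x x0 x1 : X) (m0 m1 : R) : x = x0 + x1 -> (N0 x0 <= m0%:E)%E ->
  (N1 x1 <= m1%:E)%E -> (Kfun X s t x <= (s * m0 + t * m1)%:E)%E.
Proof.
move=> xE h0 h1; apply: (@le_trans _ _ (s%:E * N0 x0 + t%:E * N1 x1)%E).
  apply: ereal_inf_lbound; exists x0, x1; split => //.
  - by apply: (le_lt_trans h0); exact: ltry.
  - by apply: (le_lt_trans h1); exact: ltry.
by rewrite EFinD !EFinM; apply: leeD; apply: lee_wpmul2l; rewrite ?lee_fin ?(ltW s0) ?(ltW t0).
Qed.

Lemma Kfun_fin x : csum X x -> Kfun X s t x \is a fin_num.
Proof.
move=> [x0 [x1 [xE h0 h1]]]; rewrite ge0_fin_numE ?Kfun_ge0//.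
have f0 : N0 x0 \is a fin_num by rewrite ge0_fin_numE ?wLnorm_ge0.
have f1 : N1 x1 \is a fin_num by rewrite ge0_fin_numE ?wLnorm_ge0.
apply: (le_lt_trans (@Kfun_le x x0 x1 (fine (N0 x0)) (fine (N1 x1)) xE _ _)).
- by rewrite fineK.
- by rewrite fineK.
- exact: ltry.
Qed.

Lemma Kfun_decomp x (k : R) : (Kfun X s t x < k%:E)%E -> exists x0 x1 : X,
  [/\ x = x0 + x1, (N0 x0 <= (k / s)%:E)%E & (N1 x1 <= (k / t)%:E)%E].
Proof.
move=> /ereal_inf_lt[_ [x0 [x1 [xE h0 h1 ->]]]].
have f0 : N0 x0 \is a fin_num by rewrite ge0_fin_numE ?wLnorm_ge0.
have f1 : N1 x1 \is a fin_num by rewrite ge0_fin_numE ?wLnorm_ge0.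
have g0 : 0 <= fine (N0 x0) by rewrite fine_ge0// wLnorm_ge0.
have g1 : 0 <= fine (N1 x1) by rewrite fine_ge0// wLnorm_ge0.
rewrite /= -(fineK f0) -(fineK f1) -!EFinM -EFinD lte_fin => h.
exists x0, x1; split => //.
- rewrite -(fineK f0) lee_fin ler_pdivlMr// mulrC (le_trans _ (ltW h))// lerDl.
  by rewrite mulr_ge0// ltW.
- rewrite -(fineK f1) lee_fin ler_pdivlMr// mulrC (le_trans _ (ltW h))// lerDr.
  by rewrite mulr_ge0// ltW.
Qed.

(** Together with [KfunZ] and [Kfun_fin] this makes the K-functional, at fixed s and t, a finite
    seminorm on the sum of the couple, as [hahn_banach] requires. *)
Lemma KfunD x y : csum X x -> csum X y ->
  fine (Kfun X s t (x + y)%R) <= fine (Kfun X s t x) + fine (Kfun X s t y).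
Proof.
move=> cx cy; apply/ler_addgt0Pr => e e0; have e2 : 0 < e / 2 by rewrite divr_gt0.
have lt z : csum X z -> (Kfun X s t z < (fine (Kfun X s t z) + e / 2)%:E)%E.
  by move=> cz; rewrite -[ltLHS]fineK ?Kfun_fin// lte_fin ltrDl.
have fz x' : (N0 x' \is a fin_num) = space0 x' :> Prop by rewrite ge0_fin_numE ?wLnorm_ge0.
have fz1 x' : (N1 x' \is a fin_num) = space1 x' :> Prop by rewrite ge0_fin_numE ?wLnorm_ge0.
move: (lt _ cx) (lt _ cy) => /ereal_inf_lt[_ [x0 [x1 [xE h0 h1 ->]]] hx].
move=> /ereal_inf_lt[_ [y0 [y1 [yE k0 k1 ->]]] hy].
move: h0 h1 k0 k1 hx hy; rewrite -!fz -!fz1 => h0 h1 k0 k1.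
rewrite /= -(fineK h0) -(fineK h1) -(fineK k0) -(fineK k1) -!EFinM -!EFinD !lte_fin => hx hy.
have : (Kfun X s t (x + y)%R <= (s * (fine (N0 x0) + fine (N0 y0)) +
    t * (fine (N1 x1) + fine (N1 y1)))%:E)%E.
  apply: (@Kfun_le _ (x0 + y0) (x1 + y1)); first by rewrite xE yE addrACA.
    by rewrite EFinD !fineK//; exact: wLnormD.
  by rewrite EFinD !fineK//; exact: wLnormD.
rewrite -[leLHS]fineK ?Kfun_fin//; last exact: csumD.
rewrite lee_fin => /le_trans; apply; lra.
Qed.

Lemma KfunZ (c : R) x : csum X x ->
  fine (Kfun X s t (c *: x)%R) = `|c| * fine (Kfun X s t x).
Proof.
move=> cx; have le (e : R) z : csum X z ->
    fine (Kfun X s t (e *: z)%R) <= `|e| * fine (Kfun X s t z).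
  move=> cz; apply/ler_addgt0Pr => h h0.
  have h1 : 0 < h / (`|e| + 1) by rewrite divr_gt0// ltr_wpDl.
  have : (Kfun X s t z < (fine (Kfun X s t z) + h / (`|e| + 1))%:E)%E.
    by rewrite -[ltLHS]fineK ?Kfun_fin// lte_fin ltrDl.
  move=> /ereal_inf_lt[_ [x0 [x1 [xE h0' h1' ->]]]].
  have f0 : N0 x0 \is a fin_num by rewrite ge0_fin_numE ?wLnorm_ge0.
  have f1 : N1 x1 \is a fin_num by rewrite ge0_fin_numE ?wLnorm_ge0.
  rewrite /= -(fineK f0) -(fineK f1) -!EFinM -EFinD lte_fin => hz.
  have : (Kfun X s t (e *: z)%R <= (s * (`|e| * fine (N0 x0)) +
      t * (`|e| * fine (N1 x1)))%:E)%E.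
    apply: (@Kfun_le _ (e *: x0) (e *: x1)); first by rewrite xE scalerDr.
      by apply: wLnormZ_le; rewrite ?fineK// fine_ge0// wLnorm_ge0.
    by apply: wLnormZ_le; rewrite ?fineK// fine_ge0// wLnorm_ge0.
  rewrite -[leLHS]fineK ?Kfun_fin//; last exact: csumZ.
  rewrite lee_fin => /le_trans; apply.
  have -> : s * (`|e| * fine (N0 x0)) + t * (`|e| * fine (N1 x1)) =
    `|e| * (s * fine (N0 x0) + t * fine (N1 x1)) by ring.
  apply: (@le_trans _ _ (`|e| * (fine (Kfun X s t z) + h / (`|e| + 1)))).
    by rewrite ler_wpM2l// ltW.
  rewrite mulrDr lerD2l mulrCA -[leRHS]mulr1 ler_wpM2l ?(ltW h0)//.
  by rewrite ler_pdivrMr ?mul1r ?lerDl// ltr_wpDl.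
apply/eqP; rewrite eq_le le//=.
have [->|c0] := eqVneq c 0.
  by rewrite normr0 mul0r fine_ge0// Kfun_ge0.
have := le c^-1 _ (csumZ c cx).
by rewrite scalerA mulVf// scale1r normfV ler_pdivlMl ?normr_gt0.
Qed.

End Kfunctional.

End LpCouple.

Lemma nearest_point (J : set int) (n : int) : J !=set0 ->
  exists c, J c /\ forall j, J j -> (absz (n - c)%R <= absz (n - j)%R)%N.
Proof.
move=> [j0 Jj0].
have exP : exists k : nat, `[< exists j, J j /\ absz (n - j)%R = k >].
  by exists (absz (n - j0)%R); apply/asboolP; exists j0.
case: (ex_minnP exP) => k /asboolP[c [Jc ck]] kmin; exists c; split => // j Jj.
by rewrite ck; apply: kmin; apply/asboolP; exists j.
Qed.

(** [cl] is the nearest-point projection onto J, which continues data from J to all integers. The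
    last two clauses identify the projection with the top end past J and with the bottom end before
    J. *)
Lemma interval_clamp (J : set int) : J !=set0 -> is_interval J ->
  exists cl : int -> int,
   [/\ forall n, J (cl n), forall n, J n -> cl n = n,
       forall n, (J n /\ J (n + 1)) \/ cl n = cl (n + 1),
       forall n, (exists2 j, J j & j <= n) -> ~ (J n /\ J (n + 1)) -> ~ J (cl n + 1) &
       forall n, (forall j, J j -> n < j) -> ~ J (cl n - 1)].
Proof.
move=> J0 iJ; have /choice[cl near] n := nearest_point n J0.
have clJ n : J n -> cl n = n.
  by move=> Jn; have [_ /(_ _ Jn)] := near n; rewrite subrr; lia.
have side n : ~ J n -> (forall j, J j -> n < j) \/ (forall j, J j -> j < n).
  move=> nJ; have [c Jc] := J0; have [nc|cn|cE] := ltgtP n c; last by rewrite cE in nJ.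
    left => j Jj; rewrite ltNge; apply/negP => jn; apply: nJ.
    by apply: (iJ j c) => //; rewrite jn ltW.
  right => j Jj; rewrite ltNge; apply/negP => nj; apply: nJ.
  by apply: (iJ c j) => //; rewrite nj ltW.
exists cl; split => //.
- by move=> n; case: (near n).
- move=> n; have [[Jn Jn1]|nJ] := pselect (J n /\ J (n + 1)); [by left|right].
  have [Jc /(_ _ (near (n + 1)).1) h1] := near n.
  have [Jc' /(_ _ Jc) h2] := near (n + 1).
  have [Jn|/side[h|h]] := pselect (J n).
  + have nJ1 : ~ J (n + 1) by move=> ?; apply: nJ.
    have /(side (n + 1))[h|h] := nJ1; first by have := h _ Jn; lia.
    by move: h1 h2; have := h _ Jc; have := h _ Jc'; lia.
  + by move: h1 h2; have := h _ Jc; have := h _ Jc'; lia.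
  + by move: h1 h2; have := h _ Jc; have := h _ Jc'; lia.
- move=> n [j Jj jn] nJ; have [Jn|nJn] := pselect (J n).
    by rewrite clJ// => Jn1; apply: nJ.
  have [h|h] := side n nJn; first by have := h _ Jj; lia.
  move=> Jc; have [Jc' /(_ _ Jc)] := near n.
  by have := h _ Jc; have := h _ Jc'; lia.
- move=> n h Jc; have [Jc' /(_ _ Jc)] := near n.
  by have := h _ Jc; have := h _ Jc'; lia.
Qed.

(** * Balanced sequences and blocks *)

Section QuasiConcave.
Context (R : realType) (rho : R -> R).
Hypothesis qc : quasi_concave rho.

Let rho0 t : 0 < t -> 0 < rho t. Proof. by case: qc => h _ _; exact: h. Qed.
Let rho_le s t : 0 < s -> s <= t -> rho s <= rho t.
Proof. by case: qc => _ h _; exact: h. Qed.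
Let rho_div s t : 0 < s -> s <= t -> rho t / t <= rho s / s.
Proof. by case: qc => _ _ h; exact: h. Qed.

(** The opposite monotonicity of rho and rho (t) / t gives |rho x - rho y| <= rho x * (|x - y| / x),
    hence the continuity behind the intermediate value arguments. *)
Lemma quasi_concave_cvg (x : R) : 0 < x -> rho y @[y --> x] --> rho x.
Proof.
move=> x0; apply/cvgrPdist_le => e e0.
have k0 : 0 < e * x / rho x by rewrite divr_gt0 ?mulr_gt0// rho0.
have near1 : \forall y \near x, 0 < y by exact: lt_nbhsr.
have near2 : \forall y \near x, `|x - y| <= e * x / rho x.
  by have /cvgrPdist_le /(_ _ k0) := @cvg_id _ (nbhs x).
near=> y.
have y0 : 0 < y by near: y.
have xy : `|x - y| <= e * x / rho x by near: y.
suff h : `|rho x - rho y| <= rho x * (`|x - y| / x).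
  apply: (le_trans h); rewrite mulrA ler_pdivrMr//.
  by move: xy; rewrite ler_pdivlMr ?rho0// mulrC.
have rx := rho0 x0; have ry := rho0 y0.
have [lexy|ltyx] := leP x y.
  have h1 := rho_le x0 lexy; have h2 := rho_div x0 lexy.
  rewrite ler0_norm ?subr_le0// ler0_norm ?subr_le0// !opprB.
  have : rho y <= rho x / x * y by rewrite -ler_pdivrMr.
  have -> : rho x * ((y - x) / x) = rho x / x * y - rho x.
    by field; rewrite gt_eqF.
  by lra.
have h1 := rho_le y0 (ltW ltyx); have h2 := rho_div y0 (ltW ltyx).
rewrite ger0_norm ?subr_ge0// ger0_norm ?subr_ge0 ?(ltW ltyx)//.
have : rho x / x * y <= rho y by rewrite -ler_pdivlMr.
have -> : rho x * ((x - y) / x) = rho x - rho x / x * y.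
  by field; rewrite gt_eqF.
by lra.
Unshelve. all: by end_near.
Qed.

Let balance_refl t : 0 < t -> balance_ratio rho t t = 1.
Proof.
by move=> t0; rewrite /balance_ratio !mulfV ?minxx// gt_eqF ?mulr_gt0// rho0.
Qed.

(** If rho exceeded q * rho t somewhere, the balance ratio, continuous and equal to 1 at t, would
    take the value q by the intermediate value theorem, and the sequence could be continued. *)
Lemma balanced_top q t : 1 < q -> 0 < t ->
  (forall e, 0 < e -> exists2 M, 0 < M & forall s, M <= s -> rho s / s <= e) ->
  ~ (exists s, t < s /\ balance_ratio rho t s = q) ->
  forall s, 0 < s -> rho s <= q * rho t.
Proof.
move=> q1 t0 lim noS s s0; rewrite leNgt; apply/negP => qs.
have q0 : 0 < q by rewrite (lt_trans _ q1).
have rt := rho0 t0.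
have ts : t < s.
  rewrite ltNge; apply/negP => st; have := rho_le s0 st.
  have : rho t < q * rho t by rewrite ltr_pMl.
  lra.
have e0 : 0 < rho t / (t * q) by rewrite divr_gt0// mulr_gt0.
have [M M0 hM] := lim _ e0.
(* From [s] on the first ratio exceeds q, from [M] on the second is at least q; [b] lies past
   both. *)
pose b := Num.max s M.
have sb : s <= b by rewrite le_max lexx.
have Mb : M <= b by rewrite le_max lexx orbT.
have b0 : 0 < b by rewrite (lt_le_trans s0).
have tb : t <= b by rewrite (le_trans (ltW ts)).
have rb := rho0 b0.
have qb : q <= balance_ratio rho t b.
  rewrite le_min !ler_pdivlMr ?mulr_gt0//; apply/andP; split.
    by rewrite (le_trans (ltW qs))// rho_le.
  have := hM _ Mb; rewrite ler_pdivrMr// => h.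
  have : q * (t * rho b) <= q * (t * (rho t / (t * q) * b)).
    by rewrite ler_pM2l// ler_pM2l.
  have -> : q * (t * (rho t / (t * q) * b)) = b * rho t.
    by field; rewrite !gt_eqF.
  by [].
have cont : {within `[t, b], continuous (balance_ratio rho t)}.
  apply: continuous_in_subspaceT => x; rewrite inE /= in_itv /= => /andP[tx xb].
  have x0 : 0 < x by rewrite (lt_le_trans t0).
  have cx := quasi_concave_cvg x0.
  apply: (@continuous_min R R (fun s => rho s / rho t) (fun s => s * rho t / (t * rho s))); first by apply: cvgM => //; exact: cvg_cst.
  apply: cvgM; first by apply: cvgM => //; exact: cvg_cst.
  apply: cvgV; first by rewrite gt_eqF// mulr_gt0// rho0.
  by apply: cvgM => //; exact: cvg_cst.
have [|c /andP[tc cb] cq] := IVT tb cont (_ : Num.min _ _ <= q <= Num.max _ _).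
  by rewrite balance_refl// ge_min ltW//= le_max qb orbT.
apply: noS; exists c; split => //; rewrite lt_neqAle; apply/andP; split.
  apply/eqP => tcE; move: cq; rewrite -tcE balance_refl// => q1'.
  by rewrite -q1' ltxx in q1.
by move: tc; rewrite bnd_simp.
Qed.

(** The mirror image of [balanced_top] under exchange of the two spaces, which replaces t by 1 / t
    and rho by rho (t) / t. *)
Lemma balanced_bottom q t : 1 < q -> 0 < t ->
  (forall e, 0 < e -> exists2 M, 0 < M & forall s, 0 < s -> s <= M -> rho s <= e) ->
  ~ (exists s, [/\ 0 < s, s < t & balance_ratio rho s t = q]) ->
  forall s, 0 < s -> rho s / s <= q * (rho t / t).
Proof.
move=> q1 t0 lim noS s s0; rewrite leNgt; apply/negP => qs.
have q0 : 0 < q by rewrite (lt_trans _ q1).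
have rt := rho0 t0.
have ts : s < t.
  rewrite ltNge; apply/negP => st; have := rho_div t0 st.
  have : rho t / t < q * (rho t / t) by rewrite ltr_pMl// divr_gt0.
  lra.
have e0 : 0 < rho t / q by rewrite divr_gt0.
have [M M0 hM] := lim _ e0.
pose b := Num.min s M.
have sb : b <= s by rewrite ge_min lexx.
have Mb : b <= M by rewrite ge_min lexx orbT.
have b0 : 0 < b by rewrite lt_min s0.
have tb : b <= t by rewrite (le_trans sb)// ltW.
have rb := rho0 b0.
have qb : q <= balance_ratio rho b t.
  rewrite le_min !ler_pdivlMr ?mulr_gt0//; apply/andP; split.
    by have := hM _ b0 Mb; rewrite ler_pdivlMr// mulrC.
  have h : q * (rho t / t) <= rho b / b by rewrite (le_trans (ltW qs))// rho_div.
  have : (q * (rho t / t)) * (b * t) <= (rho b / b) * (b * t).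
    by rewrite ler_pM2r// mulr_gt0.
  have -> : q * (rho t / t) * (b * t) = q * (b * rho t) by field; rewrite gt_eqF.
  by have -> : rho b / b * (b * t) = t * rho b by field; rewrite gt_eqF.
have cont : {within `[b, t], continuous (fun x => balance_ratio rho x t)}.
  apply: continuous_in_subspaceT => x; rewrite inE /= in_itv /= => /andP[tx xb].
  have x0 : 0 < x by rewrite (lt_le_trans b0).
  have cx := quasi_concave_cvg x0.
  apply: (@continuous_min R R (fun s => rho t / rho s) (fun s => t * rho s / (s * rho t))).
    apply: cvgM; first exact: cvg_cst.
    by apply: cvgV => //; rewrite gt_eqF// rho0.
  apply: cvgM; first by apply: cvgM => //; exact: cvg_cst.
  apply: cvgV; first by rewrite gt_eqF// mulr_gt0.
  by apply: cvgM => //; exact: cvg_cst.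
have [|c /andP[bc ct] cq] := IVT tb cont (_ : Num.min _ _ <= q <= Num.max _ _).
  by rewrite balance_refl// ge_min (ltW q1) orbT/= le_max qb.
apply: noS; exists c; split => //.
  by apply: (lt_le_trans b0); move: bc; rewrite bnd_simp.
rewrite lt_neqAle; apply/andP; split.
  apply/eqP => tcE; move: cq; rewrite tcE balance_refl// => q1'.
  by rewrite -q1' ltxx in q1.
by move: ct; rewrite bnd_simp.
Qed.

End QuasiConcave.

(** The scales of the blocks in the two norms: Q n stands for rho (t n) and S n for rho (t n) / t n,
    continued to all integers so that shifted indices need no end conditions. *)
Definition geometric_weights (R : realType) (q : R) (Q S : int -> R) : Prop :=
  [/\ forall n, 0 < Q n, forall n, 0 < S n,
      forall n, Q (n - 1) <= q^-1 * Q n & forall n, S (n + 1) <= q^-1 * S n].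

(** * Selection over the indices of a balanced sequence *)

Section SelectionJ.
Context d (T : measurableType d) (R : realType).
Variable mu : {measure set T -> \bar R}.
Implicit Types (p : \bar R) (U f y : T -> R) (E : int -> set T) (c M : R).

(** The low part of y at n; at the top end of J nothing lies above n, and it is all of y. *)
Definition upper_cut (J : set int) y (h : int -> T -> R) n : T -> R :=
  if `[< J (n + 1) >] then h n else y.

(** The part of y below n, zero at the bottom end of J; subtracting it from y leaves the part from n
    on. *)
Definition lower_cut (J : set int) (h : int -> T -> R) n : T -> R :=
  if `[< J (n - 1) >] then h (n - 1) else (fun=> 0).

Lemma selectionJ (J : set int) p0 p1 U0 U1 y (h : int -> T -> R) (Q S : int -> R) q C :
  J !=set0 -> is_interval J ->
  (1 <= p0)%E -> (1 <= p1)%E -> weight U0 -> weight U1 ->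
  measurable_fun setT y -> (forall n, measurable_fun setT (h n)) ->
  1 < q -> 0 < C -> geometric_weights q Q S ->
  (forall n, J n -> (wnorm mu p0 U0 (upper_cut J y h n) <= (C * Q n)%:E)%E) ->
  (forall n, J n -> J (n + 1) ->
    (wnorm mu p1 U1 (fun x => (y x - h n x)%R) <= (C * S n)%:E)%E) ->
  (forall n, J n -> ~ J (n - 1) -> (wnorm mu p1 U1 y <= (C * S n)%:E)%E) ->
  exists E : int -> set T,
   [/\ forall n, measurable (E n), disjoint_family E,
       forall n x, E n x -> J n /\ `|y x| <= 2 * `|upper_cut J y h n x|,
       forall n x, E n x -> `|y x| <= 2 * `|y x - lower_cut J h n x| &
   [/\ {ae mu, forall x, y x != 0 -> exists n, E n x},
       forall m, (wnorm mu p0 U0 (cut (\bigcup_j E (m - j%:Z)%R) y) <=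
          (2 * (C * Q m) / (1 - q^-1))%:E)%E &
       forall m, (wnorm mu p1 U1 (cut (\bigcup_j E (m + 1 + j%:Z)%R) y) <=
          (2 * (C * S m))%:E)%E ]].
Proof.
move=> J0 iJ hp0 hp1 w0 w1 my mh q1 C0 [Q0 S0 Ql Sl] hQ hS botS.
have q0 : 0 < q by rewrite (lt_trans _ q1).
have l0 : 0 < q^-1 by rewrite invr_gt0.
have l1 : q^-1 < 1 by rewrite invf_lt1.
have [cl [Jcl clJ _ cltop clbot]] := interval_clamp J0 iJ.
have Qmono m n : m <= n -> Q m <= Q n.
  move=> mn; have := @geo_down R Q q^-1 n (absz (n - m)%R) l0 Ql.
  have -> : n - (absz (n - m)%R)%:Z = m by lia.
  move=> /le_trans; apply; rewrite ler_piMl ?(ltW (Q0 _))// exprn_ile1// ltW//.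
have Smono m n : m <= n -> S n <= S m.
  move=> mn; have := @geo_up R S q^-1 m (absz (n - m)%R) l0 Sl.
  have -> : m + (absz (n - m)%R)%:Z = n by lia.
  move=> /le_trans; apply; rewrite ler_piMl ?(ltW (S0 _))// exprn_ile1// ltW//.
pose inJ n := `[< J n /\ J (n + 1) >].
pose above n := `[< exists2 j, J j & j <= n >].
(* Continuation of [h] to all integers: all of [y] from the top end of J on, nothing below J. A
   first index of domination then occurs only in J. *)
pose g n := if inJ n then h n else if above n then y else (fun=> 0).
have mg n : measurable_fun setT (g n).
  by rewrite /g; case: ifP => // _; case: ifP => // _; exact: measurable_cst.
have top n : ~ inJ n -> above n -> cl n <= n.
  move=> /asboolP nJ /asboolP[j Jj jn]; rewrite leNgt; apply/negP => nc.
  have Jn : J n by apply: (iJ j (cl n)) => //; rewrite jn ltW.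
  by rewrite clJ// ltxx in nc.
have gQ n : (wnorm mu p0 U0 (g n) <= (C * Q n)%:E)%E.
  rewrite /g; case: ifP => [/asboolP[Jn Jn1]|/asboolP nJ].
    by have := hQ n Jn; rewrite /upper_cut asboolT.
  case: ifP => [an|_]; last by rewrite wnorm0// lee_fin mulr_ge0// ltW.
  have cn : cl n <= n by apply: top => // /asboolP.
  have := hQ _ (Jcl n); rewrite /upper_cut asboolF; last first.
    by apply: cltop => //; exact/asboolP.
  move=> /le_trans; apply.
  by rewrite lee_fin ler_wpM2l ?(ltW C0)// Qmono.
have gS n : (wnorm mu p1 U1 (fun x => (y x - g n x)%R) <= (C * S n)%:E)%E.
  rewrite /g; case: ifP => [/asboolP[Jn Jn1]|/asboolP nJ]; first exact: hS.
  case: ifP => [_|/asboolP an].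
    rewrite (_ : (fun _ => _) = (fun=> 0)); first by rewrite wnorm0// lee_fin mulr_ge0// ltW.
    by apply/funext => x; rewrite subrr.
  rewrite (_ : (fun _ => _) = y); last by apply/funext => x; rewrite subr0.
  have nlt j : J j -> n < j.
    by move=> Jj; rewrite ltNge; apply/negP => jn; apply: an; exists j.
  apply: (le_trans (botS _ (Jcl n) (clbot _ nlt))).
  by rewrite lee_fin ler_wpM2l ?(ltW C0)// Smono// ltW// nlt.
have [E [mE dE Eg Eg' [Eae Elow Ehigh]]] := selection hp0 hp1 w0 w1 my mg l0 l1 C0
  Q0 S0 Ql Sl gQ gS.
(* Above J the part [g (n - 1)] is already all of [y], so the difference cannot dominate; below J
   [g n] is zero. Either contradicts [y x != 0]. *)
have EJ n x : E n x -> J n.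
  move=> Ex; apply: contrapT => nJ; have [y0 yg] := Eg n x Ex.
  have nin : inJ n = false by apply/asboolP => -[].
  have [an|/negbTE an] := boolP (above n).
    have /asboolP[j Jj jn] := an.
    have an1 : above (n - 1).
      apply/asboolP; exists j => //; suff : j != n by lia.
      by apply/eqP => jE; rewrite jE in Jj.
    have nin1 : inJ (n - 1) = false.
      by apply/asboolP => -[_]; rewrite subrK.
    have := Eg' n (n - 1) x _ Ex; rewrite /g nin1 an1 subrr normr0 mulr0.
    by rewrite gtrBl ltr01 => /(_ isT); rewrite normr_le0 (negbTE y0).
  by move: yg; rewrite /g nin an normr0 mulr0 normr_le0 (negbTE y0).
exists E; split => //.
- move=> n x Ex; have Jn := EJ _ _ Ex; split => //.
  have [_] := Eg n x Ex; rewrite /upper_cut /g.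
  have [Jn1|nJ1] := pselect (J (n + 1)).
    by rewrite /inJ !asboolT.
  rewrite [asbool (J (n + 1))]asboolF// /inJ asboolF; last by case.
  by case: ifP => // /asboolP []; exists n.
- move=> n x Ex; have Jn := EJ _ _ Ex.
  have := Eg' n (n - 1) x _ Ex; rewrite gtrBl ltr01 => /(_ isT).
  rewrite /lower_cut /g; have [Jn1|nJ1] := pselect (J (n - 1)).
    by rewrite /inJ subrK !asboolT.
  rewrite [asbool (J (n - 1))]asboolF// /inJ asboolF; last by case.
  case: ifP => // /asboolP [j Jj jn] _; exfalso; apply: nJ1.
  by apply: (iJ j n) => //; rewrite jn gerBl ler01.
Qed.

End SelectionJ.

(** * Blocks of the source element *)

Section Source.
Context d (T : measurableType d) (R : realType).
Variable mu : {measure set T -> \bar R}.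
Variables (p0 p1 : \bar R) (U0 U1 : T -> R).
Hypothesis hp0 : (1 <= p0)%E.
Hypothesis hp1 : (1 <= p1)%E.
Hypothesis w0 : weight U0.
Hypothesis w1 : weight U1.
Let X := Lp_couple mu p0 p1 U0 U1.

Definition block_decomposition (a : L0 mu) (J : set int) (Q S : int -> R)
    (B : int -> set T) (C : R) : Prop :=
  [/\ forall n, measurable (B n), disjoint_family B, forall n, ~ J n -> B n = set0,
      {ae mu, forall x, ofL0 a x != 0 -> exists n, B n x} &
      forall n, (wnorm mu p0 U0 (cut (B n) (ofL0 a)) <= (C * Q n)%:E)%E /\
                (wnorm mu p1 U1 (cut (B n) (ofL0 a)) <= (C * S n)%:E)%E].

(* Outside J the weights are continued geometrically from the nearest end. *)
Lemma geometric_weights_extension (rho : R -> R) (q : R) (J : set int) (t : int -> R) :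
  quasi_concave rho -> 1 < q -> balanced rho q J t ->
  exists Q S : int -> R,
   [/\ geometric_weights q Q S,
       forall n, J n -> Q n = rho (t n) /\ S n = rho (t n) / t n,
       forall n, Q n = q * Q (n - 1) \/ S (n - 1) = q * S n &
       forall n, ~ J n -> S n = q * S (n + 1)].
Proof.
move=> qc q1 [[J0 iJ] [t0 _] bal _ _]; have [rho0 _ _] := qc.
have q0 : 0 < q by rewrite (lt_trans _ q1).
have qn0 : q != 0 by rewrite gt_eqF.
have [cl [Jcl clJ clS _ _]] := interval_clamp J0 iJ.
pose Q n := rho (t (cl n)) * q ^ (n - cl n).
pose S n := rho (t (cl n)) / t (cl n) * q ^ (cl n - n).
have tc n : 0 < t (cl n) by exact: t0.
have rc n : 0 < rho (t (cl n)) by exact: rho0.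
have Q0 n : 0 < Q n by rewrite mulr_gt0// exprz_gt0.
have S0 n : 0 < S n by rewrite mulr_gt0 ?divr_gt0// exprz_gt0.
have QJ n : J n -> Q n = rho (t n) by move=> Jn; rewrite /Q clJ// subrr expr0z mulr1.
have SJ n : J n -> S n = rho (t n) / t n by move=> Jn; rewrite /S clJ// subrr expr0z mulr1.
have Qc n : cl n = cl (n + 1) -> Q (n + 1) = q * Q n.
  move=> cE; rewrite /Q -cE.
  have -> : n + 1 - cl n = (n - cl n) + 1 by ring.
  by rewrite exprzDr ?unitfE// expr1z; ring.
have Sc n : cl n = cl (n + 1) -> S n = q * S (n + 1).
  move=> cE; rewrite /S -cE.
  have -> : cl n - n = (cl n - (n + 1)) + 1 by ring.
  by rewrite exprzDr ?unitfE// expr1z; ring.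
(* Inside J the balance ratio is a minimum, so both ratios are at least q and one of them equals q;
   beyond the ends both are continued with ratio exactly q. *)
have step n : [/\ q * Q n <= Q (n + 1), q * S (n + 1) <= S n &
    (Q (n + 1) = q * Q n \/ S n = q * S (n + 1))].
  have [[Jn Jn1]|cE] := clS n; last first.
    by split; [rewrite Qc|rewrite -Sc|left; exact: Qc].
  rewrite !QJ// !SJ//; have := bal n Jn Jn1; rewrite /balance_ratio.
  have rn := rho0 _ (t0 _ Jn); have rn1 := rho0 _ (t0 _ Jn1).
  have tn := t0 _ Jn; have tn1 := t0 _ Jn1.
  set u := _ / _; set v := _ / (_ * _) => uv.
  have qu : q <= u by rewrite -uv ge_min lexx.
  have qv : q <= v by rewrite -uv ge_min lexx orbT.
  have uE : rho (t (n + 1)) = u * rho (t n) by rewrite /u divfK// gt_eqF.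
  have vE : rho (t n) / t n = v * (rho (t (n + 1)) / t (n + 1)).
    by rewrite /v; field; rewrite !gt_eqF.
  split.
  - by rewrite uE ler_pM2r.
  - by rewrite vE ler_pM2r// divr_gt0.
  - by move: uv; rewrite minEle; case: ifP => _ <-; [left|right].
exists Q, S; split.
- split => // n.
    by have [h _ _] := step (n - 1); move: h; rewrite subrK ler_pdivlMl.
  by have [_ h _] := step n; rewrite ler_pdivlMl.
- by move=> n Jn; rewrite QJ// SJ.
- by move=> n; have [_ _] := step (n - 1); rewrite subrK.
- by move=> n nJ; have [[]|/Sc] := clS n.
Qed.

Lemma block_decomposition_exists (a : L0 mu) (rho : R -> R) (q : R) (J : set int)
    (t : int -> R) :
  quasi_concave rho -> 1 < q -> balanced rho q J t ->
  (forall s, 0 < s -> Kfun X 1 s a = (rho s)%:E) ->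
  (forall e, 0 < e -> exists2 M, 0 < M & forall s, M <= s -> rho s / s <= e) ->
  (forall e, 0 < e -> exists2 M, 0 < M & forall s, 0 < s -> s <= M -> rho s <= e) ->
  exists (Q S : int -> R) (B : int -> set T) (C : R),
   [/\ 0 < C, geometric_weights q Q S,
       forall n, J n -> Q n = rho (t n) /\ S n = rho (t n) / t n &
       block_decomposition a J Q S B C].
Proof.
move=> qc q1 baln Krho limy lim0.
have [Q [S [gQS QSJ dich offJ]]] := geometric_weights_extension qc q1 baln.
have [[J0 iJ] [t0 _] _ topJ botJ] := baln; have [rho0 _ _] := qc.
have [Q0 S0 Ql Sl] := gQS.
have q0 : 0 < q by rewrite (lt_trans _ q1).
pose y := ofL0 a; have my : measurable_fun setT y by exact: measurable_ofL0.
have dec s : 0 < s -> exists u : L0 mu, (wnorm mu p0 U0 (ofL0 u) <= (2 * rho s)%:E)%E /\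
    (wnorm mu p1 U1 (fun x => (y x - ofL0 u x)%R) <= (2 * (rho s / s))%:E)%E.
  move=> s0; have rs := rho0 s s0.
  have : (Kfun X 1 s a < (2 * rho s)%:E)%E by rewrite Krho// lte_fin ltr_pMl// ltr1n.
  move=> /(Kfun_decomp ltr01 s0)[x0 [x1 [aE h0 h1]]]; exists x0; split.
    by rewrite divr1 in h0.
  rewrite mulrA; apply: le_trans h1; rewrite (_ : weighted_Lnorm p1 U1 x1 = wnorm mu p1 U1 (ofL0 x1))//.
  apply: wnorm_le => //; first exact: measurable_funB.
  by apply: filterS (ofL0_D x0 x1) => x; rewrite /y aE => ->; rewrite addrC addKr.
have /choice[h hP] (n : int) : exists u : L0 mu, J n ->
    (wnorm mu p0 U0 (ofL0 u) <= (2 * rho (t n))%:E)%E /\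
    (wnorm mu p1 U1 (fun x => (y x - ofL0 u x)%R) <= (2 * (rho (t n) / t n))%:E)%E.
  have [Jn|nJ] := pselect (J n); last by exists 0.
  by have [u hu] := dec _ (t0 _ Jn); exists u.
(* One 2 comes from near-optimal decompositions, q from the bound on rho past an end, the other 2
   from [wnorm_le_of_decompositions]. *)
pose C := 4 * q; have C0 : 0 < C by rewrite mulr_gt0.
have C2 : 2 <= C.
  by rewrite /C; move: q1; lra.
(* At the top end, decompositions at s tending to infinity have first parts bounded by 2 * q * rho
   (t n) and second parts tending to 0, so [a] lies in the first space. *)
have topN n : J n -> ~ J (n + 1) -> (wnorm mu p0 U0 y <= (C * Q n)%:E)%E.
  move=> Jn nJ; have [-> _] := QSJ n Jn; have tn := t0 _ Jn.
  have bound := balanced_top qc q1 tn limy (topJ n Jn nJ).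
  have -> : C * rho (t n) = 2 * (2 * (q * rho (t n))) by rewrite /C; ring.
  apply: (wnorm_le_of_decompositions hp1 hp0 w1 w0 my).
    by rewrite !mulr_ge0// ltW// rho0.
  move=> e e0; have e2 : 0 < e / 2 by rewrite divr_gt0.
  have [M M0 /(_ _ (lexx _)) hM] := limy _ e2.
  have [u [u0 u1]] := dec _ M0.
  exists (fun x => y x - ofL0 u x), (ofL0 u); split => //.
  - exact: measurable_funB.
  - by move=> x; rewrite subrK.
  - by apply: (le_trans u1); rewrite lee_fin; lra.
  - by apply: (le_trans u0); rewrite lee_fin ler_pM2l// bound.
have botN n : J n -> ~ J (n - 1) -> (wnorm mu p1 U1 y <= (C * S n)%:E)%E.
  move=> Jn nJ; have [_ ->] := QSJ n Jn; have tn := t0 _ Jn.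
  have bound := balanced_bottom qc q1 tn lim0 (botJ n Jn nJ).
  have -> : C * (rho (t n) / t n) = 2 * (2 * (q * (rho (t n) / t n))) by rewrite /C; ring.
  apply: (wnorm_le_of_decompositions hp0 hp1 w0 w1 my).
    by rewrite ltW// !mulr_gt0// ?invr_gt0// rho0.
  move=> e e0; have e2 : 0 < e / 2 by rewrite divr_gt0.
  have [M M0 /(_ _ M0 (lexx _)) hM] := lim0 _ e2.
  have [u [u0 u1]] := dec _ M0.
  exists (ofL0 u), (fun x => y x - ofL0 u x); split => //.
  - exact: measurable_funB.
  - by move=> x; rewrite subrKC.
  - by apply: (le_trans u0); rewrite lee_fin; lra.
  - by apply: (le_trans u1); rewrite lee_fin ler_pM2l// bound.
pose hh n := ofL0 (h n).
have [||E [mE dE EJ E' [Eae _ _]]] := @selectionJ _ _ _ mu J p0 p1 U0 U1 y hh Q S q C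
  J0 iJ hp0 hp1 w0 w1 my (fun n => measurable_ofL0 (h n)) q1 C0 gQS _ _ botN.
- move=> n Jn; rewrite /upper_cut; case: ifP => [_|/asboolP nJ]; last exact: topN.
  have [hn _] := hP n Jn; apply: (le_trans hn); have [-> _] := QSJ n Jn.
  by rewrite lee_fin ler_wpM2r// ltW// rho0// t0.
- move=> n Jn _; have [_ hn] := hP n Jn; apply: (le_trans hn).
  have [_ ->] := QSJ n Jn.
  by rewrite lee_fin ler_wpM2r// ltW// divr_gt0 ?rho0 ?t0.
have E0 n : (wnorm mu p0 U0 (cut (E n) y) <= (2 * (C * Q n))%:E)%E.
  have [Jn|nJ] := pselect (J n); last first.
    rewrite (_ : cut _ _ = (fun=> 0)); first by rewrite wnorm0// lee_fin !mulr_ge0// ltW.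
    by apply/funext => x; rewrite cutF// => /EJ[].
  apply: (@wnorm_cut_dom _ _ _ mu p0 U0 y (upper_cut J y hh n)) => //.
  - by rewrite /upper_cut; case: ifP => // _; exact: measurable_ofL0.
  - by rewrite mulr_ge0// ltW.
  - by move=> x /EJ[].
  rewrite /upper_cut; case: ifP => [_|/asboolP nJ]; last exact: topN.
  have [hn _] := hP n Jn; apply: (le_trans hn); have [-> _] := QSJ n Jn.
  by rewrite lee_fin ler_wpM2r// ltW// rho0// t0.
have E1 n : (wnorm mu p1 U1 (cut (E n) y) <= (2 * (C * S (n - 1)))%:E)%E.
  have [Jn|nJ] := pselect (J n); last first.
    rewrite (_ : cut _ _ = (fun=> 0)); first by rewrite wnorm0// lee_fin !mulr_ge0// ltW.
    by apply/funext => x; rewrite cutF// => /EJ[].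
  apply: (@wnorm_cut_dom _ _ _ mu p1 U1 y (fun x => y x - lower_cut J hh n x)) => //.
  - apply: measurable_funB => //.
    by rewrite /lower_cut; case: ifP => _; [exact: (measurable_ofL0 (h _))|exact: measurable_cst].
  - by rewrite mulr_ge0// ltW.
  - by move=> x /E'.
  rewrite /lower_cut; case: ifP => [/asboolP Jn1|/asboolP nJ].
    have [_ hn] := hP _ Jn1; apply: (le_trans hn); have [_ ->] := QSJ _ Jn1.
    by rewrite lee_fin ler_wpM2r// ltW// divr_gt0 ?rho0 ?t0.
  rewrite (_ : (fun _ => _) = y); last by apply/funext => x; rewrite subr0.
  apply: (le_trans (botN n Jn nJ)); rewrite lee_fin ler_wpM2l// ?(ltW C0)//.
  have := Sl (n - 1); rewrite subrK => /le_trans; apply.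
  by rewrite ler_piMl ?(ltW (S0 _))// invf_le1// ltW.
(* [E n] has second norm of order S (n - 1). If this equals q * S n, the set serves block n;
   otherwise Q n = q * Q (n - 1), and the first norm admits it in block n - 1. Block n thus collects
   at most [E n] and [E (n + 1)]. *)
pose up n := `[< S (n - 1) = q * S n >].
have nup n : ~~ up n -> Q n = q * Q (n - 1).
  by move=> /asboolP nS; have [|/nS] := dich n.
pose B n := [set x | E n x /\ up n] `|` [set x | E (n + 1) x /\ ~~ up (n + 1)].
have mset (P : bool) n : measurable [set x | E n x /\ P].
  case: P; first by rewrite (_ : [set x | _] = E n)//; apply/seteqP; split => x //= [].
  by rewrite (_ : [set x | _] = set0)//; apply/seteqP; split => x //= [].
have mB n : measurable (B n) by apply: measurableU; exact: mset.
exists Q, S, B, (2 * C * (1 + q)); split => //; first by rewrite !mulr_gt0 ?addr_gt0.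
split => //.
- move=> m n x [[Em um]|[Em um]] [[En un]|[En un]].
  + exact: dE Em En.
  + have mE' := dE _ _ _ Em En; by rewrite -mE' um in un.
  + have mE' := dE _ _ _ Em En; by rewrite mE' un in um.
  + by have := dE _ _ _ Em En; lia.
(* Off J the continued weights satisfy S n = q * S (n + 1), so [up (n + 1)] holds and [E (n + 1)] is
   not moved down to n: the blocks stay inside J. *)
- move=> n nJ; apply/seteqP; split => // x [[/EJ[]//]|[En1 un]].
  by move/asboolP: un; apply; rewrite addrK offJ.
- apply: filterS Eae => x h0 y0; have [n En] := h0 y0.
  have [un|un] := boolP (up n); first by exists n; left.
  by exists (n - 1); right; rewrite subrK.
move=> n; pose F b k : T -> R := if b then cut (E k) y else (fun=> 0).
have mF b k : measurable_fun setT (F b k).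
  by rewrite /F; case: b => //; exact: measurable_cut.
have BF x : cut (B n) y x = F (up n) n x + F (~~ up (n + 1)) (n + 1) x.
  rewrite /F; have [[[En un]|[En un]]|nB] := pselect (B n x).
  - rewrite un cutT; last by left.
    rewrite cutT//; case: ifP => _; rewrite ?addr0//.
    by rewrite cutF ?addr0// => /(dE _ _ _ En); lia.
  - rewrite un [cut (E (n + 1)) y x]cutT// cutT; last by right.
    case: ifP => _; rewrite ?add0r// cutF ?add0r// => /(dE _ _ _ En); lia.
  - rewrite (cutF _ nB); case: ifP => un; case: ifP => un1; rewrite ?addr0 ?add0r//.
    + rewrite !cutF ?addr0//; first by move=> En1; apply: nB; right.
      by move=> En; apply: nB; left.
    + by rewrite cutF// => En; apply: nB; left.
    + by rewrite cutF// => En1; apply: nB; right.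
have bound p U (D1 D2 : R) : (1 <= p)%E -> weight U -> 0 <= D1 -> 0 <= D2 ->
    (up n -> (wnorm mu p U (cut (E n) y) <= D1%:E)%E) ->
    (~~ up (n + 1) -> (wnorm mu p U (cut (E (n + 1)%R) y) <= D2%:E)%E) ->
    (wnorm mu p U (cut (B n) y) <= (D1 + D2)%:E)%E.
  move=> p1' wU D10 D20 b1 b2.
  have -> : cut (B n) y = (F (up n) n \+ F (~~ up (n + 1)) (n + 1))%R by apply/funext.
  apply: (le_trans (wnormD _ _ _ _ _)) => //; rewrite EFinD; apply: leeD.
    by rewrite /F; case: ifP => u; [exact: b1|rewrite wnorm0// lee_fin].
  by rewrite /F; case: ifP => u; [exact: b2|rewrite wnorm0// lee_fin].
have Qn := ltW (Q0 n); have Sn := ltW (S0 n); have C0' := ltW C0; have q0' := ltW q0.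
split.
  have -> : 2 * C * (1 + q) * Q n = 2 * (C * Q n) + 2 * (C * (q * Q n)) by ring.
  apply: bound => //; rewrite ?mulr_ge0//.
  by move=> /nup; rewrite addrK => <-.
have -> : 2 * C * (1 + q) * S n = 2 * (C * (q * S n)) + 2 * (C * S n) by ring.
apply: bound => //; rewrite ?mulr_ge0//.
  by move=> /asboolW <-.
by have := E1 (n + 1); rewrite addrK.
Qed.

End Source.

(** * From the orbit to the phi-space *)

Section Operators.
Context (R : realType) (X Y : couple R).
Variable T : X -> Y.
Hypothesis opT : couple_operator T.
Hypothesis X0 : csum X 0.
Hypothesis Xlin : forall (c : R) (x y : X), csum X x -> csum X y -> csum X (c *: x + y).

Lemma couple_operatorD x y : csum X x -> csum X y -> T (x + y) = T x + T y.
Proof. by case: opT => _ lT _ _ hx hy; have := lT 1 x y hx hy; rewrite !scale1r. Qed.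

Lemma couple_operator0 : T 0 = 0.
Proof. by have := couple_operatorD X0 X0; rewrite addr0 => /esym/eqP; rewrite -subr_eq0 addrK => /eqP. Qed.

Lemma couple_operatorZ (c : R) x : csum X x -> T (c *: x) = c *: T x.
Proof.
by case: opT => _ lT _ _ hx; have := lT c x 0 hx X0; rewrite couple_operator0 !addr0.
Qed.

Lemma csum_sum (I : Type) (s : seq I) (c : I -> R) (x : I -> X) :
  (forall i, csum X (x i)) -> csum X (\sum_(i <- s) c i *: x i).
Proof.
by move=> hx; elim: s => [|i s IH]; [rewrite big_nil|rewrite big_cons; exact: Xlin].
Qed.

Lemma couple_operator_sum (I : Type) (s : seq I) (c : I -> R) (x : I -> X) :
  (forall i, csum X (x i)) ->
  T (\sum_(i <- s) c i *: x i) = \sum_(i <- s) c i *: T (x i).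
Proof.
move=> hx; elim: s => [|i s IH]; first by rewrite !big_nil couple_operator0.
rewrite !big_cons -IH; case: opT => _ lT _ _; apply: lT => //; exact: csum_sum.
Qed.

End Operators.

Section OperatorBound.
Context d d' (TX : measurableType d) (TY : measurableType d') (R : realType).
Variables (mu : {measure set TX -> \bar R}) (nu : {measure set TY -> \bar R}).
Implicit Types (p r : \bar R).

(** [opnorm] tests only the unit ball, so x is scaled by l^-1. Homogeneity of T is available on a
    set D, in practice the sum of the couple. *)
Lemma opnorm_bound p r U V (D : set (L0 mu)) (T : L0 mu -> L0 nu) (A l : R) x :
  (1 <= p)%E -> (1 <= r)%E -> weight U -> weight V ->
  (forall (c : R) x, D x -> T (c *: x) = c *: T x) -> (forall (c : R) x, D x -> D (c *: x)) ->
  0 < A -> 0 < l ->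
  (opnorm (weighted_Lnorm (mu := mu) p U) (weighted_Lnorm (mu := nu) r V) T <= A%:E)%E ->
  D x -> (weighted_Lnorm p U x <= l%:E)%E -> (weighted_Lnorm r V (T x) <= (A * l)%:E)%E.
Proof.
move=> p1 r1 wU wV TZ DZ A0 l0 TA Dx xl.
have l0' := ltW l0; have A0' := ltW A0.
have x'1 : (weighted_Lnorm p U (l^-1 *: x)%R <= 1)%E.
  have := wLnormZ_le l^-1 p1 wU l0' xl.
  by rewrite ger0_norm ?invr_ge0// mulVf// gt_eqF.
have Tx' : (weighted_Lnorm r V (T (l^-1 *: x)%R) <= A%:E)%E.
  by apply: le_trans TA; apply: ereal_sup_ubound; exists (l^-1 *: x).
have := wLnormZ_le l r1 wV A0' Tx'; rewrite ger0_norm// mulrC.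
by rewrite -TZ ?scalerA ?mulfV ?scale1r ?gt_eqF//; exact: DZ.
Qed.

End OperatorBound.

Section SourceSums.
Context d (T : measurableType d) (R : realType).
Variable mu : {measure set T -> \bar R}.
Implicit Types (p : \bar R) (U : T -> R) (B : int -> set T).

Lemma wnormZ_ge p U (f : T -> R) (c : R) : (1 <= p)%E -> weight U -> measurable_fun setT f ->
  wnorm mu p U f \is a fin_num -> wnorm mu p U (fun x => c * f x)%R \is a fin_num ->
  `|c| * fine (wnorm mu p U f) <= fine (wnorm mu p U (fun x => c * f x)%R).
Proof.
move=> p1 wU mf ff fcf; have [->|c0] := eqVneq c 0.
  by rewrite normr0 mul0r fine_ge0// wnorm_ge0.
have mcf : measurable_fun setT (fun x => c * f x) by exact: measurable_funM.
have g0 : 0 <= fine (wnorm mu p U (fun x => c * f x)%R) by rewrite fine_ge0// wnorm_ge0.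
have := @wnormZ _ _ _ mu p U (fun x => c * f x) _ c^-1 p1 wU mcf g0.
rewrite fineK// => /(_ (lexx _)).
rewrite (_ : (fun x => c^-1 * (c * f x)) = f); last by apply/funext => x; rewrite mulKf.
by rewrite -[leLHS]fineK// lee_fin normfV ler_pdivlMl ?normr_gt0.
Qed.

(** These are the test functions fed to an operator: the blocks are disjoint and of norm at most D *
    W n, so division by W n turns a point of the l_p ball into a function of norm at most D. The
    injection [tau] shifts the index. *)
Lemma wnorm_source_sum p U B (a : T -> R) (tau : int -> int) (W : int -> R) (D : R)
    (s : seq int) (xi : int -> R) :
  (1 <= p)%E -> weight U -> uniq s -> disjoint_family B -> (forall n, measurable (B n)) ->
  injective tau -> measurable_fun setT a -> 0 < D -> (forall n, 0 < W n) ->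
  (forall n, wnorm mu p U (cut (B (tau n)) a) <= (D * W n)%:E)%E ->
  lball p s xi ->
  (wnorm mu p U (fun x => (\sum_(n <- s) (xi n / W n) * cut (B (tau n)) a x)%R) <= D%:E)%E.
Proof.
move=> p1 wU us dB mB itau ma D0 W0 hW hxi.
have := @wnorm_sum_disjoint _ _ _ mu p U (B \o tau) (fun n x => (xi n / W n) * a x) s xi D
  p1 wU us _ _ _ D0 _ hxi.
rewrite (_ : (fun t => \sum_(n <- s) cut ((B \o tau) n) _ t) =
  (fun x => \sum_(n <- s) xi n / W n * cut (B (tau n)) a x)); last first.
  by apply/funext => x; apply: eq_bigr => n _; rewrite /cut /= mulrA.
apply => //.
- by move=> m n x /= Bm /(dB _ _ _ Bm) /itau.
- by move=> n /=.
- by move=> n; apply: measurable_funM.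
move=> n ns; rewrite (_ : cut _ _ = (fun x => (xi n / W n) * cut (B (tau n)) a x)); last first.
  by apply/funext => x; rewrite /cut /= mulrA.
have Wn := W0 n.
apply: (le_trans (wnormZ _ p1 wU _ _ (hW n))); first exact: measurable_cut.
  by rewrite mulr_ge0// ltW.
by rewrite lee_fin normrM normfV (gtr0_norm Wn) mulrCA -mulrA mulVf ?mulr1// gt_eqF.
Qed.

End SourceSums.

(** * Diagonal estimates for the images of blocks, one norm at a time *)

Section OrbitBlocks.
Context d d' (TX : measurableType d) (TY : measurableType d') (R : realType).
Variables (mu : {measure set TX -> \bar R}) (nu : {measure set TY -> \bar R}).
Variables (p r : \bar R) (U : TX -> R) (V : TY -> R).
Hypotheses (p1 : (1 <= p)%E) (r1 : (1 <= r)%E) (wU : weight U) (wV : weight V).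
Variables (CX : set (L0 mu)) (T : L0 mu -> L0 nu) (A : R).
Hypothesis CX_sum : forall (s : seq int) (c : int -> R) (x : int -> L0 mu),
  (forall i, CX (x i)) -> CX (\sum_(i <- s) c i *: x i).
Hypothesis T_sum : forall (s : seq int) (c : int -> R) (x : int -> L0 mu),
  (forall i, CX (x i)) -> T (\sum_(i <- s) c i *: x i) = \sum_(i <- s) c i *: T (x i).
Hypothesis A0 : 0 < A.
Hypothesis T_bound : forall x (l : R), CX x -> 0 < l ->
  (weighted_Lnorm p U x <= l%:E)%E -> (weighted_Lnorm r V (T x) <= (A * l)%:E)%E.
Variables (a : L0 mu) (B : int -> set TX) (E : int -> set TY).
Hypotheses (dB : disjoint_family B) (mB : forall n, measurable (B n)).
Hypotheses (dE : disjoint_family E) (mE : forall n, measurable (E n)).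
Hypothesis CXB : forall n, CX (rcut (B n) a).
Variables (tau : nat -> int -> int) (W : int -> R) (D l : R).
Hypotheses (W0 : forall n, 0 < W n) (D0 : 0 < D) (l0 : 0 < l) (l1 : l < 1).
Hypothesis tau_inj : forall i, injective (tau i).
Hypothesis hB : forall i n,
  (wnorm mu p U (cut (B (tau i n)) (ofL0 a)) <= (D * l ^+ i * W n)%:E)%E.
Variables (z : int -> L0 nu) (tail : nat -> int -> L0 mu).
Hypothesis CXtail : forall I n, CX (tail I n).
Hypothesis tail_bound : forall I n,
  (weighted_Lnorm p U (tail I n) <= (D * l ^+ I * W n)%:E)%E.
Hypothesis zE : forall I n, z n = \sum_(i < I) T (rcut (B (tau i n)) a) + T (tail I n).

(** For a fixed shift i the sum of normalised blocks has norm at most D * l ^ i, and so has every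
    change of signs; cut down to the diagonal, the image keeps the bound A * D * l ^ i. In use z n
    is the image of the part of [a] on one side of n, and tau i n is n - i or n + i. *)
Lemma wnorm_orbit_sum (s : seq int) (xi : int -> R) : uniq s -> lball p s xi ->
  (wnorm nu r V (fun x => (\sum_(n <- s) cut (E n) (fun x => xi n / W n * ofL0 (z n) x) x)%R)
     <= (A * D / (1 - l) + A * D)%:E)%E.
Proof.
move=> us hxi; have c0 : 0 < A * D by rewrite mulr_gt0.
have p0 : (0 < p)%E by rewrite (lt_le_trans _ p1).
have xi1 n : n \in s -> `|xi n| <= 1 by exact: (lball_le1 p0 hxi).
(* I is taken so large that the tails, one for each element of [s], add up to at most A * D. *)
have sz0 : 0 < (size s).+1%:R^-1 :> R by rewrite invr_gt0.
have [I /(_ I (leqnn I)) hI] := geometric_small l0 l1 sz0.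
pose v i n x := xi n / W n * ofL0 (T (rcut (B (tau i n)) a)) x.
pose rest n x := xi n / W n * ofL0 (T (tail I n)) x.
have mv i n : measurable_fun setT (v i n) by apply: measurable_funM.
have mrest n : measurable_fun setT (rest n) by apply: measurable_funM.
apply: (@wnorm_sum_cut_dom _ _ _ nu r V E s _ I v rest (A * D) l) => //.
- by move=> n; apply: measurable_funM.
- exact: ltW.
- have : forall k : nat, {ae nu, forall x, ofL0 (z (nth 0 s k)) x =
     \sum_(i < I) ofL0 (T (rcut (B (tau i (nth 0 s k))) a)) x + ofL0 (T (tail I (nth 0 s k))) x}.
    move=> k; pose Ti (i : 'I_I) := T (rcut (B (tau i (nth 0 s k))) a).
    apply: filterS2 (ofL0_D (\sum_(i < I) Ti i) (T (tail I (nth 0 s k))))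
      (ofL0_sum (index_enum 'I_I) xpredT Ti) => x E1 E2.
    by rewrite (zE I) E1 E2.
  move/ae_foralln; apply: filterS => x hx n ns _.
  have := hx (index n s); rewrite nth_index// => ->.
  rewrite mulrDr; apply: (le_trans (ler_normD _ _)); rewrite lerD2r mulr_sumr.
  exact: ler_norm_sum.
- move=> i _; apply: wnorm_diagonal => //; first by rewrite mulr_ge0 ?exprn_ge0// ltW.
  (* The signs are absorbed into the coefficients, which stay in the ball. *)
  move=> eps; pose xe n := (-1) ^+ eps n * xi n.
  have hxe : lball p s xe.
    by apply: lball_le hxi => // n _; rewrite /xe normrM normr_sign mul1r.
  have Dl0 : 0 < D * l ^+ i by rewrite mulr_gt0// exprn_gt0.
  have := wnorm_source_sum p1 wU us dB mB (@tau_inj i) (measurable_ofL0 a) Dl0 W0 (hB i) hxe.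
  set g := (fun x => \sum_(n <- s) _) => hg.
  have mg : measurable_fun setT g.
    by apply: measurable_big => n; apply: measurable_funM => //; exact: measurable_cut.
  have clg : cls mu g = \sum_(n <- s) (xe n / W n) *: rcut (B (tau i n)) a.
    apply: cls_eqP => //.
    have : forall k : nat, {ae mu, forall x, ofL0 ((xe (nth 0 s k) / W (nth 0 s k)) *: rcut (B (tau i (nth 0 s k))) a) x =
        xe (nth 0 s k) / W (nth 0 s k) * cut (B (tau i (nth 0 s k))) (ofL0 a) x}.
      move=> k; apply: filterS2 (ofL0_Z (xe (nth 0 s k) / W (nth 0 s k)) (rcut (B (tau i (nth 0 s k))) a))
        (clsE mu (measurable_rcut a (mB (tau i (nth 0 s k))))) => x -> Ex.
      by rewrite /rcut Ex.
    move/ae_foralln => h; apply: filterS2 h (ofL0_sum s xpredT (fun n => (xe n / W n) *: rcut (B (tau i n)) a)) => x hx ->.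
    apply: eq_big_seq => n ns.
    by have := hx (index n s); rewrite nth_index.
  have := @T_bound (cls mu g) _ _ Dl0; rewrite wLnorm_cls// hg => /(_ _ isT).
  rewrite clg => /(_ (CX_sum _ _ (fun n => CXB (tau i n)))); rewrite T_sum//.
  rewrite mulrA; apply: le_trans.
  rewrite wLnormE; apply: wnorm_le => //.
    by apply: measurable_big => n; exact: measurable_funM.
  have : forall k : nat, {ae nu, forall x, ofL0 ((xe (nth 0 s k) / W (nth 0 s k)) *: T (rcut (B (tau i (nth 0 s k))) a)) x =
        xe (nth 0 s k) / W (nth 0 s k) * ofL0 (T (rcut (B (tau i (nth 0 s k))) a)) x}.
    by move=> k; exact: ofL0_Z.
  move/ae_foralln => h; apply: filterS2 h (ofL0_sum s xpredT (fun n => (xe n / W n) *: T (rcut (B (tau i n)) a))) => x hx ->.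
  rewrite le_eqVlt; apply/orP; left; apply/eqP; congr `|_|.
  apply: eq_big_seq => n ns; have := hx (index n s); rewrite nth_index// => ->.
  by rewrite /v /xe !mulrA.
- apply: (@le_trans _ _ (\sum_(n <- s) (A * D * l ^+ I))%:E).
    apply: wnorm_sum_le => //; first by move=> n; exact: measurableT_comp.
    move=> n ns; apply: (@le_trans _ _ (wnorm nu r V (rest n))).
      apply: wnorm_le => //; first exact: measurableT_comp.
      by apply: nearW => x; rewrite normr_id.
    have Wn := W0 n; have lI : 0 < l ^+ I by rewrite exprn_gt0.
    have DW0 : 0 < D * l ^+ I * W n by rewrite !mulr_gt0.
    have hT := T_bound (CXtail I n) DW0 (tail_bound I n).
    have ADW : 0 <= A * (D * l ^+ I * W n) by rewrite mulr_ge0// ltW.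
    apply: (le_trans (wnormZ _ r1 wV (measurable_ofL0 _) ADW hT)).
    rewrite lee_fin normrM normfV (gtr0_norm Wn).
    have -> : `|xi n| / W n * (A * (D * l ^+ I * W n)) = `|xi n| * (A * D * l ^+ I).
      by field; rewrite gt_eqF.
    by rewrite ler_piMl ?xi1// !mulr_ge0// ltW.
  rewrite lee_fin big_const_seq count_predT iter_addr_0 -mulr_natr -mulrA.
  rewrite ler_piMr ?(ltW c0)//.
  apply: (@le_trans _ _ ((size s).+1%:R^-1 * (size s)%:R)).
    by rewrite ler_wpM2r.
  by rewrite mulrC ler_pdivrMr// mul1r ler_nat.
Qed.

Variables (y : TY -> R) (J : set int).
Hypothesis my : measurable_fun setT y.
Hypothesis yz : forall n, J n ->
  {ae nu, forall x, E n x -> `|y x| <= 2 * `|ofL0 (z n) x|}.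

Lemma orbit_multiplier (s : seq int) (xi : int -> R) : uniq s -> (forall n, n \in s -> J n) ->
  lball p s xi ->
  (wnorm nu r V (fun x => (\sum_(n <- s) cut (E n) (fun x => xi n / W n * y x) x)%R)
     <= (2 * (A * D / (1 - l) + A * D))%:E)%E.
Proof.
move=> us sJ hxi.
set c := A * D / (1 - l) + A * D.
have c0 : 0 <= c.
  have l1' : 0 < 1 - l by rewrite subr_gt0.
  by rewrite ltW// addr_gt0 ?divr_gt0// mulr_gt0.
have h := wnorm_orbit_sum us hxi.
have mg (u : TY -> R) : measurable_fun setT u ->
    measurable_fun setT (fun x => \sum_(n <- s) cut (E n) (fun x => xi n / W n * u x) x).
  by move=> mu_; apply: measurable_big => n; apply: measurable_cut => //; exact: measurable_funM.
have mgz : measurable_fun setT (fun x => \sum_(n <- s) cut (E n) (fun x => xi n / W n * ofL0 (z n) x) x).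
  by apply: measurable_big => n; apply: measurable_cut => //; exact: measurable_funM.
have := wnormZ 2 r1 wV mgz c0 h; rewrite normr_nat; apply: le_trans.
apply: wnorm_le => //; [exact: mg|exact: measurable_funM|].
have : forall k : nat, {ae nu, forall x, nth 0 s k \in s -> E (nth 0 s k) x ->
    `|y x| <= 2 * `|ofL0 (z (nth 0 s k)) x|}.
  move=> k; have [ks|nks] := boolP (nth 0 s k \in s); last by apply: nearW.
  by apply: filterS (yz (sJ _ ks)) => x hx _.
move/ae_foralln; apply: filterS => x hx.
have [[n ns Ex]|nE] := pselect (exists2 n, n \in s & E n x); last first.
  rewrite big1_seq ?normr0// => n /andP[_ ns]; rewrite cutF// => Ex.
  by apply: nE; exists n.
have sumE (g : int -> TY -> R) : \sum_(n <- s) cut (E n) (g n) x = g n x.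
  rewrite (bigD1_seq n)//= big1 ?addr0 ?cutT//.
  by move=> k /eqP kn; rewrite cutF// => /dE /(_ Ex).
rewrite !sumE.
have := hx (index n s); rewrite nth_index// => /(_ ns Ex) hy.
by rewrite [leLHS]normrM [leRHS]normrM normr_nat [X in 2 * X]normrM mulrCA ler_wpM2l.
Qed.

(** Every xi in the l_p ball multiplies the normalised block norms into the ball of the target
    exponent r, up to the scale c; [lball_mul_converse] then yields the multiplier exponent. *)
Lemma orbit_block_norms c : c = 2 * (A * D / (1 - l) + A * D) ->
  (forall n, J n -> wnorm nu r V (cut (E n) y) \is a fin_num) /\
  (forall s, uniq s -> (forall n, n \in s -> J n) ->
    lball (multiplier_exponent p r) s (fun n => (W n)^-1 * fine (wnorm nu r V (cut (E n) y)) / c)).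
Proof.
move=> cE; have l1' : 0 < 1 - l by rewrite subr_gt0.
have c0 : 0 < c by rewrite cE mulr_gt0// addr_gt0 ?divr_gt0// mulr_gt0.
(* [fine] would send an infinite norm to 0, so finiteness comes first, from the one-element family
   [[:: n]] with coefficient 1. *)
have finE n : J n -> wnorm nu r V (cut (E n) y) \is a fin_num.
  move=> Jn; have Wn := W0 n.
  have sJ k : k \in [:: n] -> J k by rewrite inE => /eqP ->.
  have h1 : lball p [:: n] (fun=> 1).
    case: (p) p1 => [e| |]//= _; last by move=> *; rewrite normr1.
    by rewrite big_seq1 normr1 powR1.
  have := orbit_multiplier (isT : uniq [:: n]) sJ h1; rewrite -cE.
  rewrite (_ : (fun x => _) = (fun x => (W n)^-1 * cut (E n) y x)); last first.
    by apply/funext => x; rewrite big_seq1 /cut div1r mulrA.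
  have mc : measurable_fun setT (fun x => (W n)^-1 * cut (E n) y x).
    by apply: measurable_funM => //; exact: measurable_cut.
  move=> /(wnormZ (W n) r1 wV mc (ltW c0)).
  rewrite (_ : (fun x => _ * (_ * _)) = cut (E n) y); last first.
    by apply/funext => x; rewrite mulVKf// gt_eqF.
  by move=> h; rewrite ge0_fin_numE ?wnorm_ge0// (le_lt_trans h)// ltry.
split=> // s us sJ; apply: (lball_mul_converse p1 r1 us) => xi hxi.
have := orbit_multiplier us sJ hxi; rewrite -cE.
set f := (fun x => \sum_(n <- s) _) => hf.
have mf : measurable_fun setT f.
  by apply: measurable_big => n; apply: measurable_cut => //; exact: measurable_funM.
have := wnorm_lball_disjoint r1 wV us dE mE mf c0 hf; apply: lball_le => // n ns.
have Wn := W0 n.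
have cutf : cut (E n) f = (fun x => (xi n / W n) * cut (E n) y x).
  apply/funext => x; have [Ex|nEx] := pselect (E n x); last by rewrite !cutF// mulr0.
  rewrite !cutT// /f (bigD1_seq n)//= big1 ?addr0 ?cutT//.
  by move=> k /eqP kn; rewrite cutF// => /dE /(_ Ex).
have mcy : measurable_fun setT (cut (E n) y) by exact: measurable_cut.
have cutfin : wnorm nu r V (cut (E n) f) \is a fin_num.
  rewrite ge0_fin_numE ?wnorm_ge0//; apply: (le_lt_trans _ (ltry c)).
  apply: le_trans hf; apply: wnorm_le => //; first exact: measurable_cut.
  by apply: nearW => x; exact: norm_cut.
have := @wnormZ_ge _ _ _ nu r V (cut (E n) y) (xi n / W n) r1 wV mcy (finE n (sJ n ns)).
rewrite -cutf => /(_ cutfin) h.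
have g0 : 0 <= fine (wnorm nu r V (cut (E n) y)) by rewrite fine_ge0// wnorm_ge0.
have g1 : 0 <= fine (wnorm nu r V (cut (E n) f)) by rewrite fine_ge0// wnorm_ge0.
rewrite [leRHS]ger0_norm ?divr_ge0 ?(ltW c0)// mulrA normrM normfV (gtr0_norm c0).
rewrite ler_wpM2r ?invr_ge0 ?(ltW c0)//; apply: le_trans h.
by rewrite mulrA normrM (ger0_norm g0).
Qed.

End OrbitBlocks.

Lemma multiplier_exponent_ge1 (R : realType) (p q : \bar R) : (1 <= p)%E -> (1 <= q)%E ->
  (1 <= multiplier_exponent p q)%E.
Proof.
move=> p1 q1; case: (multiplier_exponentP p1 q1) => //; first by rewrite leey.
move=> e f g pE _ f1 _ g0 fE; have e0 : 0 < e.
  by move: p1; rewrite pE lee_fin; apply: lt_le_trans.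
have f0 : 0 < f by rewrite (lt_le_trans _ f1).
rewrite lee_fin -[leLHS]invr1 -[leRHS]invrK lef_pV2 ?posrE ?invr_gt0//.
have : f^-1 <= 1 by rewrite invf_le1.
have : 0 < e^-1 by rewrite invr_gt0.
rewrite fE; lra.
Qed.

Lemma lnorm_le_of_lball (R : realType) (J : set int) (r : \bar R) (u : int -> \bar R)
    (b : int -> R) (c : R) : (1 <= r)%E -> 0 < c ->
  (forall n, J n -> (0 <= u n)%E /\ (u n <= (b n)%:E)%E) ->
  (forall s, uniq s -> (forall n, n \in s -> J n) -> lball r s (fun n => b n / c)) ->
  (lnorm J r u <= c%:E)%E.
Proof.
move=> r1 c0 ub hb.
have fu n : J n -> u n \is a fin_num.
  move=> Jn; have [u0 un] := ub n Jn.
  by rewrite ge0_fin_numE// (le_lt_trans un)// ltry.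
apply: lball_lnorm => //; first by rewrite (lt_le_trans _ r1).
move=> s us sJ; apply: lball_le (hb s us sJ) => // n ns; have Jn := sJ n ns.
have [u0 un] := ub n Jn; have f0 : 0 <= fine (u n) by rewrite fine_ge0.
have : fine (u n) <= b n by rewrite -lee_fin fineK// fu.
move=> ub'; rewrite !normrM ler_wpM2r// ger0_norm// ger0_norm//.
exact: le_trans ub'.
Qed.

Section Window.
Definition window (J : set int) (M N : nat) : seq int :=
  fset_set (J `&` [set n | (- M%:Z <= n <= N%:Z)%R]).

Lemma finite_window J (M N : nat) : finite_set (J `&` [set n | (- M%:Z <= n <= N%:Z)%R]).
Proof.
apply: (@sub_finite_set _ _ ((fun k : nat => k%:Z - M%:Z) @` `I_(M + N).+1)).
  move=> n [_ /= /andP[h1 h2]]; exists (absz (n + M%:Z)%R) => /=; lia.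
exact: finite_image.
Qed.

Lemma mem_window J M N n : n \in window J M N <-> J n /\ (- M%:Z <= n <= N%:Z)%R.
Proof.
by rewrite /window in_fset_set ?inE; [split|exact: finite_window].
Qed.

Lemma uniq_window J M N : uniq (window J M N).
Proof. exact: fset_uniq. Qed.

Lemma partial_sumE (R : realType) (rho : R -> R) J (t : int -> R) (Y : couple R)
    (w : int -> Y) M N :
  partial_sum rho J t w M N = \sum_(n <- window J M N) rho (t n) *: w n.
Proof. by rewrite /partial_sum fsbig_finite//; exact: finite_window. Qed.
End Window.

Section RcutUnion.
Context d (T : measurableType d) (R : realType).
Variable mu : {measure set T -> \bar R}.

Lemma rcutU (E F G : set T) (u : L0 mu) : measurable F -> measurable G ->
  (forall x, E x <-> F x \/ G x) -> (forall x, F x -> ~ G x) ->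
  rcut E u = rcut F u + rcut G u.
Proof.
move=> mF mG EFG FG.
have -> : E = F `|` G by apply/seteqP; split => x /EFG.
rewrite /rcut -clsD; [|exact: measurable_rcut..].
congr cls; apply/funext => x /=.
have [Fx|nF] := pselect (F x).
  by rewrite [X in _ + X]cutF ?addr0 ?cutT//; [left|exact: FG].
rewrite [X in X + _]cutF// add0r; have [Gx|nG] := pselect (G x).
  by rewrite !cutT//; right.
by rewrite !cutF// => -[].
Qed.

Lemma rcut_cover (E : set T) (u : L0 mu) : measurable E ->
  {ae mu, forall x, ofL0 u x != 0 -> E x} -> rcut E u = u.
Proof.
move=> mE h; apply: cls_eqP; first exact: measurable_rcut.
apply: filterS h => x hx; have [Ex|nE] := pselect (E x); first by rewrite cutT.
rewrite cutF//; apply/eqP; rewrite eq_sym; apply/negPn/negP => /hx.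
exact: nE.
Qed.

End RcutUnion.

(** * Low and high parts of the source element *)

Section BlockSums.
Context d (T : measurableType d) (R : realType).
Variable mu : {measure set T -> \bar R}.
Variables (p0 p1 : \bar R) (U0 U1 : T -> R).
Hypotheses (hp0 : (1 <= p0)%E) (hp1 : (1 <= p1)%E) (w0 : weight U0) (w1 : weight U1).
Variables (a : L0 mu) (J : set int) (Q S : int -> R) (q : R) (B : int -> set T) (C : R).
Hypotheses (iJ : is_interval J) (q1 : 1 < q) (C0 : 0 < C).
Hypotheses (gQS : geometric_weights q Q S).
Hypothesis bB : block_decomposition p0 p1 U0 U1 a J Q S B C.

Definition low_blocks n := \bigcup_j B (n - j%:Z).
Definition high_blocks n := \bigcup_j B (n + j%:Z).

Let mB n : measurable (B n). Proof. by case: bB. Qed.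
Let dB : disjoint_family B. Proof. by case: bB. Qed.

Lemma measurable_low n : measurable (low_blocks n).
Proof. exact: bigcup_measurable. Qed.

Lemma measurable_high n : measurable (high_blocks n).
Proof. exact: bigcup_measurable. Qed.

Lemma low_blocksP n x : low_blocks n x <-> exists2 k, B k x & k <= n.
Proof.
clear hp0 hp1 q1 C0.
split=> [[j _ Bj]|[k Bk kn]]; first by exists (n - j%:Z) => //; lia.
exists (absz (n - k)%R) => //.
by have -> : n - (absz (n - k)%R)%:Z = k by lia.
Qed.

Lemma high_blocksP n x : high_blocks n x <-> exists2 k, B k x & n <= k.
Proof.
clear hp0 hp1 q1 C0.
split=> [[j _ Bj]|[k Bk kn]]; first by exists (n + j%:Z) => //; lia.
exists (absz (k - n)%R) => //.
by have -> : n + (absz (k - n)%R)%:Z = k by lia.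
Qed.

Lemma rcut_low n : rcut (low_blocks n) a = rcut (B n) a + rcut (low_blocks (n - 1)) a.
Proof.
clear hp0 hp1 q1 C0.
apply: rcutU => //; first exact: measurable_low.
  move=> x; rewrite !low_blocksP; split.
    move=> [k Bk kn]; have [->|kn'] := eqVneq n k; first by left.
    by right; exists k => //; lia.
  by move=> [Bn|[k Bk kn]]; [exists n|exists k => //; lia].
by move=> x Bn /low_blocksP[k Bk kn]; have := dB Bn Bk; lia.
Qed.

Lemma rcut_high n : rcut (high_blocks n) a = rcut (B n) a + rcut (high_blocks (n + 1)) a.
Proof.
clear hp0 hp1 q1 C0.
apply: rcutU => //; first exact: measurable_high.
  move=> x; rewrite !high_blocksP; split.
    move=> [k Bk kn]; have [->|kn'] := eqVneq n k; first by left.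
    by right; exists k => //; lia.
  by move=> [Bn|[k Bk kn]]; [exists n|exists k => //; lia].
by move=> x Bn /high_blocksP[k Bk kn]; have := dB Bn Bk; lia.
Qed.

Lemma rcut_low_high n : a = rcut (low_blocks n) a + rcut (high_blocks (n + 1)) a.
Proof.
clear hp0 hp1 q1 C0.
rewrite -(@rcutU _ _ _ _ (\bigcup_j B j%:Z `|` \bigcup_j B (- j%:Z))).
- rewrite rcut_cover//; first by apply: measurableU; exact: bigcup_measurable.
  case: bB => _ _ _ cov _; apply: filterS cov => x /[apply] -[k Bk].
  have [k0|k0] := lerP 0 k; [left|right]; exists (absz k) => //.
    by have -> : (absz k)%:Z = k by lia.
  by have -> : - (absz k)%:Z = k by lia.
- exact: measurable_low.
- exact: measurable_high.
- move=> x; rewrite low_blocksP high_blocksP; split.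
    have h k : B k x -> (exists2 k0, B k0 x & k0 <= n) \/ (exists2 k0, B k0 x & n + 1 <= k0).
      by move=> Bk; have [kn|kn] := lerP k n; [left|right]; exists k => //; lia.
    by move=> [] [j _ /h].
  have h k : B k x -> (\bigcup_j B j%:Z `|` \bigcup_j B (- j%:Z)) x.
    move=> Bk; have [k0|k0] := lerP 0 k; [left|right]; exists (absz k) => //.
      by have -> : (absz k)%:Z = k by lia.
    by have -> : - (absz k)%:Z = k by lia.
  by move=> [] [k /h].
- by move=> x /low_blocksP[k Bk kn] /high_blocksP[m Bm nm]; have := dB Bk Bm; lia.
Qed.

(** With [high_bottom], this matches the conventions of [upper_cut] and [lower_cut] at the ends of
    J. *)
Lemma low_top n : J n -> ~ J (n + 1) -> rcut (low_blocks n) a = a.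
Proof.
clear hp0 hp1 q1 C0.
move=> Jn nJ; rewrite [RHS](rcut_low_high n) (_ : high_blocks (n + 1) = set0).
  rewrite [X in _ + X](_ : _ = 0) ?addr0//; apply: cls_eqP.
    by apply: measurable_rcut.
  by apply: filterS (ofL0_0 mu) => x ->; rewrite cutF.
apply/seteqP; split => // x /high_blocksP[k Bk nk]; case: bB => _ _ BJ _ _.
have [Jk|/BJ Bk0] := pselect (J k); last by rewrite Bk0 in Bk.
by apply: nJ; apply: (iJ Jn Jk); rewrite nk andbT lerDl ler01.
Qed.

Lemma high_bottom n : J n -> ~ J (n - 1) -> rcut (high_blocks n) a = a.
Proof.
clear hp0 hp1 q1 C0.
move=> Jn nJ; rewrite [RHS](rcut_low_high (n - 1)) subrK (_ : low_blocks (n - 1) = set0).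
  rewrite [X in X + _](_ : _ = 0) ?add0r//; apply: cls_eqP.
    by apply: measurable_rcut.
  by apply: filterS (ofL0_0 mu) => x ->; rewrite cutF.
apply/seteqP; split => // x /low_blocksP[k Bk nk]; case: bB => _ _ BJ _ _.
have [Jk|/BJ Bk0] := pselect (J k); last by rewrite Bk0 in Bk.
by apply: nJ; apply: (iJ Jk Jn); rewrite nk gerBl ler01.
Qed.

(** The constant of [wnorm_cut_bigcup] for blocks decaying with ratio q^-1. *)
Definition tail_const := 2 * C / (1 - q^-1).

Let l0 : 0 < q^-1. Proof. by rewrite invr_gt0 (lt_trans _ q1). Qed.
Let l1 : q^-1 < 1. Proof. by rewrite invf_lt1// (lt_trans _ q1). Qed.
Let l1' : 0 < 1 - q^-1. Proof. by rewrite subr_gt0. Qed.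

Lemma tail_const_ge : C <= tail_const.
Proof.
rewrite /tail_const ler_pdivlMr// mulrC ler_wpM2r ?ltW//.
by have := l0; lra.
Qed.

Lemma tail_const_gt0 : 0 < tail_const.
Proof. exact: lt_le_trans tail_const_ge. Qed.

Lemma wLnorm_low n : (weighted_Lnorm p0 U0 (rcut (low_blocks n) a) <= (tail_const * Q n)%:E)%E.
Proof.
case: gQS => Q0 S0 Ql Sl; case: bB => _ _ _ _ hB.
rewrite wLnorm_rcut//; last exact: measurable_low.
have -> : tail_const * Q n = 2 * (C * Q n) / (1 - q^-1) by rewrite /tail_const; ring.
apply: (@wnorm_cut_bigcup _ _ _ mu p0 U0 _ (fun j => cut (B (n - j%:Z)) (ofL0 a))) => //.
- by move=> j; exact: measurable_rcut.
- by move=> j x Bj; rewrite cutT//; have := normr_ge0 (ofL0 a x); lra.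
- by rewrite mulr_ge0// ltW.
move=> j; have [hB0 _] := hB (n - j%:Z); apply: (le_trans hB0).
by rewrite lee_fin -mulrA ler_wpM2l ?(ltW C0)// mulrC; exact: geo_down.
Qed.

Lemma wLnorm_high n : (weighted_Lnorm p1 U1 (rcut (high_blocks n) a) <= (tail_const * S n)%:E)%E.
Proof.
case: gQS => Q0 S0 Ql Sl; case: bB => _ _ _ _ hB.
rewrite wLnorm_rcut//; last exact: measurable_high.
have -> : tail_const * S n = 2 * (C * S n) / (1 - q^-1) by rewrite /tail_const; ring.
apply: (@wnorm_cut_bigcup _ _ _ mu p1 U1 _ (fun j => cut (B (n + j%:Z)) (ofL0 a))) => //.
- by move=> j; exact: measurable_rcut.
- by move=> j x Bj; rewrite cutT//; have := normr_ge0 (ofL0 a x); lra.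
- by rewrite mulr_ge0// ltW.
move=> j; have [_ hB1] := hB (n + j%:Z); apply: (le_trans hB1).
by rewrite lee_fin -mulrA ler_wpM2l ?(ltW C0)// mulrC; exact: geo_up.
Qed.

End BlockSums.

(** * A representation in the phi-space of each element of the orbit *)

Section OrbitInPhi.
Context d d' (TX : measurableType d) (TY : measurableType d') (R : realType).
Variables (mu : {measure set TX -> \bar R}) (nu : {measure set TY -> \bar R}).
Variables (p0 p1 : \bar R) (U0 U1 : TX -> R) (q0 q1 : \bar R) (V0 V1 : TY -> R).
Hypotheses (hp0 : (1 <= p0)%E) (hp1 : (1 <= p1)%E) (w0 : weight U0) (w1 : weight U1).
Hypotheses (hq0 : (1 <= q0)%E) (hq1 : (1 <= q1)%E) (v0 : weight V0) (v1 : weight V1).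
Let X := Lp_couple mu p0 p1 U0 U1.
Let Y := Lp_couple nu q0 q1 V0 V1.
Variables (a : L0 mu) (rho : R -> R) (J : set int) (t : int -> R).
Variables (Q S : int -> R) (q : R) (B : int -> set TX) (C : R).
Hypotheses (ca : csum X a) (J0 : J !=set0) (iJ : is_interval J) (q_gt1 : 1 < q) (C0 : 0 < C).
Hypotheses (gQS : geometric_weights q Q S).
Hypothesis bB : block_decomposition p0 p1 U0 U1 a J Q S B C.
Hypothesis t0 : forall n, J n -> 0 < t n.
Hypothesis QSJ : forall n, J n -> Q n = rho (t n) /\ S n = rho (t n) / t n.

Lemma filter_prod_geometric_cvg (l c1 c2 : R) : 0 < l -> l < 1 ->
  (c1 * l ^+ z.1 + c2 * l ^+ z.2)%R
    @[z --> filter_prod (\oo : set_system nat) (\oo : set_system nat)] --> (0 : R).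
Proof.
move=> l0 l1; have hl : l ^+ n @[n --> \oo] --> (0 : R).
  by apply: cvg_expr; rewrite ger0_norm// ltW.
rewrite -[X in _ --> X](_ : c1 * 0 + c2 * 0 = 0); last by rewrite !mulr0 addr0.
apply: cvgD; apply: cvgM; (try exact: cvg_cst).
  apply: (@cvg_comp _ _ _ fst (fun n => l ^+ n) _ (\oo : set_system nat) _ _ hl); exact: cvg_fst.
apply: (@cvg_comp _ _ _ snd (fun n => l ^+ n) _ (\oo : set_system nat) _ _ hl); exact: cvg_snd.
Qed.

(** The remainder of a partial sum is y on the sets below the window plus y on the sets above it.
    The first is small in one space and the second in the other, so this is already a good
    decomposition for K(1, 1, .). *)
Lemma partial_sum_cvg (y : TY -> R) (x : L0 nu) (w : int -> L0 nu) (E : int -> set TY)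
    (c0 c1 : R) :
  measurable_fun setT y -> (forall n, measurable (E n)) -> disjoint_family E ->
  (forall n x, E n x -> J n) ->
  {ae nu, forall x, y x != 0 -> exists n, E n x} ->
  {ae nu, forall s, ofL0 x s = y s} ->
  (forall n, J n -> {ae nu, forall s, rho (t n) * ofL0 (w n) s = cut (E n) y s}) ->
  0 <= c0 -> 0 <= c1 ->
  (forall m, (wnorm nu q0 V0 (cut (\bigcup_j E (m - j%:Z)%R) y) <= (c0 * Q m)%:E)%E) ->
  (forall m, (wnorm nu q1 V1 (cut (\bigcup_j E (m + 1 + j%:Z)%R) y) <= (c1 * S m)%:E)%E) ->
  Kfun Y 1%R 1%R (x - partial_sum rho J t (w : int -> Y) z.1 z.2)%R
    @[z --> filter_prod (\oo : set_system nat) (\oo : set_system nat)] --> (0 : \bar R).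
Proof.
move=> my mE dE EJ Eae xy wE c00 c10 hlow hhigh.
have [Q0 S0 Ql Sl] := gQS.
have q0' : 0 < q by rewrite (lt_trans _ q_gt1).
have l0 : 0 < q^-1 by rewrite invr_gt0.
have l1 : q^-1 < 1 by rewrite invf_lt1.
apply: (@squeeze_cvge _ _ _ _ (fun=> 0%E) _
  (fun z : nat * nat => (c0 * Q 0 * q^-1 ^+ z.1 + c1 * S 0 * q^-1 ^+ z.2)%:E)); last 2 first.
- exact: cvg_cst.
- by apply: cvg_EFin; [exact: nearW|exact: filter_prod_geometric_cvg].
apply: nearW => -[M N] /=; rewrite Kfun_ge0//=.
(* The window is -M <= n <= N, so what it misses starts at -M - 1 and at N + 1. *)
pose lo := cut (\bigcup_j E (- M%:Z - 1 - j%:Z)) y.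
pose hi := cut (\bigcup_j E (N%:Z + 1 + j%:Z)) y.
have mlo : measurable_fun setT lo by apply: measurable_cut => //; exact: bigcup_measurable.
have mhi : measurable_fun setT hi by apply: measurable_cut => //; exact: bigcup_measurable.
have xE : x - partial_sum rho J t (w : int -> Y) M N = cls nu lo + cls nu hi :> L0 nu.
  rewrite partial_sumE -clsD//; apply/esym/cls_eqP; first exact: measurable_funD.
  have hw : {ae nu, forall s, forall k : nat, nth 0 (window J M N) k \in window J M N ->
      rho (t (nth 0 (window J M N) k)) * ofL0 (w (nth 0 (window J M N) k)) s =
      cut (E (nth 0 (window J M N) k)) y s}.
    apply/ae_foralln => k; have [|nk] := boolP (nth 0 (window J M N) k \in window J M N).
      by move=> /mem_window[Jn _]; apply: filterS (wE _ Jn) => s h _.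
    exact: nearW.
  have hz : {ae nu, forall s, forall k : nat,
      ofL0 (rho (t (nth 0 (window J M N) k)) *: w (nth 0 (window J M N) k)) s =
      rho (t (nth 0 (window J M N) k)) * ofL0 (w (nth 0 (window J M N) k)) s}.
    by apply/ae_foralln => k; exact: ofL0_Z.
  have hsum := ofL0_sum (window J M N) xpredT (fun n => rho (t n) *: w n).
  have hB := ofL0_B x (\sum_(n <- window J M N) rho (t n) *: w n).
  apply: filterS3 (filterI xy Eae) (filterI hw hz) (filterI hsum hB).
  move=> s [xs ys] [hws hzs] [hs ->]; rewrite hs xs.
  have -> : \sum_(n <- window J M N) ofL0 (rho (t n) *: w n) s =
      \sum_(n <- window J M N) cut (E n) y s.
    apply: eq_big_seq => n ns; have := hzs (index n (window J M N)).
    by have := hws (index n (window J M N)); rewrite nth_index// => /(_ ns) -> ->.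
  rewrite /lo /hi /=; have [y0|yn0] := eqVneq (y s) 0.
    rewrite /cut y0 !mul0r big1 ?subr0 ?addr0// => n _.
    by rewrite mul0r.
  have [k Ek] := ys yn0; have Jk := EJ _ _ Ek.
  have sumE : \sum_(n <- window J M N) cut (E n) y s =
      if k \in window J M N then y s else 0.
    case: ifPn => ks.
      rewrite (bigD1_seq k) ?uniq_window//= big1 ?addr0 ?cutT// => n /eqP nk.
      by rewrite cutF// => /dE /(_ Ek).
    rewrite big1_seq// => n /andP[_ ns]; rewrite cutF// => /dE /(_ Ek) nk.
    by rewrite nk (negbTE ks) in ns.
  have loE : (\bigcup_j E (- M%:Z - 1 - j%:Z)) s <-> k < - M%:Z.
    split=> [[j _ Ej]|kM]; first by have := dE _ _ _ Ej Ek; clear; lia.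
    exists (absz (- M%:Z - 1 - k)%R) => //.
    by have -> : - M%:Z - 1 - (absz (- M%:Z - 1 - k)%R)%:Z = k by move: kM; clear; lia.
  have hiE : (\bigcup_j E (N%:Z + 1 + j%:Z)) s <-> N%:Z < k.
    split=> [[j _ Ej]|kM]; first by have := dE _ _ _ Ej Ek; clear; lia.
    exists (absz (k - N%:Z - 1)%R) => //.
    by have -> : N%:Z + 1 + (absz (k - N%:Z - 1)%R)%:Z = k by move: kM; clear; lia.
  rewrite sumE; case: ifPn => ks.
    have /mem_window[_ /andP[h1 h2]] := ks.
    by rewrite !cutF ?subrr ?addr0//; [rewrite hiE; move: h2; clear; lia|rewrite loE; move: h1; clear; lia].
  have [kM|Mk] := ltP k (- M%:Z).
    by rewrite cutT ?loE// cutF ?subr0 ?addr0// hiE; move: kM; clear; lia.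
  rewrite cutF; last by rewrite loE; move: Mk; clear; lia.
  rewrite add0r subr0 cutT// hiE ltNge; apply/negP => kN.
  by move/negP: ks; apply; apply/mem_window; rewrite Mk kN.
have h0 : (weighted_Lnorm q0 V0 (cls nu lo) <= (c0 * Q 0 * q^-1 ^+ M)%:E)%E.
  rewrite wLnorm_cls//; apply: (le_trans (hlow _)); rewrite lee_fin -mulrA ler_wpM2l//.
  have h := @geo_down R Q q^-1 (- M%:Z) 1 l0 Ql.
  have h' := @geo_down R Q q^-1 0 M l0 Ql; rewrite sub0r mulrC in h'.
  apply: le_trans h'; apply: (le_trans h); rewrite expr1.
  by rewrite ler_piMl// ltW.
have h1 : (weighted_Lnorm q1 V1 (cls nu hi) <= (c1 * S 0 * q^-1 ^+ N)%:E)%E.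
  rewrite wLnorm_cls//; apply: (le_trans (hhigh _)); rewrite lee_fin -mulrA ler_wpM2l//.
  by have h' := @geo_up R S q^-1 0 N l0 Sl; rewrite add0r mulrC in h'.
have := @Kfun_le _ _ _ nu q0 q1 V0 V1 1 1 ltr01 ltr01 _ _ _ _ _ xE h0 h1.
by rewrite !mul1r.
Qed.

(** The sum in parentheses is the bound of [wnorm_orbit_sum] without the factor A; the 2 is lost in
    comparing y with [z n] on [E n]. *)
Definition orbit_const := 2 * (tail_const q C / (1 - q^-1) + tail_const q C).

(** [A] is any common bound of the two operator norms and the constant depends on q and C alone, so
    an infimum over T can be taken afterwards. *)
Lemma orbit_in_phi (T : X -> Y) (A : R) : couple_operator T -> 0 < A ->
  (opnorm (cnorm0 X) (cnorm0 Y) T <= A%:E)%E ->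
  (opnorm (cnorm1 X) (cnorm1 Y) T <= A%:E)%E ->
  exists w : int -> Y,
    [/\ phi_representation rho J t (multiplier_exponent p0 q0) (multiplier_exponent p1 q1) (T a) w,
        (phi_norm0 J (multiplier_exponent p0 q0) w <= (orbit_const * A)%:E)%E &
        (phi_norm1 J t (multiplier_exponent p1 q1) w <= (orbit_const * A)%:E)%E].
Proof.
move=> opT A0 TA0 TA1.
have [Q0 S0 Ql Sl] := gQS; have [mB dB BJ cov hB] := bB.
have q0' : 0 < q by rewrite (lt_trans _ q_gt1).
have l0 : 0 < q^-1 by rewrite invr_gt0.
have l1 : q^-1 < 1 by rewrite invf_lt1.
set D := tail_const q C; have D0 : 0 < D by exact: tail_const_gt0.
have CD : C <= D by exact: tail_const_ge.
have Xlin := @csum_lin _ _ _ mu p0 p1 U0 U1 hp0 hp1 w0 w1.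
have X00 := @csum0 _ _ _ mu p0 p1 U0 U1 hp0 hp1 w0 w1.
have crc E : measurable E -> csum X (rcut E a).
  by move=> mE; apply: csum_rcut.
have TD := couple_operatorD opT.
have TZ := couple_operatorZ opT X00.
have DZ c x : csum X x -> csum X (c *: x) by move=> cx; exact: csumZ.
have Tb0 x l : csum X x -> 0 < l -> (weighted_Lnorm p0 U0 x <= l%:E)%E ->
    (weighted_Lnorm q0 V0 (T x) <= (A * l)%:E)%E.
  move=> cx ll; exact: (@opnorm_bound _ _ _ _ _ mu nu p0 q0 U0 V0 (csum X) T A l x
    hp0 hq0 w0 v0 TZ DZ A0 ll TA0 cx).
have Tb1 x l : csum X x -> 0 < l -> (weighted_Lnorm p1 U1 x <= l%:E)%E ->
    (weighted_Lnorm q1 V1 (T x) <= (A * l)%:E)%E.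
  move=> cx ll; exact: (@opnorm_bound _ _ _ _ _ mu nu p1 q1 U1 V1 (csum X) T A l x
    hp1 hq1 w1 v1 TZ DZ A0 ll TA1 cx).
pose lo n := rcut (low_blocks B n) a.
pose hi n := rcut (high_blocks B n) a.
have clo n : csum X (lo n) by apply: crc; exact: (measurable_low bB).
have chi n : csum X (hi n) by apply: crc; exact: (measurable_high bB).
have DQ n : 0 < D * Q n by rewrite mulr_gt0.
have DS n : 0 < D * S n by rewrite mulr_gt0.
have Nlo n := wLnorm_low hp0 w0 q_gt1 C0 gQS bB n.
have Nhi n := wLnorm_high hp1 w1 q_gt1 C0 gQS bB n.
have NTlo n := Tb0 _ _ (clo n) (DQ n) (Nlo n).
have NThi n := Tb1 _ _ (chi n) (DS n) (Nhi n).
have Tlohi n : T a = T (lo n) + T (hi (n + 1)).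
  by rewrite -TD// -(rcut_low_high bB n).
pose y := ofL0 (T a); pose h n := ofL0 (T (lo n)).
have my : measurable_fun setT y by exact: measurable_ofL0.
have yh n : {ae nu, forall x, y x - h n x = ofL0 (T (hi (n + 1))) x}.
  apply: filterS (ofL0_D (T (lo n)) (T (hi (n + 1)))) => x.
  by rewrite -Tlohi /y /h => ->; rewrite addrC addKr.
have DA0 : 0 < A * D by rewrite mulr_gt0.
(* Even at the ends of J, the cut of y at n and its complement are images under T of the low and of
   the high part of [a]. *)
have upE n : J n -> {ae nu, forall x, upper_cut J y h n x = ofL0 (T (lo n)) x}.
  move=> Jn; rewrite /upper_cut; case: asboolP => nJ; apply: nearW => x //.
  by rewrite /y /lo (low_top iJ bB Jn nJ).
have dnE n : J n -> {ae nu, forall x, y x - lower_cut J h n x = ofL0 (T (hi n)) x}.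
  move=> Jn; rewrite /lower_cut; case: asboolP => nJ.
    by apply: filterS (yh (n - 1)) => x; rewrite subrK.
  by apply: nearW => x; rewrite subr0 /y /hi (high_bottom iJ bB Jn nJ).
have Smono n : S (n + 1) <= S n.
  by apply: (le_trans (Sl n)); rewrite ler_piMl ?(ltW (S0 _))// ltW.
have mup n : measurable_fun setT (upper_cut J y h n).
  by rewrite /upper_cut; case: ifP => _ //; exact: measurable_ofL0.
have [|||E [mE dE EJ E' [Eae Elow Ehigh]]] := @selectionJ _ _ _ nu J q0 q1 V0 V1 y h Q S q
  (A * D) J0 iJ hq0 hq1 v0 v1 my (fun n => measurable_ofL0 _) q_gt1 DA0 gQS.
- move=> n Jn; rewrite (@eq_wnorm _ _ _ nu q0 V0 _ (ofL0 (T (lo n))))//; last exact: upE.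
  by rewrite -mulrA; exact: NTlo.
- move=> n Jn _; rewrite (@eq_wnorm _ _ _ nu q1 V1 _ (ofL0 (T (hi (n + 1)))))//.
    apply: (le_trans (NThi _)); rewrite lee_fin mulrA.
    by rewrite ler_wpM2l ?(ltW DA0).
  by apply: measurable_funB => //; exact: measurable_ofL0.
- move=> n Jn nJ; rewrite (_ : y = ofL0 (T (hi n))); first by rewrite -mulrA; exact: NThi.
  by rewrite /y /hi (high_bottom iJ bB Jn nJ).
have EJ' n x : E n x -> J n by move=> /EJ[].
have mEy n : measurable_fun setT (cut (E n) y) by exact: measurable_cut.
(* Division by Q n = rho (t n) makes rho (t n) *: w n the part of [y] on [E n]; in the second norm
   the factor becomes t n / Q n = 1 / S n. *)
pose w n : Y := cls nu (fun x => (Q n)^-1 * cut (E n) y x).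
have mw n : measurable_fun setT (fun x => (Q n)^-1 * cut (E n) y x).
  exact: measurable_funM.
have cE : orbit_const * A = 2 * (A * D / (1 - q^-1) + A * D).
  by rewrite /orbit_const -/D; ring.
have c0 : 0 < orbit_const * A.
  have l1' : 0 < 1 - q^-1 by rewrite subr_gt0.
  by rewrite cE mulr_gt0// addr_gt0 ?divr_gt0.
have CXsum (s : seq int) (c : int -> R) (x : int -> X) := @csum_sum _ X X00 Xlin int s c x.
have Tsum (s : seq int) (c : int -> R) (x : int -> X) :=
  @couple_operator_sum _ X Y T opT X00 Xlin int s c x.
(* For the first norm the low part at n is expanded downwards into blocks n, n - 1, ..., with the
   low part at n - I as tail. The second norm expands the high part upwards. *)
have [fin0 ball0] : (forall n, J n -> wnorm nu q0 V0 (cut (E n) y) \is a fin_num) /\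
  (forall s, uniq s -> (forall n, n \in s -> J n) ->
    lball (multiplier_exponent p0 q0) s
      (fun n => (Q n)^-1 * fine (wnorm nu q0 V0 (cut (E n) y)) / (orbit_const * A))).
  apply: (@orbit_block_norms _ _ _ _ _ mu nu p0 q0 U0 V0 hp0 hq0 w0 v0 (csum X) T A CXsum
    Tsum A0 Tb0 a B E dB mB dE mE (fun n => crc _ (mB n)) (fun i n => n - i%:Z) Q D q^-1 Q0 D0 l0 l1
    _ _ (fun n => T (lo n)) (fun I n => lo (n - I%:Z)) _ _ _ y J my _ _ cE).
  - by move=> i m n /addIr.
  - move=> i n; have [hB0 _] := hB (n - i%:Z); apply: (le_trans hB0).
    rewrite lee_fin -mulrA; apply: ler_pM => //; rewrite ?(ltW C0) ?(ltW (Q0 _))//.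
    exact: geo_down.
  - by move=> I n.
  - move=> I n; apply: (le_trans (Nlo _)); rewrite lee_fin -mulrA ler_wpM2l ?(ltW D0)//.
    exact: geo_down.
  - move=> I n; elim: I => [|I IH]; first by rewrite big_ord0 add0r subr0.
    rewrite {1}IH big_ord_recr/= -addrA; congr (_ + _).
    rewrite -TD//; last by apply: crc.
    rewrite /lo (rcut_low bB (n - I%:Z)); congr (T (_ + rcut (low_blocks B _) a)).
    by clear; lia.
  - move=> n Jn; apply: filterS (upE n Jn) => x <- /EJ[_].
    by [].
have [fin1 ball1] : (forall n, J n -> wnorm nu q1 V1 (cut (E n) y) \is a fin_num) /\
  (forall s, uniq s -> (forall n, n \in s -> J n) ->
    lball (multiplier_exponent p1 q1) s
      (fun n => (S n)^-1 * fine (wnorm nu q1 V1 (cut (E n) y)) / (orbit_const * A))).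
  apply: (@orbit_block_norms _ _ _ _ _ mu nu p1 q1 U1 V1 hp1 hq1 w1 v1 (csum X) T A CXsum
    Tsum A0 Tb1 a B E dB mB dE mE (fun n => crc _ (mB n)) (fun i n => n + i%:Z) S D q^-1 S0 D0 l0 l1
    _ _ (fun n => T (hi n)) (fun I n => hi (n + I%:Z)) _ _ _ y J my _ _ cE).
  - by move=> i m n /addIr.
  - move=> i n; have [_ hB1] := hB (n + i%:Z); apply: (le_trans hB1).
    rewrite lee_fin -mulrA; apply: ler_pM => //; rewrite ?(ltW C0) ?(ltW (S0 _))//.
    exact: geo_up.
  - by move=> I n.
  - move=> I n; apply: (le_trans (Nhi _)); rewrite lee_fin -mulrA ler_wpM2l ?(ltW D0)//.
    exact: geo_up.
  - move=> I n; elim: I => [|I IH]; first by rewrite big_ord0 add0r addr0.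
    rewrite {1}IH big_ord_recr/= -addrA; congr (_ + _).
    rewrite -TD//; last by apply: crc.
    rewrite /hi (rcut_high bB (n + I%:Z)); congr (T (_ + rcut (high_blocks B _) a)).
    by clear; lia.
  - by move=> n Jn; apply: filterS (dnE n Jn) => x <- /E'.
have Nw n p V : (1 <= p)%E -> weight V -> wnorm nu p V (cut (E n) y) \is a fin_num ->
    (weighted_Lnorm p V (w n) <= ((Q n)^-1 * fine (wnorm nu p V (cut (E n) y)))%:E)%E.
  move=> hp wV fy; have g0 : 0 <= fine (wnorm nu p V (cut (E n) y)).
    by rewrite fine_ge0// wnorm_ge0.
  rewrite wLnorm_cls//; apply: (le_trans (wnormZ (Q n)^-1 hp wV (mEy n) g0 _)).
    by rewrite fineK.
  by rewrite ger0_norm// invr_ge0 ltW.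
have r0ge := multiplier_exponent_ge1 hp0 hq0.
have r1ge := multiplier_exponent_ge1 hp1 hq1.
have P0 : (phi_norm0 J (multiplier_exponent p0 q0) w <= (orbit_const * A)%:E)%E.
  apply: (@lnorm_le_of_lball _ _ _ _ (fun n => (Q n)^-1 * fine (wnorm nu q0 V0 (cut (E n) y)))) => //.
  move=> n Jn; split; first exact: wLnorm_ge0.
  by apply: Nw => //; exact: fin0.
have P1 : (phi_norm1 J t (multiplier_exponent p1 q1) w <= (orbit_const * A)%:E)%E.
  apply: (@lnorm_le_of_lball _ _ _ _ (fun n => (S n)^-1 * fine (wnorm nu q1 V1 (cut (E n) y)))) => //.
  move=> n Jn; have tn := t0 Jn; split.
    by apply: mule_ge0; [rewrite lee_fin ltW|exact: wLnorm_ge0].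
  have := Nw n q1 V1 hq1 v1 (fin1 n Jn).
  move=> /(lee_wpmul2l (_ : 0 <= (t n)%:E)%E) hh; apply: (le_trans (hh _)).
    by rewrite lee_fin ltW.
  rewrite -EFinM lee_fin mulrA ler_wpM2r ?fine_ge0 ?wnorm_ge0//.
  have [QE SE] := QSJ Jn; rewrite SE -QE invf_div.
  by [].
exists w; split => //; split.
- by have [hT _ _ _] := opT; exact: hT.
- move=> n Jn; split.
    by apply: (le_lt_trans (Nw n q0 V0 hq0 v0 (fin0 n Jn))); exact: ltry.
  by apply: (le_lt_trans (Nw n q1 V1 hq1 v1 (fin1 n Jn))); exact: ltry.
- apply: (@partial_sum_cvg y (T a) w E (2 * (A * D) / (1 - q^-1)) (2 * (A * D))) => //.
  + exact: nearW.
  + move=> n Jn; apply: filterS (clsE nu (mw n)) => x ->.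
    by have [<- _] := QSJ Jn; rewrite mulVKf// gt_eqF.
  + apply: mulr_ge0; last by rewrite invr_ge0 subr_ge0 ltW.
    by apply: mulr_ge0 => //; exact: ltW.
  + by apply: mulr_ge0 => //; exact: ltW.
  + move=> m; apply: (le_trans (Elow m)).
    by rewrite lee_fin le_eqVlt; apply/orP; left; apply/eqP; ring.
  + move=> m; apply: (le_trans (Ehigh m)).
    by rewrite lee_fin le_eqVlt; apply/orP; left; apply/eqP; ring.
- by apply: (le_lt_trans P0); exact: ltry.
- by apply: (le_lt_trans P1); exact: ltry.
Qed.

End OrbitInPhi.

(** The index i may vary with n. For a finite exponent e, the e-th power of y n is at most the sum
    over all i < m, which totals at most m over n; dividing y by m gains at least the factor m since
    e >= 1. *)
Lemma lball_pigeonhole (R : realType) (p : \bar R) (s : seq int) (m : nat)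
    (x : nat -> int -> R) (y : int -> R) : (1 <= p)%E -> (0 < m)%N ->
  (forall i, (i < m)%N -> lball p s (x i)) ->
  (forall n, n \in s -> exists2 i, (i < m)%N & `|y n| <= `|x i n|) ->
  lball p s (fun n => y n / m%:R).
Proof.
move=> p1 m0 hx yx; have m0' : 0 < m%:R :> R by rewrite ltr0n.
have m1 : 1 <= m%:R :> R by rewrite ler1n.
have nE n : `|y n / m%:R| = `|y n| / m%:R.
  by rewrite normrM normfV (gtr0_norm m0').
case: p p1 hx => [e| |]//=; rewrite ?lee_fin.
  move=> e1 hx; have e0 : 0 < e by rewrite (lt_le_trans _ e1).
  apply: (@le_trans _ _ (\sum_(n <- s) m%:R^-1 * \sum_(i < m) `|x i n| `^ e)).
    rewrite big_seq [leRHS]big_seq; apply: ler_sum => n ns; rewrite nE.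
    rewrite powRM ?invr_ge0 ?(ltW m0')// mulrC; apply: ler_pM; rewrite ?powR_ge0//.
      by apply: ge1r_powR => //; rewrite invr_gt0 m0' invf_le1.
    have [i im yi] := yx n ns; rewrite (bigD1 (Ordinal im))//=.
    apply: (@le_trans _ _ (`|x i n| `^ e)); last by rewrite lerDl sumr_ge0// => *; exact: powR_ge0.
    by rewrite ge0_ler_powR// ?nnegrE// ltW.
  rewrite -mulr_sumr exchange_big/= ler_pdivrMl// mulr1.
  apply: (@le_trans _ _ (\sum_(i < m) 1)).
    by apply: ler_sum => i _; exact: hx.
  by rewrite sumr_const card_ord.
move=> _ hx n ns; rewrite nE ler_pdivrMr// mul1r.
have [i im yi] := yx n ns; apply: (le_trans yi); apply: le_trans m1.
exact: hx.
Qed.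

(** * From the phi-space to the orbit *)

Section Functionals.
Context d (T : measurableType d) (R : realType).
Variable mu : {measure set T -> \bar R}.
Variables (p0 p1 : \bar R) (U0 U1 : T -> R).
Hypotheses (hp0 : (1 <= p0)%E) (hp1 : (1 <= p1)%E) (w0 : weight U0) (w1 : weight U1).
Let X := Lp_couple mu p0 p1 U0 U1.
Variables (a : L0 mu) (J : set int) (t : int -> R) (Q S : int -> R) (q : R)
  (B : int -> set T) (C : R).
Hypotheses (ca : csum X a) (iJ : is_interval J) (q1 : 1 < q) (C0 : 0 < C).
Hypotheses (gQS : geometric_weights q Q S).
Hypothesis bB : block_decomposition p0 p1 U0 U1 a J Q S B C.
Hypothesis t0 : forall n, J n -> 0 < t n.
Hypothesis tS : forall n, J n -> t n * S n = Q n.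
Hypothesis KQ : forall n, J n -> Kfun X 1 (t n) a = (Q n)%:E.

Let mB n : measurable (B n). Proof. by case: bB. Qed.

Lemma Kfun_sum (s t' : R) (I : Type) (r : seq I) (x : I -> X) : 0 < s -> 0 < t' ->
  (forall i, csum X (x i)) ->
  csum X (\sum_(i <- r) x i) /\
  fine (Kfun X s t' (\sum_(i <- r) x i)%R) <= \sum_(i <- r) fine (Kfun X s t' (x i)).
Proof.
move=> s0 t0' hx; elim: r => [|i r [IH1 IH2]].
  rewrite !big_nil; split; first exact: csum0.
  have := @KfunZ _ _ _ mu p0 p1 U0 U1 hp0 hp1 w0 w1 s t' s0 t0' 0 0 (csum0 mu hp0 hp1 w0 w1).
  by rewrite scale0r normr0 mul0r => ->.
rewrite !big_cons; split; first exact: csumD.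
apply: (le_trans (KfunD _ _ _ _ _ _ _ _)) => //.
by rewrite lerD2l.
Qed.

(* The parts of a far below and far above n have small K-functional at t n, so one of
   the 2N+1 blocks near n carries a fixed proportion of K(1, t n, a) = Q n. *)
Lemma big_block : exists N : nat, forall n, J n -> exists k : int,
  (exists2 i, (i < (2 * N).+1)%N & k = n + N%:Z - i%:Z) /\
  Q n <= 2 * (2 * N).+1%:R * fine (Kfun X 1 (t n) (rcut (B k) a)).
Proof.
have [Q0 S0 Ql Sl] := gQS.
have q0' : 0 < q by rewrite (lt_trans _ q1).
have l0 : 0 < q^-1 by rewrite invr_gt0.
have l1 : q^-1 < 1 by rewrite invf_lt1.
set D := tail_const q C; have D0 : 0 < D by exact: tail_const_gt0.
(* With this threshold each tail carries at most a quarter of Q n, which leaves at least half to the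
   2N + 1 middle blocks; N does not depend on n. *)
have e0 : 0 < (4 * D)^-1 by rewrite invr_gt0 mulr_gt0.
have [N hN] := geometric_small l0 l1 e0.
exists N => n Jn; have tn := t0 Jn; have Qn := Q0 n.
have lN : D * q^-1 ^+ N.+1 <= 4^-1.
  have := hN N.+1 (leqnSn N); rewrite -(ler_pM2l D0) => /le_trans; apply.
  by rewrite invfM mulrCA mulfV ?mulr1// gt_eqF.
pose lo n := rcut (low_blocks B n) a.
pose hi n := rcut (high_blocks B n) a.
have crc E : measurable E -> csum X (rcut E a) by move=> mE; apply: csum_rcut.
have Klo : fine (Kfun X 1 (t n) (lo (n - N.+1%:Z))) <= 4^-1 * Q n.
  have h0 := wLnorm_low hp0 w0 q1 C0 gQS bB (n - N.+1%:Z).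
  have h1 : (weighted_Lnorm p1 U1 (0%R : L0 mu) <= 0%:E)%E by rewrite wLnorm0.
  have := Kfun_le ltr01 tn (esym (addr0 (lo (n - N.+1%:Z)))) h0 h1.
  rewrite mul1r mulr0 addr0 -[X in (X <= _)%E -> _]fineK; last first.
    by apply: Kfun_fin => //; apply: crc; exact: (measurable_low bB).
  rewrite lee_fin => /le_trans; apply.
  apply: (@le_trans _ _ (D * (q^-1 ^+ N.+1 * Q n))).
    by rewrite ler_wpM2l ?(ltW D0)//; exact: geo_down.
  by rewrite mulrA ler_wpM2r// ltW.
have Khi : fine (Kfun X 1 (t n) (hi (n + N.+1%:Z))) <= 4^-1 * Q n.
  have h1 := wLnorm_high hp1 w1 q1 C0 gQS bB (n + N.+1%:Z).
  have h0 : (weighted_Lnorm p0 U0 (0%R : L0 mu) <= 0%:E)%E by rewrite wLnorm0.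
  have := Kfun_le ltr01 tn (esym (add0r (hi (n + N.+1%:Z)))) h0 h1.
  rewrite mul1r add0r -[X in (X <= _)%E -> _]fineK; last first.
    by apply: Kfun_fin => //; apply: crc; exact: (measurable_high bB).
  rewrite lee_fin => /le_trans; apply.
  apply: (@le_trans _ _ (t n * (D * (q^-1 ^+ N.+1 * S n)))).
    by rewrite ler_wpM2l ?(ltW tn)// ler_wpM2l ?(ltW D0)//; exact: geo_up.
  have -> : t n * (D * (q^-1 ^+ N.+1 * S n)) = D * q^-1 ^+ N.+1 * (t n * S n) by ring.
  by rewrite tS// ler_wpM2r// ltW.
have loE I m : lo m = \sum_(i < I) rcut (B (m - i%:Z)) a + lo (m - I%:Z).
  elim: I => [|I IH]; first by rewrite big_ord0 add0r subr0.
  rewrite {1}IH big_ord_recr/= -addrA; congr (_ + _).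
  rewrite /lo (rcut_low bB (m - I%:Z)); congr (_ + rcut (low_blocks B _) a).
  by clear; lia.
pose M := (2 * N).+1.
have aE : a = (\sum_(i < M) rcut (B (n + N%:Z - i%:Z)) a + lo (n - N.+1%:Z)) + hi (n + N.+1%:Z).
  rewrite {1}(rcut_low_high bB (n + N%:Z)); congr (_ + rcut (high_blocks B _) a); last by clear; lia.
  rewrite -/(lo _) (loE M); congr (_ + lo _); rewrite /M; clear; lia.
have [cs Ks] := @Kfun_sum 1 (t n) _ (index_enum 'I_M) (fun i : 'I_M => rcut (B (n + N%:Z - i%:Z)) a)
  ltr01 tn (fun i => crc _ (mB _)).
have clo : csum X (lo (n - N.+1%:Z)) by apply: crc; exact: (measurable_low bB).
have chi : csum X (hi (n + N.+1%:Z)) by apply: crc; exact: (measurable_high bB).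
have : Q n <= \sum_(i < M) fine (Kfun X 1 (t n) (rcut (B (n + N%:Z - i%:Z)) a)) +
    4^-1 * Q n + 4^-1 * Q n.
  have -> : Q n = fine (Kfun X 1 (t n) a) by rewrite KQ.
  rewrite {1}aE; apply: (le_trans (KfunD hp0 hp1 w0 w1 ltr01 tn _ chi)).
    exact: csumD.
  rewrite KQ//=; apply: lerD => //.
  by apply: (le_trans (KfunD hp0 hp1 w0 w1 ltr01 tn cs clo)); exact: lerD.
move=> hQ; apply: contrapT => nk.
have small i : (i < M)%N -> fine (Kfun X 1 (t n) (rcut (B (n + N%:Z - i%:Z)) a)) < Q n / (2 * M%:R).
  move=> iM; rewrite ltNge; apply/negP => h; apply: nk; exists (n + N%:Z - i%:Z).
  split; first by exists i.
  by move: h; rewrite ler_pdivrMr ?mulr_gt0 ?ltr0n// mulrC.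
have : \sum_(i < M) fine (Kfun X 1 (t n) (rcut (B (n + N%:Z - i%:Z)) a)) <
    \sum_(i < M) (Q n / (2 * M%:R)).
  apply: ltr_sum; first by rewrite /M; apply/hasP; exists ord0 => //; exact: mem_index_enum.
  by move=> i _; exact: small.
rewrite sumr_const card_ord.
have -> : Q n / (2 * M%:R) *+ M = 2^-1 * Q n.
  by rewrite -mulr_natl; field; rewrite pnatr_eq0.
by move: hQ; lra.
Qed.

(** Restricting to the block before applying a Hahn-Banach functional localises f n; the trivial
    decompositions (x, 0) and (0, x) of a block bound its K-functional by either norm. F is the
    reciprocal of the proportion in [big_block]. *)
Lemma block_functionals : exists (N : nat) (F : R) (k : int -> int) (f : int -> L0 mu -> R),
  0 < F /\ forall n, J n ->
   [/\ exists2 i, (i < (2 * N).+1)%N & k n = n + N%:Z - i%:Z,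
       forall (c : R) x y, csum X x -> csum X y -> f n (c *: x + y) = c * f n x + f n y,
       f n a = Q n,
       forall x m, csum X x -> (weighted_Lnorm p0 U0 (rcut (B (k n)) x) <= m%:E)%E ->
         `|f n x| <= F * m &
       forall x m, csum X x -> (weighted_Lnorm p1 U1 (rcut (B (k n)) x) <= m%:E)%E ->
         `|f n x| <= F * (t n * m)].
Proof.
have [Q0 S0 Ql Sl] := gQS.
have [N hN] := big_block; pose F : R := 2 * (2 * N).+1%:R.
have F0 : 0 < F by rewrite mulr_gt0.
have : forall n, exists z : int * (L0 mu -> R), J n ->
   [/\ exists2 i, (i < (2 * N).+1)%N & z.1 = n + N%:Z - i%:Z,
       forall (c : R) x y, csum X x -> csum X y -> z.2 (c *: x + y) = c * z.2 x + z.2 y,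
       z.2 a = Q n,
       forall x m, csum X x -> (weighted_Lnorm p0 U0 (rcut (B z.1) x) <= m%:E)%E ->
         `|z.2 x| <= F * m &
       forall x m, csum X x -> (weighted_Lnorm p1 U1 (rcut (B z.1) x) <= m%:E)%E ->
         `|z.2 x| <= F * (t n * m)].
  move=> n; have [Jn|nJ] := pselect (J n); last by exists (0, fun=> 0).
  have [k [kE Kk]] := hN n Jn; have tn := t0 Jn; have Qn := Q0 n.
  pose P (x : L0 mu) := fine (Kfun X 1 (t n) x).
  have cb : csum X (rcut (B k) a) by apply: csum_rcut.
  have Pb0 : 0 < P (rcut (B k) a).
    have := lt_le_trans Qn Kk; rewrite pmulr_rgt0//.
  have [f0 [lin0 dom0 fb]] := @hahn_banach R (L0 mu) (csum X) P (rcut (B k) a)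
    (csum0 mu hp0 hp1 w0 w1) (@csum_lin _ _ _ mu p0 p1 U0 U1 hp0 hp1 w0 w1)
    (fun x y => @KfunD _ _ _ mu p0 p1 U0 U1 hp0 hp1 w0 w1 1 (t n) ltr01 tn x y)
    (fun c x => @KfunZ _ _ _ mu p0 p1 U0 U1 hp0 hp1 w0 w1 1 (t n) ltr01 tn c x) cb.
  (* Rescaled to take the value Q n at [a]; by [big_block] the factor is at most F. *)
  pose g x := Q n / P (rcut (B k) a) * f0 (rcut (B k) x).
  have dom x : csum X x -> `|g x| <= F * P (rcut (B k) x).
    move=> cx; have cx' : csum X (rcut (B k) x) by apply: csum_rcut.
    rewrite /g normrM; apply: ler_pM => //; last exact: dom0.
    rewrite ger0_norm; last by rewrite divr_ge0 ?(ltW Qn) ?(ltW Pb0).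
    by rewrite ler_pdivrMr.
  exists (k, g) => _ /=; split => //.
  - move=> c x y cx cy; rewrite /g rcut_lin// lin0; [ring|exact: csum_rcut..].
  - by rewrite /g fb divfK// gt_eqF.
  - move=> x m cx hx; apply: (le_trans (dom x cx)); rewrite ler_wpM2l ?(ltW F0)//.
    have h1 : (weighted_Lnorm p1 U1 (0%R : L0 mu) <= 0%:E)%E by rewrite wLnorm0.
    have := Kfun_le ltr01 tn (esym (addr0 (rcut (B k) x))) hx h1.
    rewrite mul1r mulr0 addr0 -[X in (X <= _)%E -> _]fineK//.
    by apply: Kfun_fin => //; apply: csum_rcut.
  - move=> x m cx hx; apply: (le_trans (dom x cx)); rewrite ler_wpM2l ?(ltW F0)//.
    have h1 : (weighted_Lnorm p0 U0 (0%R : L0 mu) <= 0%:E)%E by rewrite wLnorm0.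
    have := Kfun_le ltr01 tn (esym (add0r (rcut (B k) x))) h1 hx.
    rewrite mul1r add0r -[X in (X <= _)%E -> _]fineK//.
    by apply: Kfun_fin => //; apply: csum_rcut.
move=> /choice[z hz]; exists N, F, (fun n => (z n).1), (fun n => (z n).2).
by split.
Qed.

(** Different n may share a block, so disjointness does not apply directly. For each of the 2N + 1
    shifts i the blocks n + N - i are disjoint, and [lball_pigeonhole] combines the shifts. *)
Lemma functionals_lball p U (N : nat) (F : R) (k : int -> int) (g : int -> R) (x : L0 mu)
    (s : seq int) : (1 <= p)%E -> weight U -> uniq s -> 0 < F ->
  (forall n, n \in s -> exists2 i, (i < (2 * N).+1)%N & k n = n + N%:Z - i%:Z) ->
  (weighted_Lnorm p U x <= 1)%E ->
  (forall n m, n \in s -> (weighted_Lnorm p U (rcut (B (k n)) x) <= m%:E)%E -> `|g n| <= F * m) ->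
  lball p s (fun n => g n / (F * (2 * N).+1%:R)).
Proof.
move=> hp wU us F0 kE hx hg; have dB : disjoint_family B by case: bB.
pose xx (i : nat) n := fine (wnorm mu p U (cut (B (n + N%:Z - i%:Z)) (ofL0 x))) / 1.
have hxx i : lball p s (xx i).
  apply: (@wnorm_lball_disjoint _ _ _ mu p U (fun n => B (n + N%:Z - i%:Z))) => //.
  by move=> m n z /dB Bm /Bm; clear; lia.
have := @lball_pigeonhole R p s (2 * N).+1 xx (fun n => g n / F) hp isT (fun i _ => hxx i).
have -> : (fun n => g n / F / (2 * N).+1%:R) = (fun n => g n / (F * (2 * N).+1%:R)).
  by apply/funext => n; rewrite invfM mulrA.
apply => n ns; have [i iN kn] := kE n ns; exists i => //.
have fin : wnorm mu p U (cut (B (n + N%:Z - i%:Z)) (ofL0 x)) \is a fin_num.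
  rewrite ge0_fin_numE ?wnorm_ge0// -wLnorm_rcut//.
  by apply: (le_lt_trans (wLnorm_rcut_le _ _ _ _)) => //; rewrite (le_lt_trans hx)// ltry.
rewrite /xx divr1 [leRHS]ger0_norm ?fine_ge0 ?wnorm_ge0//.
rewrite normrM normfV (gtr0_norm F0) ler_pdivrMr// mulrC; apply: hg => //.
by rewrite kn wLnorm_rcut// fineK.
Qed.

End Functionals.

Section UniqSums.
Context (R : realType).

Lemma sum_uniq_nat_le (s : seq nat) (K : nat) (g : nat -> R) : uniq s ->
  (forall i, i \in s -> (i < K)%N) -> (forall i, 0 <= g i) ->
  \sum_(i <- s) g i <= \sum_(i < K) g i.
Proof.
move=> us sK g0; have -> : \sum_(i <- s) g i = \sum_(i <- [seq i <- iota 0 K | i \in s]) g i.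
  apply: perm_big; apply: uniq_perm => //; first by rewrite filter_uniq// iota_uniq.
  move=> i; rewrite mem_filter mem_iota add0n leq0n /= andbC.
  by case: (boolP (i \in s)) => [/sK ->//|_]; rewrite andbF.
rewrite big_filter -(big_mkord xpredT) /index_iota subn0 [leRHS](bigID (mem s))/=.
by rewrite lerDl sumr_ge0.
Qed.

Lemma sum_inj_le (s : seq int) (k : int -> nat) (K : nat) (f : int -> R) (g : nat -> R) :
  uniq s -> {in s &, injective k} -> (forall n, n \in s -> (k n < K)%N) ->
  (forall n, n \in s -> f n <= g (k n)) -> (forall i, 0 <= g i) ->
  \sum_(n <- s) f n <= \sum_(i < K) g i.
Proof.
move=> us ik kK fg g0; apply: (@le_trans _ _ (\sum_(n <- s) g (k n))).
  by rewrite big_seq [leRHS]big_seq; apply: ler_sum => n; exact: fg.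
rewrite -(big_map k xpredT g); apply: sum_uniq_nat_le => //.
  by rewrite map_inj_in_uniq.
by move=> i /mapP[n ns ->]; exact: kK.
Qed.

Lemma seq_bound (s : seq int) (k : int -> nat) : exists K, forall n, n \in s -> (k n < K)%N.
Proof.
elim: s => [|m s [K hK]]; first by exists 0%N.
exists (maxn K (k m).+1) => n; rewrite inE => /predU1P[->|/hK h].
  by rewrite leq_max ltnSn orbT.
by rewrite leq_max h.
Qed.

Lemma sum_inj_geometric (s : seq int) (k : int -> nat) (l : R) :
  uniq s -> {in s &, injective k} -> 0 < l -> l < 1 ->
  \sum_(n <- s) l ^+ k n <= (1 - l)^-1.
Proof.
move=> us ik l0 l1; have [K hK] := seq_bound s k.
apply: le_trans (sum_geometric_le K l0 l1).
by apply: (sum_inj_le us ik hK) => // i; rewrite exprn_ge0// ltW.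
Qed.

Lemma lball_map (p : \bar R) (s : seq int) (k : int -> int) (x : int -> R) :
  lball p (map k s) x -> lball p s (fun n => x (k n)).
Proof.
case: p => [e| |]/=; first by rewrite big_map.
  by move=> h n ns; apply: h; exact: map_f.
by move=> h n ns; apply: h; exact: map_f.
Qed.

(** Needed because the shifted indices n - i and n + i may leave J. *)
Lemma lball_extend (p : \bar R) (J : set int) (x : int -> R) (s : seq int) :
  (1 <= p)%E -> uniq s ->
  (forall s, uniq s -> (forall n, n \in s -> J n) -> lball p s x) ->
  lball p s (fun n => if `[< J n >] then x n else 0).
Proof.
move=> p1 us h.
have := h [seq n <- s | `[< J n >]] (filter_uniq _ us) _.
have sJ n : n \in [seq n <- s | `[< J n >]] -> J n.
  by rewrite mem_filter => /andP[/asboolP].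
move=> /(_ sJ); case: p p1 {h} => [e| |]//=; rewrite ?lee_fin => e1.
  rewrite big_filter (bigID (fun n => `[< J n >]) xpredT)/= => h.
  rewrite [X in _ + X]big1 ?addr0; last first.
    by move=> n /negbTE ->; rewrite normr0 powR0// gt_eqF// (lt_le_trans _ e1).
  by rewrite (eq_bigr (fun n => `|x n| `^ e))// => n ->.
move=> h n ns; case: ifPn => [Jn|_]; last by rewrite normr0.
by apply: h; rewrite mem_filter Jn.
Qed.

End UniqSums.

(** * Multipliers that are constant on disjoint sets *)

Section SelectedCoefficient.
Context d (T : measurableType d) (R : realType).
Variable mu : {measure set T -> \bar R}.
Variable E : int -> set T.
Hypotheses (dE : disjoint_family E) (mE : forall n, measurable (E n)).

(** The sum of c n times the indicator of [E n], without an infinite sum: for disjoint [E n] the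
    index at a point is unique, and [xget] picks it. *)
Definition mcoef (c : int -> R) (s : T) : R :=
  cut [set s | exists n, E n s] (fun s => c (xget 0 [set n | E n s])) s.

Lemma mcoefE c n s : E n s -> mcoef c s = c n.
Proof.
move=> Es; rewrite /mcoef cutT; last by exists n.
congr c; have := @xgetPex _ 0 [set n | E n s] (ex_intro _ n Es).
by move=> /= Ex; exact: dE Ex Es.
Qed.

Lemma mcoef0 c s : (forall n, ~ E n s) -> mcoef c s = 0.
Proof. by move=> nE; rewrite /mcoef cutF// => -[n /nE]. Qed.

Let U := \bigcup_j E j%:Z `|` \bigcup_j E (- j%:Z).

Let UP s : U s <-> exists n, E n s.
Proof.
split=> [[[j _ Ej]|[j _ Ej]]|[n En]]; first by exists j%:Z.
  by exists (- j%:Z).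
have [n0|n0] := lerP 0 n; [left|right]; exists (absz n) => //.
  by have -> : (absz n)%:Z = n by lia.
by have -> : - (absz n)%:Z = n by lia.
Qed.

Lemma measurable_mcoef c : measurable_fun setT (mcoef c).
Proof.
move=> _ Z mZ; rewrite setTI.
pose F n := [set s | E n s /\ Z (c n)].
have mF n : measurable (F n).
  have [Zc|nZ] := pselect (Z (c n)).
    by rewrite (_ : F n = E n)//; apply/seteqP; split => x // [].
  by rewrite (_ : F n = set0)//; apply/seteqP; split => x // [].
pose G := [set s | ~ U s /\ Z 0].
have mG : measurable G.
  have [Z0|nZ] := pselect (Z 0).
    rewrite (_ : G = ~` U).
      by apply: measurableC; apply: measurableU; exact: bigcup_measurable.
    by apply/seteqP; split => x // [].
  by rewrite (_ : G = set0)//; apply/seteqP; split => x // [].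
have -> : mcoef c @^-1` Z = \bigcup_j F j%:Z `|` \bigcup_j F (- j%:Z) `|` G.
  apply/seteqP; split => s /=.
    have [[n En]|nE] := pselect (exists n, E n s).
      rewrite (mcoefE c En) => Zc; left.
      have [n0|n0] := lerP 0 n; [left|right]; exists (absz n) => //.
        by have -> : (absz n)%:Z = n by lia.
      by have -> : - (absz n)%:Z = n by lia.
    rewrite mcoef0; last by move=> n En; apply: nE; exists n.
    by move=> Z0; right; split => // /UP.
  move=> [[[j _ [Ej Zc]]|[j _ [Ej Zc]]]|[nU Z0]]; rewrite ?(mcoefE c Ej)//.
  by rewrite mcoef0// => n En; apply: nU; apply/UP; exists n.
apply: measurableU => //; apply: measurableU; exact: bigcup_measurable.
Qed.

(** On a window the product is a finite sum as in the hypothesis; the windows exhaust J, and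
    [wnorm_cut_lim] passes to their union. *)
Lemma wnorm_mcoef p V (J : set int) (y : T -> R) (c : int -> R) (M : R) :
  (1 <= p)%E -> weight V -> measurable_fun setT y -> 0 <= M ->
  (forall n s, E n s -> J n) ->
  (forall s, uniq s -> (forall n, n \in s -> J n) ->
    (wnorm mu p V (fun x => (\sum_(n <- s) cut (E n) (fun x => c n * y x) x)%R) <= M%:E)%E) ->
  (wnorm mu p V (fun x => (mcoef c x * y x)%R) <= M%:E)%E.
Proof.
move=> p1 wV my M0 EJ hs.
pose F k := [set s | exists2 n, n \in window J k k & E n s].
have mF k : measurable (F k).
  have -> : F k = \bigcup_(j in [set j | (j < size (window J k k))%N]) E (nth 0 (window J k k) j).
    apply/seteqP; split => s.
      move=> [n nw En]; exists (index n (window J k k)) => /=; first by rewrite index_mem.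
      by rewrite nth_index.
    by move=> [j /= jw Ej]; exists (nth 0 (window J k k) j) => //; exact: mem_nth.
  exact: bigcup_measurable.
have mg : measurable_fun setT (fun x => mcoef c x * y x).
  by apply: measurable_funM => //; exact: measurable_mcoef.
have ndF : {homo F : n m / (n <= m)%N >-> (n <= m)%O}.
  move=> n m nm; apply/subsetPset => s [k kw Ek]; exists k => //.
  have /mem_window[Jk /andP[h1 h2]] := kw; apply/mem_window; split => //.
  by move: h1 h2 nm; clear; lia.
have cutF' : (wnorm mu p V (cut (\bigcup_k F k) (fun x => (mcoef c x * y x)%R)) <= M%:E)%E.
  apply: wnorm_cut_lim => // k.
  have sJ n : n \in window J k k -> J n by move=> /mem_window[].
  have := hs _ (uniq_window J k k) sJ; congr (wnorm _ _ _ _ <= _)%E.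
  apply/funext => s; have [[n nw En]|nF] := pselect (F k s).
    rewrite cutT; last by exists n.
    rewrite (mcoefE c En) (bigD1_seq n) ?uniq_window//= big1 ?addr0 ?cutT//.
    by move=> m /eqP mn; rewrite cutF// => /dE /(_ En).
  rewrite (cutF _ nF) big1_seq// => n /andP[_ nw]; rewrite cutF// => En.
  by apply: nF; exists n.
rewrite (_ : (fun x => _) = cut (\bigcup_k F k) (fun x => (mcoef c x * y x)%R))//.
apply/funext => s; have [[n En]|nE] := pselect (exists n, E n s).
  rewrite [RHS]cutT//; exists (absz n) => //; exists n => //.
  by apply/mem_window; split; [exact: EJ En|clear; lia].
rewrite mcoef0; last by move=> n En; apply: nE; exists n.
by rewrite /cut mcoef0 ?mul0r// => n En; apply: nE; exists n.
Qed.

End SelectedCoefficient.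

(** * Hoelder estimates on the selected sets, one norm at a time *)

Section PhiMultiplier.
Context d (T : measurableType d) (R : realType).
Variable nu : {measure set T -> \bar R}.
Variables (p r : \bar R) (V : T -> R).
Hypotheses (p1 : (1 <= p)%E) (r1 : (1 <= r)%E) (wV : weight V).
Variables (E : int -> set T) (J : set int) (y : T -> R) (W : int -> R) (A l : R).
Hypotheses (dE : disjoint_family E) (mE : forall n, measurable (E n)).
Hypotheses (my : measurable_fun setT y) (W0 : forall n, 0 < W n) (A0 : 0 < A).
Hypotheses (l0 : 0 < l) (l1 : l < 1).
Variables (tau : nat -> int -> int) (om : nat -> int -> T -> R) (be : int -> R).
Hypothesis tau_inj : forall i, injective (tau i).
Hypothesis mom : forall i n, measurable_fun setT (om i n).
Hypothesis hbe : forall s, uniq s -> lball (multiplier_exponent p r) s be.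
Hypothesis om_bound : forall i n,
  (wnorm nu r V (om i n) <= (A * l ^+ i * W n * `|be (tau i n)|)%:E)%E.
Variables (Rr : int -> T -> R) (K : R) (I : int -> nat).
Hypothesis K1 : 1 <= K.
Hypothesis mRr : forall n, measurable_fun setT (Rr n).
(* The weights 2^-pickle make the remainders summable over any finite set of indices. *)
Hypothesis Rr_bound : forall n, J n ->
  (wnorm nu r V (Rr n) <= (K * A * W n * 2^-1 ^+ choice.pickle n)%:E)%E.
Hypothesis y_dom : forall n, J n -> {ae nu, forall x, E n x ->
  `|y x| <= 2 * (\sum_(i < I n) `|om i n x| + `|Rr n x|)}.

(** The 4 covers the factor 2 of the domination of [y] and the sum, at most 2, of the weights
    2^-pickle; K is the loss at the ends of J. One summand bounds the series over shifts, the other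
    the remainder. *)
Definition phi_const := 4 * K / (1 - l) + 4 * K.

(** For each shift i, Hoelder's inequality puts xi n * be (tau i n) into the ball of the target
    exponent, and disjointness of the [E n] turns this into a bound for the sum; the shifts then
    form a geometric series. *)
Lemma phi_multiplier (s : seq int) (xi : int -> R) : uniq s -> (forall n, n \in s -> J n) ->
  lball p s xi ->
  (wnorm nu r V (fun x => (\sum_(n <- s) cut (E n) (fun x => xi n / W n * y x) x)%R)
     <= (phi_const * A)%:E)%E.
Proof.
move=> us sJ hxi; have K0 : 0 < K by rewrite (lt_le_trans _ K1).
have p0 : (0 < p)%E by rewrite (lt_le_trans _ p1).
have xi1 n : n \in s -> `|xi n| <= 1 by exact: (lball_le1 p0 hxi).
(* The number I n of terms varies with n; on the finite set [s] one bound serves, and surplus terms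
   only enlarge the majorant. *)
have [M hM] := seq_bound s I.
pose v i n x := 2 * (xi n / W n) * om i n x.
pose rest n x := 2 * (xi n / W n) * Rr n x.
have mv i n : measurable_fun setT (v i n) by apply: measurable_funM.
have mrest n : measurable_fun setT (rest n) by apply: measurable_funM.
have c0 : 0 < 4 * K * A by rewrite !mulr_gt0.
have -> : phi_const * A = 4 * K * A / (1 - l) + 4 * K * A by rewrite /phi_const; ring.
have coefE n : `|2 * (xi n / W n)| = 2 * (`|xi n| / W n).
  by rewrite !normrM normr_nat normfV (gtr0_norm (W0 n)).
have coef0 n : 0 <= 2 * (`|xi n| / W n) by rewrite -coefE.
apply: (@wnorm_sum_cut_dom _ _ _ nu r V E s _ M v rest (4 * K * A) l) => //.
- by move=> n; apply: measurable_funM.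
- exact: ltW.
- have : forall k : nat, {ae nu, forall x, nth 0 s k \in s -> E (nth 0 s k) x ->
     `|y x| <= 2 * (\sum_(i < I (nth 0 s k)) `|om i (nth 0 s k) x| + `|Rr (nth 0 s k) x|)}.
    move=> k; have [ks|nks] := boolP (nth 0 s k \in s); last exact: nearW.
    by apply: filterS (y_dom (sJ _ ks)) => x hx _.
  move/ae_foralln; apply: filterS => x hx n ns Ex.
  have := hx (index n s); rewrite nth_index// => /(_ ns Ex) hy.
  rewrite normrM; apply: (@le_trans _ _ (`|xi n / W n| *
     (2 * (\sum_(i < M) `|om i n x| + `|Rr n x|)))).
    rewrite ler_wpM2l//; apply: (le_trans hy); rewrite ler_wpM2l// lerD2r.
    rewrite -!(big_mkord xpredT (fun i => `|om i n x|)).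
    have IM : (I n <= M)%N by exact: ltnW (hM n ns).
    by rewrite [leRHS](big_cat_nat (leq0n _) IM)//= lerDl sumr_ge0.
  rewrite mulrA mulrDr mulr_sumr le_eqVlt; apply/orP; left; apply/eqP; congr (_ + _).
    by apply: eq_bigr => i _; rewrite /v [RHS]normrM [X in _ = X * _]normrM normr_nat; ring.
  by rewrite /rest [RHS]normrM [X in _ = X * _]normrM normr_nat; ring.
- move=> i _; have li : 0 < l ^+ i by rewrite exprn_gt0.
  have c1 : 0 < 4 * K * A * l ^+ i by rewrite mulr_gt0.
  have hx : lball r s (fun n => xi n * be (tau i n)).
    apply: (lball_mul p1 r1 hxi); apply: lball_map; apply: hbe.
    by rewrite map_inj_uniq//; exact: tau_inj.
  apply: (wnorm_sum_disjoint r1 wV us dE mE (mv i) c1 _ hx) => n ns.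
  apply: (@le_trans _ _ (wnorm nu r V (v i n))).
    apply: wnorm_le => //; first exact: measurable_cut.
    by apply: nearW => x; exact: norm_cut.
  have B0 : 0 <= A * l ^+ i * W n * `|be (tau i n)|.
    by rewrite !mulr_ge0// ltW.
  apply: (le_trans (wnormZ _ r1 wV (mom i n) B0 (om_bound i n))).
  rewrite lee_fin coefE normrM.
  have -> : 2 * (`|xi n| / W n) * (A * l ^+ i * W n * `|be (tau i n)|) =
    2 * A * l ^+ i * (`|xi n| * `|be (tau i n)|) by field; rewrite gt_eqF.
  rewrite ler_wpM2r ?mulr_ge0// ler_wpM2r ?(ltW li)// ler_wpM2r ?(ltW A0)//.
  by move: K1; lra.
- have h2 : (0 : R) < 2^-1 by rewrite invr_gt0.
  have h2' : 2^-1 < 1 :> R by rewrite invf_lt1// ltr1n.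
  apply: (@le_trans _ _ (\sum_(n <- s) (2 * K * A * 2^-1 ^+ choice.pickle n))%:E).
    apply: wnorm_sum_le => //; first by move=> n; exact: measurableT_comp.
    move=> n ns; apply: (@le_trans _ _ (wnorm nu r V (rest n))).
      apply: wnorm_le => //; first exact: measurableT_comp.
      by apply: nearW => x; rewrite normr_id.
    have e0 : 0 <= 2^-1 ^+ choice.pickle n :> R by rewrite exprn_ge0.
    have B0 : 0 <= K * A * W n * 2^-1 ^+ choice.pickle n by rewrite !mulr_ge0// ltW.
    apply: (le_trans (wnormZ _ r1 wV (mRr n) B0 (Rr_bound (sJ n ns)))).
    rewrite lee_fin coefE.
    have -> : 2 * (`|xi n| / W n) * (K * A * W n * 2^-1 ^+ choice.pickle n) =
      `|xi n| * (2 * K * A * 2^-1 ^+ choice.pickle n) by field; rewrite gt_eqF.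
    by rewrite ler_piMl ?xi1// !mulr_ge0// ltW.
  rewrite lee_fin -mulr_sumr.
  have -> : 4 * K * A = 2 * K * A * (1 - 2^-1)^-1.
    have -> : (1 - 2^-1 : R)^-1 = 2 by rewrite (_ : 1 - 2^-1 = 2^-1 :> R) ?invrK//; lra.
    by ring.
  rewrite ler_wpM2l ?mulr_ge0 ?(ltW K0) ?(ltW A0)//.
  apply: sum_inj_geometric => // m n _ _; exact: (pcan_inj choice.pickleK).
Qed.

End PhiMultiplier.

(** K absorbs the weight of the only possible index, in practice an end of J; it depends on P and M
    alone. *)
Lemma at_most_one_bound (R : realType) (P : int -> Prop) (M : R) : 0 < M ->
  (forall m n, P m -> P n -> m = n) ->
  exists2 K : R, 1 <= K & forall n, P n -> M <= K * 2^-1 ^+ choice.pickle n.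
Proof.
move=> M0 uP; have [[n0 Pn0]|nP] := pselect (exists n, P n); last first.
  by exists 1 => // n Pn; exfalso; apply: nP; exists n.
exists (Num.max 1 (M * 2 ^+ choice.pickle n0)); first by rewrite le_max lexx.
move=> n Pn; have -> := uP _ _ Pn Pn0.
rewrite exprVn ler_pdivlMr ?exprn_gt0//.
by rewrite le_max lexx orbT.
Qed.

(** * An operator from each representation in the phi-space *)

Section PhiInOrbit.
Context d d' (TX : measurableType d) (TY : measurableType d') (R : realType).
Variables (mu : {measure set TX -> \bar R}) (nu : {measure set TY -> \bar R}).
Variables (p0 p1 : \bar R) (U0 U1 : TX -> R) (q0 q1 : \bar R) (V0 V1 : TY -> R).
Hypotheses (hp0 : (1 <= p0)%E) (hp1 : (1 <= p1)%E) (w0 : weight U0) (w1 : weight U1).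
Hypotheses (hq0 : (1 <= q0)%E) (hq1 : (1 <= q1)%E) (v0 : weight V0) (v1 : weight V1).
Let X := Lp_couple mu p0 p1 U0 U1.
Let Y := Lp_couple nu q0 q1 V0 V1.
Variables (a : L0 mu) (rho : R -> R) (J : set int) (t : int -> R).
Variables (Q S : int -> R) (q : R) (B : int -> set TX) (C : R).
Hypotheses (ca : csum X a) (J0 : J !=set0) (iJ : is_interval J) (q_gt1 : 1 < q) (C0 : 0 < C).
Hypotheses (gQS : geometric_weights q Q S).
Hypothesis bB : block_decomposition p0 p1 U0 U1 a J Q S B C.
Hypothesis t0 : forall n, J n -> 0 < t n.
Hypothesis QSJ : forall n, J n -> Q n = rho (t n) /\ S n = rho (t n) / t n.
Hypothesis KQ : forall n, J n -> Kfun X 1 (t n) a = (Q n)%:E.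
Local Notation l := (q^-1).
Local Notation G := ((1 - q^-1)^-1).
Local Notation r0 := (multiplier_exponent p0 q0).
Local Notation r1 := (multiplier_exponent p1 q1).

Let tS n : J n -> t n * S n = Q n.
Proof. by move=> Jn; have [-> ->] := QSJ Jn; rewrite mulrC divfK// gt_eqF// t0. Qed.
Let q0' : 0 < q. Proof. exact: lt_trans q_gt1. Qed.
Let l0 : 0 < l. Proof. by rewrite invr_gt0. Qed.
Let l1 : l < 1. Proof. by rewrite invf_lt1. Qed.
Let G0 : 0 < G. Proof. by rewrite invr_gt0 subr_gt0. Qed.

Section Representation.
Variables (x : L0 nu) (w : int -> L0 nu) (A : R).
Hypothesis rep : @phi_representation R rho J t Y r0 r1 x w.
Hypothesis A0 : 0 < A.
Hypothesis PA0 : (@phi_norm0 R J Y r0 w <= A%:E)%E.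
Hypothesis PA1 : (@phi_norm1 R J t Y r1 w <= A%:E)%E.

(** The terms of the representation, continued by zero off J so that shifts need no case
    distinction. *)
Definition term n : TY -> R :=
  if `[< J n >] then (fun s => Q n * ofL0 (w n) s) else (fun=> 0).
(** Normalised norms of the [w n]: they lie in the unit ball of l_{r_0}, and term n has first norm
    at most A * Q n * |be0 n|. [be1] does the same for the second space and S n. *)
Definition be0 n : R :=
  if `[< J n >] then fine (weighted_Lnorm q0 V0 (w n)) / A else 0.
Definition be1 n : R :=
  if `[< J n >] then fine ((t n)%:E * weighted_Lnorm q1 V1 (w n)) / A else 0.

Lemma measurable_term n : measurable_fun setT (term n).
Proof.
by rewrite /term; case: ifP => _; [apply: measurable_funM|exact: measurable_cst].
Qed.

Lemma weights_pos n : 0 < Q n /\ 0 < S n. Proof. by case: gQS. Qed.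

Let r0_ge1 : (1 <= r0)%E. Proof. exact: multiplier_exponent_ge1. Qed.
Let r1_ge1 : (1 <= r1)%E. Proof. exact: multiplier_exponent_ge1. Qed.

Let blocks0 : (forall n, J n -> weighted_Lnorm q0 V0 (w n) \is a fin_num) /\
  forall s, uniq s -> (forall n, n \in s -> J n) ->
    lball r0 s (fun n => fine (weighted_Lnorm q0 V0 (w n)) / A).
Proof.
apply: lnorm_lball => //; first exact: lt_le_trans r0_ge1.
by move=> n _; exact: wLnorm_ge0.
Qed.

Let blocks1 : (forall n, J n -> ((t n)%:E * weighted_Lnorm q1 V1 (w n))%E \is a fin_num) /\
  forall s, uniq s -> (forall n, n \in s -> J n) ->
    lball r1 s (fun n => fine ((t n)%:E * weighted_Lnorm q1 V1 (w n)) / A).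
Proof.
apply: lnorm_lball => //; first exact: lt_le_trans r1_ge1.
by move=> n Jn; apply: mule_ge0; [rewrite lee_fin ltW// t0|exact: wLnorm_ge0].
Qed.

Lemma lball_be0 s : uniq s -> lball r0 s be0.
Proof. by move=> us; apply: lball_extend => //; exact: blocks0.2. Qed.

Lemma lball_be1 s : uniq s -> lball r1 s be1.
Proof. by move=> us; apply: lball_extend => //; exact: blocks1.2. Qed.

Lemma be0_le1 n : `|be0 n| <= 1.
Proof.
apply: (@lball_le1 R r0 [:: n]); [exact: lt_le_trans r0_ge1|exact: lball_be0|].
by rewrite inE.
Qed.

Lemma be1_le1 n : `|be1 n| <= 1.
Proof.
apply: (@lball_le1 R r1 [:: n]); [exact: lt_le_trans r1_ge1|exact: lball_be1|].
by rewrite inE.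
Qed.

Lemma term_bound0 n : (wnorm nu q0 V0 (term n) <= (A * Q n * `|be0 n|)%:E)%E.
Proof.
have [Qn Sn] := weights_pos n; rewrite /term /be0; case: asboolP => Jn; last first.
  by rewrite wnorm0// normr0 mulr0.
have g0 : 0 <= fine (weighted_Lnorm q0 V0 (w n)) by rewrite fine_ge0// wLnorm_ge0.
have h : (wnorm nu q0 V0 (ofL0 (w n)) <= (fine (weighted_Lnorm q0 V0 (w n)))%:E)%E.
  by rewrite fineK//; exact: blocks0.1.
apply: (le_trans (wnormZ (Q n) hq0 v0 (measurable_ofL0 (w n)) g0 h)).
rewrite lee_fin (gtr0_norm Qn) ger0_norm ?divr_ge0 ?(ltW A0)//.
rewrite le_eqVlt; apply/orP; left; apply/eqP; field; exact: lt0r_neq0.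
Qed.

Lemma term_bound1 n : (wnorm nu q1 V1 (term n) <= (A * S n * `|be1 n|)%:E)%E.
Proof.
have [Qn Sn] := weights_pos n; rewrite /term /be1; case: asboolP => Jn; last first.
  by rewrite wnorm0// normr0 mulr0.
have tn := t0 Jn; have fin := blocks1.1 n Jn.
have finN : weighted_Lnorm q1 V1 (w n) \is a fin_num.
  rewrite ge0_fin_numE ?wLnorm_ge0//; case E : (weighted_Lnorm q1 V1 (w n)) => [z| |]//.
    by rewrite ltry.
  by move: fin; rewrite E gt0_muley ?lte_fin.
have g0 : 0 <= fine (weighted_Lnorm q1 V1 (w n)) by rewrite fine_ge0// wLnorm_ge0.
have h : (wnorm nu q1 V1 (ofL0 (w n)) <= (fine (weighted_Lnorm q1 V1 (w n)))%:E)%E.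
  by rewrite fineK.
apply: (le_trans (wnormZ (Q n) hq1 v1 (measurable_ofL0 (w n)) g0 h)).
have -> : fine ((t n)%:E * weighted_Lnorm q1 V1 (w n)) = t n * fine (weighted_Lnorm q1 V1 (w n)).
  by rewrite -[in LHS](fineK finN).
rewrite lee_fin (gtr0_norm Qn) ger0_norm ?divr_ge0 ?mulr_ge0 ?(ltW A0) ?(ltW tn)//.
rewrite -(tS Jn) le_eqVlt; apply/orP; left; apply/eqP; field; exact: lt0r_neq0.
Qed.

Lemma low_sum_bound (s : seq int) m : uniq s -> (forall k, k \in s -> k <= m) ->
  (wnorm nu q0 V0 (fun z => (\sum_(k <- s) term k z)%R) <= (A * G * Q m)%:E)%E.
Proof.
move=> us sm; have [Qm _] := weights_pos m; have [_ _ Ql _] := gQS.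
apply: (@le_trans _ _ (\sum_(k <- s) (A * Q m * l ^+ absz (m - k)%R))%:E).
  apply: wnorm_sum_le => //; first exact: measurable_term.
  move=> k ks; apply: (le_trans (term_bound0 k)); rewrite lee_fin.
  have [Qk _] := weights_pos k.
  apply: (@le_trans _ _ (A * Q k)).
    by rewrite ler_piMr ?be0_le1// mulr_ge0// ltW.
  rewrite -mulrA ler_wpM2l ?(ltW A0)// mulrC.
  have := @geo_down R Q l m (absz (m - k)%R) l0 Ql.
  suff -> : m - (absz (m - k)%R)%:Z = k by [].
  by have := sm k ks; clear; lia.
rewrite lee_fin -mulr_sumr [leRHS]mulrAC ler_wpM2l//; first by rewrite mulr_ge0// ltW.
apply: sum_inj_geometric => // i j /sm im /sm jm.
by move: im jm; clear; lia.
Qed.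

Lemma high_sum_bound (s : seq int) m : uniq s -> (forall k, k \in s -> m <= k) ->
  (wnorm nu q1 V1 (fun z => (\sum_(k <- s) term k z)%R) <= (A * G * S m)%:E)%E.
Proof.
move=> us sm; have [_ Sm] := weights_pos m; have [_ _ _ Sl] := gQS.
apply: (@le_trans _ _ (\sum_(k <- s) (A * S m * l ^+ absz (k - m)%R))%:E).
  apply: wnorm_sum_le => //; first exact: measurable_term.
  move=> k ks; apply: (le_trans (term_bound1 k)); rewrite lee_fin.
  have [_ Sk] := weights_pos k.
  apply: (@le_trans _ _ (A * S k)).
    by rewrite ler_piMr ?be1_le1// mulr_ge0// ltW.
  rewrite -mulrA ler_wpM2l ?(ltW A0)// mulrC.
  have := @geo_up R S l m (absz (k - m)%R) l0 Sl.
  suff -> : m + (absz (k - m)%R)%:Z = k by [].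
  by have := sm k ks; clear; lia.
rewrite lee_fin -mulr_sumr [leRHS]mulrAC ler_wpM2l//; first by rewrite mulr_ge0// ltW.
apply: sum_inj_geometric => // i j /sm im /sm jm.
by move: im jm; clear; lia.
Qed.

(** Convergence in the sum of the couple: the error of some partial sum has K(1, 1, .) below e,
    hence splits into two small parts. *)
Lemma representation_decomposition (e : R) : 0 < e ->
  exists (z : seq int * (L0 nu * L0 nu)),
    [/\ uniq z.1, forall k, k \in z.1 -> J k,
        (weighted_Lnorm q0 V0 z.2.1 <= e%:E)%E, (weighted_Lnorm q1 V1 z.2.2 <= e%:E)%E &
        {ae nu, forall s, ofL0 x s =
           \sum_(k <- z.1) term k s + ofL0 z.2.1 s + ofL0 z.2.2 s}].
Proof.
move=> e0; have [_ _ cv _ _] := rep.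
move/fine_cvgP : cv => [fin /cvgrPdist_lt /(_ _ e0) h].
have [[M N] [/= finz]] := filter_ex (filterI fin h).
rewrite sub0r normrN => hz.
have K0 := @Kfun_ge0 _ _ _ nu q0 q1 V0 V1 1 1 ltr01 ltr01
  (x - partial_sum rho J t (w : int -> Y) M N).
have : (Kfun Y 1 1 (x - partial_sum rho J t (w : int -> Y) M N)%R < e%:E)%E.
  rewrite -(fineK finz) lte_fin; apply: le_lt_trans hz.
  exact: ler_norm.
move=> /(Kfun_decomp ltr01 ltr01)[x0 [x1 [xE h0 h1]]].
exists (window J M N, (x0, x1)) => /=; split.
- exact: uniq_window.
- by move=> k /mem_window[].
- by rewrite divr1 in h0.
- by rewrite divr1 in h1.
have hs := ofL0_sum (window J M N) xpredT (fun n => rho (t n) *: w n).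
have hz' : {ae nu, forall s, forall k : nat,
      ofL0 (rho (t (nth 0 (window J M N) k)) *: w (nth 0 (window J M N) k)) s =
      rho (t (nth 0 (window J M N) k)) * ofL0 (w (nth 0 (window J M N) k)) s}.
  by apply/ae_foralln => k; exact: ofL0_Z.
have hB := ofL0_B x (\sum_(n <- window J M N) rho (t n) *: w n).
have hD := ofL0_D x0 x1.
rewrite partial_sumE in xE.
apply: filterS3 (filterI hs hz') hB hD => s [E1 E2] E3 E4.
have E5 : ofL0 x s = ofL0 (\sum_(n <- window J M N) rho (t n) *: w n) s + ofL0 (x0 + x1) s.
  by rewrite -xE E3 addrC subrK.
rewrite E5 E4 E1 addrA; congr (_ + _ + _).
apply: eq_big_seq => n ns; have /mem_window[Jn _] := ns.
have := E2 (index n (window J M N)); rewrite nth_index// => ->.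
by rewrite /term asboolT//; have [-> _] := QSJ Jn.
Qed.

(** No index of the representation exceeds n, so partial sums are bounded in the first space by a
    geometric series, and [wnorm_le_of_decompositions] passes to x. In G + 1 the 1 is for the error
    kept in the first space. *)
Lemma top_bound n : J n -> ~ J (n + 1) ->
  (wnorm nu q0 V0 (ofL0 x) <= (2 * (A * (G + 1) * Q n))%:E)%E.
Proof.
move=> Jn nJ; have [Qn _] := weights_pos n.
apply: (wnorm_le_of_decompositions hq1 hq0 v1 v0 (measurable_ofL0 x)).
  by rewrite !mulr_ge0 ?addr_ge0 ?(ltW A0) ?(ltW G0) ?(ltW Qn).
(* Below e for the error that is split off, below A * Q n for the one that is kept. *)
move=> e e0; have e'0 : 0 < Num.min e (A * Q n) by rewrite lt_min e0 mulr_gt0.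
have [[s [x0 x1]] [/= us sJ h0 h1 xE]] := representation_decomposition e'0.
pose v z := \sum_(k <- s) term k z + ofL0 x0 z.
have ms : measurable_fun setT (fun z => \sum_(k <- s) term k z).
  by apply: measurable_big => k; exact: measurable_term.
have mv : measurable_fun setT v by apply: measurable_funD.
exists (fun z => ofL0 x z - v z), v; split => //.
- exact: measurable_funB.
- by move=> z; rewrite subrK.
- apply: (@le_trans _ _ (Num.min e (A * Q n))%:E); last by rewrite lee_fin ge_min lexx.
  apply: le_trans h1; rewrite wLnormE; apply: wnorm_le => //; first exact: measurable_funB.
  by apply: filterS xE => z ->; rewrite /v addrC addKr.
- apply: (le_trans (wnormD _ hq0 v0 ms (measurable_ofL0 x0))).
  have -> : A * (G + 1) * Q n = A * G * Q n + A * Q n by ring.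
  rewrite EFinD; apply: leeD.
    apply: low_sum_bound => // k ks; rewrite leNgt; apply/negP => nk.
    by apply: nJ; apply: (iJ Jn (sJ k ks)); move: nk; clear; lia.
  by apply: (le_trans h0); rewrite lee_fin ge_min lexx orbT.
Qed.

Lemma bottom_bound n : J n -> ~ J (n - 1) ->
  (wnorm nu q1 V1 (ofL0 x) <= (2 * (A * (G + 1) * S n))%:E)%E.
Proof.
move=> Jn nJ; have [_ Sn] := weights_pos n.
apply: (wnorm_le_of_decompositions hq0 hq1 v0 v1 (measurable_ofL0 x)).
  by rewrite !mulr_ge0 ?addr_ge0 ?(ltW A0) ?(ltW G0) ?(ltW Sn).
move=> e e0; have e'0 : 0 < Num.min e (A * S n) by rewrite lt_min e0 mulr_gt0.
have [[s [x0 x1]] [/= us sJ h0 h1 xE]] := representation_decomposition e'0.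
pose v z := \sum_(k <- s) term k z + ofL0 x1 z.
have ms : measurable_fun setT (fun z => \sum_(k <- s) term k z).
  by apply: measurable_big => k; exact: measurable_term.
have mv : measurable_fun setT v by apply: measurable_funD.
exists (fun z => ofL0 x z - v z), v; split => //.
- exact: measurable_funB.
- by move=> z; rewrite subrK.
- apply: (@le_trans _ _ (Num.min e (A * S n))%:E); last by rewrite lee_fin ge_min lexx.
  apply: le_trans h0; rewrite wLnormE; apply: wnorm_le => //; first exact: measurable_funB.
  apply: filterS xE => z ->; rewrite /v.
  rewrite (_ : _ - _ = ofL0 x0 z)//; ring.
- apply: (le_trans (wnormD _ hq1 v1 ms (measurable_ofL0 x1))).
  have -> : A * (G + 1) * S n = A * G * S n + A * S n by ring.
  rewrite EFinD; apply: leeD.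
    apply: high_sum_bound => // k ks; rewrite leNgt; apply/negP => nk.
    by apply: nJ; apply: (iJ (sJ k ks) Jn); move: nk; clear; lia.
  by apply: (le_trans h1); rewrite lee_fin ge_min lexx orbT.
Qed.

Variable K : R.
Hypothesis K1 : 1 <= K.
Hypothesis Kend : forall n, J n -> ~ J (n + 1) \/ ~ J (n - 1) ->
  2 * (G + 1) <= K * 2^-1 ^+ choice.pickle n.

(* The parts of x on E n behave like disjointly supported terms of a representation. *)
Lemma disjoint_representation : exists E : int -> set TY,
  [/\ forall n, measurable (E n), disjoint_family E, forall n s, E n s -> J n,
      {ae nu, forall s, ofL0 x s != 0 -> exists n, E n s} &
      forall (s : seq int) (xi : int -> R), uniq s -> (forall n, n \in s -> J n) ->
        (lball p0 s xi -> (wnorm nu q0 V0 (fun z => (\sum_(n <- s)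
           cut (E n) (fun z => xi n / Q n * ofL0 x z) z)%R) <= (phi_const l K * A)%:E)%E) /\
        (lball p1 s xi -> (wnorm nu q1 V1 (fun z => (\sum_(n <- s)
           cut (E n) (fun z => xi n / S n * ofL0 x z) z)%R) <= (phi_const l K * A)%:E)%E)].
Proof.
have [Q0 S0 Ql Sl] := gQS; have A0' := ltW A0; have G0' := ltW G0.
pose y := ofL0 x; have my : measurable_fun setT y by exact: measurable_ofL0.
pose de (n : int) : R := 2^-1 ^+ choice.pickle n.
have de0 n : 0 < de n by rewrite exprn_gt0// invr_gt0.
have de1 n : de n <= 1 by rewrite exprn_ile1// ?invr_ge0// invf_le1// ler1n.
(* The first error of the n-th decomposition is used at index n, the second at index n + 1, hence
   the two scales. *)
pose ep n := A * Num.min (Q n * de n) (S (n + 1) * de (n + 1)).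
have ep0 n : 0 < ep n by rewrite mulr_gt0// lt_min !mulr_gt0.
have /choice[z hz] n := representation_decomposition (ep0 n).
pose s0 n := (z n).1; pose u0 n := (z n).2.1; pose u1 n := (z n).2.2.
have us0 n : uniq (s0 n) by case: (hz n).
have s0J n k : k \in s0 n -> J k by case: (hz n) => _ h _ _ _; exact: h.
have hu0 n : (wnorm nu q0 V0 (ofL0 (u0 n)) <= (A * Q n * de n)%:E)%E.
  case: (hz n) => _ _ h _ _; apply: (le_trans h).
  by rewrite lee_fin -mulrA ler_wpM2l// ge_min lexx.
have hu1 n : (wnorm nu q1 V1 (ofL0 (u1 n)) <= (A * S (n + 1) * de (n + 1))%:E)%E.
  case: (hz n) => _ _ _ h _; apply: (le_trans h).
  by rewrite lee_fin -mulrA ler_wpM2l// ge_min lexx orbT.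
pose lo n v := \sum_(k <- [seq k <- s0 n | k <= n]) term k v.
pose hi n v := \sum_(k <- [seq k <- s0 n | ~~ (k <= n)]) term k v.
have mlo n : measurable_fun setT (lo n).
  by apply: measurable_big => k; exact: measurable_term.
have mhi n : measurable_fun setT (hi n).
  by apply: measurable_big => k; exact: measurable_term.
have yE n : {ae nu, forall v, y v = lo n v + ofL0 (u0 n) v + (hi n v + ofL0 (u1 n) v)}.
  case: (hz n) => _ _ _ _; apply: filterS => v; rewrite /y => ->.
  rewrite /lo /hi !big_filter (bigID (fun k => k <= n))/=.
  by rewrite -!addrA; congr (_ + _); rewrite addrCA.
pose h n v := lo n v + ofL0 (u0 n) v.
have mh n : measurable_fun setT (h n) by apply: measurable_funD.
have Nh n : (wnorm nu q0 V0 (h n) <= (A * (G + 1) * Q n)%:E)%E.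
  apply: (le_trans (wnormD _ hq0 v0 (mlo n) (measurable_ofL0 (u0 n)))).
  have -> : A * (G + 1) * Q n = A * G * Q n + A * Q n by ring.
  rewrite EFinD; apply: leeD.
    apply: low_sum_bound; first exact: filter_uniq.
    by move=> k; rewrite mem_filter => /andP[].
  apply: (le_trans (hu0 n)); rewrite lee_fin ler_piMr// mulr_ge0// ltW//.
have Nyh n : (wnorm nu q1 V1 (fun v => (y v - h n v)%R) <= (A * (G + 1) * S (n + 1))%:E)%E.
  rewrite (@eq_wnorm _ _ _ nu q1 V1 _ (hi n \+ ofL0 (u1 n))%R)//.
  - apply: (le_trans (wnormD _ hq1 v1 (mhi n) (measurable_ofL0 (u1 n)))).
    have -> : A * (G + 1) * S (n + 1) = A * G * S (n + 1) + A * S (n + 1) by ring.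
    rewrite EFinD; apply: leeD.
      apply: high_sum_bound; first exact: filter_uniq.
      by move=> k; rewrite mem_filter => /andP[+ _]; clear; lia.
    by apply: (le_trans (hu1 n)); rewrite lee_fin ler_piMr// mulr_ge0// ltW.
  - exact: measurable_funB.
  - exact: measurable_funD.
  - by apply: filterS (yE n) => v ->; rewrite /h /= addrC addKr.
have C20 : 0 < 2 * (A * (G + 1)) by rewrite !mulr_gt0// addr_gt0.
have c1 (D : R) : 0 <= D -> A * (G + 1) * D <= 2 * (A * (G + 1)) * D.
  move=> D0; rewrite ler_wpM2r// ler_peMl ?ler1n// mulr_ge0// addr_ge0//.
have Smono n : S (n + 1) <= S n.
  by apply: (le_trans (Sl n)); rewrite ler_piMl ?(ltW (S0 _))// ltW.
have [|||E [mE dE EJ E' [Eae _ _]]] := @selectionJ _ _ _ nu J q0 q1 V0 V1 y h Q S q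
  (2 * (A * (G + 1))) J0 iJ hq0 hq1 v0 v1 my mh q_gt1 C20 gQS.
- move=> n Jn; rewrite /upper_cut; case: asboolP => nJ.
    by apply: (le_trans (Nh n)); rewrite lee_fin c1// ltW.
  by rewrite -mulrA; exact: top_bound.
- move=> n Jn _; apply: (le_trans (Nyh n)); rewrite lee_fin.
  apply: (le_trans (c1 _ (ltW (S0 _)))); rewrite ler_wpM2l//.
  exact: ltW.
- by move=> n Jn nJ; rewrite -mulrA; exact: bottom_bound.
have EJ' n v : E n v -> J n by move=> /EJ[].
exists E; split => // s xi us sJ.
have /choice[I0 hI0] n := seq_bound (s0 n) (fun k => absz (n - k)%R).
have /choice[I1 hI1] n := seq_bound (s0 (n - 1)) (fun k => absz (k - n)%R).
(* The remainder on [E n] is the error of the decomposition, except at an end of J, where it is all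
   of [y] and the constant K takes over. *)
pose Rr0 n := if `[< J (n + 1) >] then ofL0 (u0 n) : TY -> R else y.
pose Rr1 n := if `[< J (n - 1) >] then ofL0 (u1 (n - 1)) : TY -> R else y.
have mRr0 n : measurable_fun setT (Rr0 n).
  by rewrite /Rr0; case: ifP => _ //; exact: measurable_ofL0.
have mRr1 n : measurable_fun setT (Rr1 n).
  by rewrite /Rr1; case: ifP => _ //; exact: measurable_ofL0.
have KA (D : R) n : 0 <= D -> A * D * de n <= K * A * D * de n.
  move=> D0; rewrite -!mulrA [leRHS]mulrCA ler_wpM2l// ler_peMl//.
  by rewrite mulr_ge0// ltW.
have Kend' (D : R) n : 0 <= D -> J n -> ~ J (n + 1) \/ ~ J (n - 1) ->
    2 * (A * (G + 1) * D) <= K * A * D * de n.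
  move=> D0 Jn nJ; have := Kend Jn nJ; rewrite -/(de n) => hK.
  have -> : 2 * (A * (G + 1) * D) = A * D * (2 * (G + 1)) by ring.
  have -> : K * A * D * de n = A * D * (K * de n) by ring.
  by rewrite ler_wpM2l// mulr_ge0.
split=> hxi.
- apply: (@phi_multiplier _ _ _ nu p0 q0 V0 hp0 hq0 v0 E J y Q A l dE mE my Q0 A0 l0 l1
    (fun i n => n - i%:Z) (fun i n => term (n - i%:Z)) be0 _ _ lball_be0 _ Rr0 K I0 K1 mRr0
    _ _ s xi us sJ hxi).
  + by move=> i m n /addIr.
  + by move=> i n; exact: measurable_term.
  + move=> i n; apply: (le_trans (term_bound0 _)); rewrite lee_fin ler_wpM2r//.
    by rewrite -mulrA ler_wpM2l//; exact: geo_down.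
  + move=> n Jn; rewrite /Rr0; case: asboolP => nJ.
      by apply: (le_trans (hu0 n)); rewrite lee_fin KA// ltW.
    apply: (le_trans (top_bound Jn nJ)); rewrite lee_fin Kend'//; first exact: ltW.
    by left.
  + move=> n Jn; apply: nearW => v /EJ[_ hv]; apply: (le_trans hv).
    rewrite ler_wpM2l// /upper_cut /Rr0; case: asboolP => nJ; last first.
      by rewrite lerDr sumr_ge0.
    rewrite /h; apply: (le_trans (ler_normD _ _)); rewrite lerD2r /lo.
    apply: (le_trans (ler_norm_sum _ _ _)).
    apply: (@sum_inj_le R _ (fun k => absz (n - k)%R) (I0 n) _ (fun i => `|term (n - i%:Z) v|)).
    * exact: filter_uniq.
    * by move=> i j; rewrite !mem_filter => /andP[+ _] /andP[+ _]; clear; lia.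
    * by move=> k; rewrite mem_filter => /andP[_ /hI0].
    * move=> k; rewrite mem_filter => /andP[kn _].
      suff -> : n - (absz (n - k)%R)%:Z = k by [].
      by move: kn; clear; lia.
    * by move=> i; exact: normr_ge0.
- apply: (@phi_multiplier _ _ _ nu p1 q1 V1 hp1 hq1 v1 E J y S A l dE mE my S0 A0 l0 l1
    (fun i n => n + i%:Z) (fun i n => term (n + i%:Z)) be1 _ _ lball_be1 _ Rr1 K I1 K1 mRr1
    _ _ s xi us sJ hxi).
  + by move=> i m n /addIr.
  + by move=> i n; exact: measurable_term.
  + move=> i n; apply: (le_trans (term_bound1 _)); rewrite lee_fin ler_wpM2r//.
    by rewrite -mulrA ler_wpM2l//; exact: geo_up.
  + move=> n Jn; rewrite /Rr1; case: asboolP => nJ.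
      by apply: (le_trans (hu1 (n - 1))); rewrite subrK lee_fin KA// ltW.
    apply: (le_trans (bottom_bound Jn nJ)); rewrite lee_fin Kend'//; first exact: ltW.
    by right.
  + move=> n Jn; apply: filterS (yE (n - 1)) => v yv /E' hv; apply: (le_trans hv).
    rewrite ler_wpM2l// /lower_cut /Rr1; case: asboolP => nJ; last first.
      by rewrite subr0 lerDr sumr_ge0.
    have -> : y v - h (n - 1) v = hi (n - 1) v + ofL0 (u1 (n - 1)) v.
      by rewrite yv /h addrC addKr.
    apply: (le_trans (ler_normD _ _)); rewrite lerD2r /hi.
    apply: (le_trans (ler_norm_sum _ _ _)).
    apply: (@sum_inj_le R _ (fun k => absz (k - n)%R) (I1 n) _ (fun i => `|term (n + i%:Z) v|)).
    * exact: filter_uniq.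
    * by move=> i j; rewrite !mem_filter => /andP[+ _] /andP[+ _]; clear; lia.
    * by move=> k; rewrite mem_filter => /andP[_ /hI1].
    * move=> k; rewrite mem_filter => /andP[kn _].
      suff -> : n + (absz (k - n)%R)%:Z = k by [].
      by move: kn; clear; lia.
    * by move=> i; exact: normr_ge0.
Qed.

End Representation.

(* At an end of J the remainder is not arbitrarily small, but there are at most two ends. *)
Lemma end_constant : exists2 K : R, 1 <= K &
  forall n, J n -> ~ J (n + 1) \/ ~ J (n - 1) ->
    2 * (G + 1) <= K * 2^-1 ^+ choice.pickle n.
Proof.
have M0 : 0 < 2 * (G + 1) by rewrite mulr_gt0// addr_gt0.
have [|Ka Ka1 hKa] := @at_most_one_bound R (fun n => J n /\ ~ J (n + 1)) _ M0 _.
  have lt m n : J m -> ~ J (m + 1) -> J n -> n <= m.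
    move=> Jm nJ Jn; rewrite leNgt; apply/negP => mn; apply: nJ.
    by apply: (iJ Jm Jn); move: mn; clear; lia.
  by move=> m n [Jm nm] [Jn nn]; apply/eqP; rewrite eq_le !lt.
have [|Kb Kb1 hKb] := @at_most_one_bound R (fun n => J n /\ ~ J (n - 1)) _ M0 _.
  have lt m n : J m -> ~ J (m - 1) -> J n -> m <= n.
    move=> Jm nJ Jn; rewrite leNgt; apply/negP => mn; apply: nJ.
    by apply: (iJ Jn Jm); move: mn; clear; lia.
  by move=> m n [Jm nm] [Jn nn]; apply/eqP; rewrite eq_le !lt.
exists (Num.max Ka Kb); first by rewrite le_max Ka1.
move=> n Jn nJ; have e0 : 0 <= 2^-1 ^+ choice.pickle n :> R by rewrite exprn_ge0// invr_ge0.
case: nJ => nJ.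
  by apply: (le_trans (hKa n (conj Jn nJ))); rewrite ler_wpM2r// le_max lexx.
by apply: (le_trans (hKb n (conj Jn nJ))); rewrite ler_wpM2r// le_max lexx orbT.
Qed.

(** [K0] is chosen before x, w and A, and the bounds are linear in A: this uniformity gives the norm
    inequality. Its factor Fm comes from the functionals, [phi_const] from the disjoint
    representation. *)
Lemma phi_in_orbit : exists2 K0 : R, 0 < K0 & forall (x : L0 nu) (w : int -> L0 nu) (A : R),
  @phi_representation R rho J t Y r0 r1 x w -> 0 < A ->
  (@phi_norm0 R J Y r0 w <= A%:E)%E -> (@phi_norm1 R J t Y r1 w <= A%:E)%E ->
  exists T : X -> Y, [/\ couple_operator T, x = T a,
    (opnorm (cnorm0 X) (cnorm0 Y) T <= (K0 * A)%:E)%E &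
    (opnorm (cnorm1 X) (cnorm1 Y) T <= (K0 * A)%:E)%E].
Proof.
have [K K1 Kend] := end_constant.
have [N [F [k [f [F0 hf]]]]] := block_functionals hp0 hp1 w0 w1 ca q_gt1 C0 gQS bB t0 tS KQ.
have [Q0 S0 _ _] := gQS; have [mB _ _ _ _] := bB.
pose Fm : R := F * (2 * N).+1%:R.
have Fm0 : 0 < Fm by rewrite mulr_gt0.
have K0 : 0 < K by rewrite (lt_le_trans _ K1).
have ph0 : 0 < phi_const l K.
  by rewrite /phi_const addr_gt0 ?mulr_gt0.
exists (Fm * phi_const l K); first exact: mulr_gt0.
move=> x w A rep A0 PA0 PA1.
have [E [mE dE EJ Eae hE]] := disjoint_representation rep A0 PA0 PA1 K1 Kend.
pose y := ofL0 x; have my : measurable_fun setT y by exact: measurable_ofL0.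
pose m (u : L0 mu) := mcoef E (fun n => f n u / Q n).
have mm u : measurable_fun setT (m u) by exact: measurable_mcoef.
have mmy u : measurable_fun setT (fun s => m u s * y s) by exact: measurable_funM.
(* Multiplication of x by a function depending linearly on u; at u = a each coefficient f n a / Q n
   is 1. *)
pose T (u : X) : Y := cls nu (fun s => m u s * y s).
have Tlin (c : R) (u v : X) : csum X u -> csum X v -> T (c *: u + v) = c *: T u + T v.
  move=> cu cv; rewrite /T -clsZ// -clsD//; last exact: measurable_funM.
  congr cls; apply/funext => s /=.
  have [[n En]|nE] := pselect (exists n, E n s).
    rewrite /m !(mcoefE dE _ En); have [_ lin _ _ _] := hf n (EJ _ _ En).
    by rewrite lin//; ring.
  by rewrite /m !mcoef0 ?mul0r ?mulr0 ?addr0// => n En; apply: nE; exists n.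
have KA0 : 0 < Fm * phi_const l K * A by rewrite !mulr_gt0.
have pA0 : 0 <= phi_const l K * A by rewrite mulr_ge0 ?(ltW A0) ?(ltW ph0).
have scale p V (W : int -> R) (xi : int -> R) (u : L0 mu) (s : seq int) : (1 <= p)%E -> weight V ->
    (forall n, n \in s -> f n u / Q n = Fm * (xi n / W n)) ->
    (wnorm nu p V (fun z => (\sum_(n <- s) cut (E n) (fun z => xi n / W n * y z) z)%R) <=
      (phi_const l K * A)%:E)%E ->
    (wnorm nu p V (fun z => (\sum_(n <- s) cut (E n) (fun z => f n u / Q n * y z) z)%R) <=
      (Fm * phi_const l K * A)%:E)%E.
  move=> hp wV hxi h.
  have mg : measurable_fun setT (fun z => \sum_(n <- s) cut (E n) (fun z => xi n / W n * y z) z).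
    by apply: measurable_big => n; apply: measurable_cut => //; exact: measurable_funM.
  have := wnormZ Fm hp wV mg pA0 h; rewrite (gtr0_norm Fm0) mulrA.
  congr (wnorm _ _ _ _ <= _)%E; apply/funext => z; rewrite mulr_sumr.
  by apply: eq_big_seq => n ns; rewrite /cut hxi// !mulrA.
have T0 : (opnorm (cnorm0 X) (cnorm0 Y) T <= (Fm * phi_const l K * A)%:E)%E.
  apply: ge_ereal_sup => _ [u /= u1 <-].
  have cu : csum X u by apply: space0_csum => //; apply: (le_lt_trans u1); exact: ltry.
  rewrite /T wLnorm_cls//; apply: (wnorm_mcoef dE mE hq0 v0 my (ltW KA0) EJ) => s us sJ.
  apply: (scale q0 V0 Q (fun n => f n u / Fm)) => //.
    by move=> n ns; field; rewrite !lt0r_neq0.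
  apply: (hE s _ us sJ).1.
  apply: (functionals_lball (k := k) bB hp0 w0 us F0 _ u1).
    by move=> n /sJ /hf[].
  by move=> n mm' ns hm; have [_ _ _ h _] := hf n (sJ n ns); exact: h.
have T1 : (opnorm (cnorm1 X) (cnorm1 Y) T <= (Fm * phi_const l K * A)%:E)%E.
  apply: ge_ereal_sup => _ [u /= u1 <-].
  have cu : csum X u by apply: space1_csum => //; apply: (le_lt_trans u1); exact: ltry.
  rewrite /T wLnorm_cls//; apply: (wnorm_mcoef dE mE hq1 v1 my (ltW KA0) EJ) => s us sJ.
  (* As Q n = t n * S n, passing from the weight Q to S moves a factor 1 / t n into the coefficient,
     which cancels the t n in the second bound on f n. *)
  apply: (scale q1 V1 S (fun n => f n u / t n / Fm)) => //.
    move=> n ns; have Jn := sJ n ns; rewrite -(tS Jn).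
    have tn := t0 Jn; have Sn := S0 n.
    by field; rewrite !lt0r_neq0.
  apply: (hE s _ us sJ).2.
  apply: (functionals_lball (k := k) bB hp1 w1 us F0 _ u1).
    by move=> n /sJ /hf[].
  move=> n mm' ns hm; have Jn := sJ n ns; have [_ _ _ _ h] := hf n Jn.
  have tn := t0 Jn.
  by rewrite normrM normfV (gtr0_norm tn) ler_pdivrMr// -mulrA [X in F * X]mulrC; exact: h.
have X00 := @csum0 _ _ _ mu p0 p1 U0 U1 hp0 hp1 w0 w1.
have T00 : T 0 = 0.
  have := Tlin (-1) 0 0 X00 X00; rewrite scaler0 addr0 scaleN1r addNr.
  by [].
have TZ (c : R) (u : X) : csum X u -> T (c *: u) = c *: T u.
  by move=> cu; have := Tlin c u 0 cu X00; rewrite T00 !addr0.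
have DZ (c : R) (u : X) : csum X u -> csum X (c *: u) by move=> cu; exact: csumZ.
exists T; split => //.
- split => //.
  (* The images of the two parts decompose the image; the added 1 keeps the bound on each part
     positive when its norm is 0. *)
  + move=> _ [u0 [u1 [-> h0 h1]]].
    have cu0 : csum X u0 by apply: space0_csum.
    have cu1 : csum X u1 by apply: space1_csum.
    exists (T u0), (T u1); split.
    * by have := Tlin 1 u0 u1 cu0 cu1; rewrite !scale1r.
    * have fin : weighted_Lnorm p0 U0 u0 \is a fin_num by rewrite ge0_fin_numE ?wLnorm_ge0.
      have L0' : 0 < fine (weighted_Lnorm p0 U0 u0) + 1.
        by rewrite ltr_wpDl// fine_ge0// wLnorm_ge0.
      have hL : (weighted_Lnorm p0 U0 u0 <= (fine (weighted_Lnorm p0 U0 u0) + 1)%:E)%E.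
        by rewrite -[leLHS](fineK fin) lee_fin lerDl.
      apply: (le_lt_trans (@opnorm_bound _ _ _ _ _ mu nu p0 q0 U0 V0 (csum X) T _ _ u0
        hp0 hq0 w0 v0 TZ DZ KA0 L0' T0 cu0 hL)).
      exact: ltry.
    * have fin : weighted_Lnorm p1 U1 u1 \is a fin_num by rewrite ge0_fin_numE ?wLnorm_ge0.
      have L0' : 0 < fine (weighted_Lnorm p1 U1 u1) + 1.
        by rewrite ltr_wpDl// fine_ge0// wLnorm_ge0.
      have hL : (weighted_Lnorm p1 U1 u1 <= (fine (weighted_Lnorm p1 U1 u1) + 1)%:E)%E.
        by rewrite -[leLHS](fineK fin) lee_fin lerDl.
      apply: (le_lt_trans (@opnorm_bound _ _ _ _ _ mu nu p1 q1 U1 V1 (csum X) T _ _ u1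
        hp1 hq1 w1 v1 TZ DZ KA0 L0' T1 cu1 hL)).
      exact: ltry.
  + by apply: (le_lt_trans T0); exact: ltry.
  + by apply: (le_lt_trans T1); exact: ltry.
- apply/esym/cls_eqP; first exact: mmy.
  apply: filterS Eae => s hs; have [y0|/hs[n En]] := eqVneq (ofL0 x s) 0.
    by rewrite /y y0 mulr0.
  have [_ _ fa _ _] := hf n (EJ _ _ En).
  by rewrite /m (mcoefE dE _ En) fa mulfV ?mul1r// gt_eqF.
Qed.

End PhiInOrbit.

(** * Limits of rho, and passage to infima over operators and representations *)

Lemma Phi0_limits (R : realType) (phi : R -> R -> R) : Phi0 phi ->
  (forall e, 0 < e -> exists2 M, 0 < M & forall s, M <= s -> phi 1 s / s <= e) /\
  (forall e, 0 < e -> exists2 M, 0 < M & forall s, 0 < s -> s <= M -> phi 1 s <= e).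
Proof.
move=> [[pos hom qc] lim1 lim2].
have near0 (f : R -> R) : f t @[t --> 0^'+] --> (0 : R) ->
    forall e, 0 < e -> exists2 M, 0 < M & forall s, 0 < s -> s <= M -> f s <= e.
  move=> fl e e0; have /cvgrPdist_le /(_ _ e0) [d /= d0 h] := fl.
  exists (d / 2); first by rewrite divr_gt0.
  move=> s s0 sd; have : `|0 - f s| <= e.
    apply: h => //=; rewrite sub0r normrN gtr0_norm//.
    by move: d0 sd; lra.
  by rewrite sub0r normrN; apply: le_trans; exact: ler_norm.
split; last exact: near0.
move=> e e0; have [M M0 h] := near0 _ lim2 e e0.
exists M^-1; first by rewrite invr_gt0.
move=> s sM; have s0 : 0 < s by apply: lt_le_trans sM; rewrite invr_gt0.
have sV0 : 0 < s^-1 by rewrite invr_gt0.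
(* Homogeneity turns the limit of phi (t, 1) at 0 into the decay of rho (s) / s at infinity. *)
have -> : phi 1 s / s = phi s^-1 1.
  by have := hom s^-1 1 s sV0 ltr01 s0; rewrite mulr1 mulVf ?gt_eqF// mulrC => ->.
by apply: h => //; rewrite -[leRHS]invrK lef_pV2 ?posrE ?invr_gt0.
Qed.

(** The operator and representation lemmas ask for a strictly positive real bound A, which the
    infimum need not be; it is approached from above within e / K. *)
Lemma ereal_inf_bound (R : realType) (D : set (\bar R)) (N : \bar R) (K : R) : 0 < K ->
  D !=set0 -> (forall k, D k -> (0 <= k)%E /\ (k < +oo)%E) ->
  (forall A : R, 0 < A -> (exists2 k, D k & (k <= A%:E)%E) -> (N <= (K * A)%:E)%E) ->
  (N <= K%:E * ereal_inf D)%E.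
Proof.
move=> K0 [k0 Dk0] Dk h.
have inf0 : (0 <= ereal_inf D)%E by apply: le_ereal_inf_tmp => k /Dk[].
have fin : ereal_inf D \is a fin_num.
  rewrite ge0_fin_numE//; have [_] := Dk _ Dk0; apply: le_lt_trans.
  exact: ereal_inf_lbound.
have i0 : 0 <= fine (ereal_inf D) by rewrite fine_ge0.
rewrite -(fineK fin) -EFinM; apply/lee_addgt0Pr => e e0.
have eK : 0 < e / K by rewrite divr_gt0.
have : (ereal_inf D < (fine (ereal_inf D) + e / K)%:E)%E.
  by rewrite -[ltLHS](fineK fin) lte_fin ltrDl.
move=> /ereal_inf_lt[k Dk' kA].
have := h (fine (ereal_inf D) + e / K); rewrite ltr_wpDl// => /(_ isT).
have ex : exists2 k, D k & (k <= (fine (ereal_inf D) + e / K)%:E)%E by exists k => //; exact: ltW.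
by move=> /(_ ex); rewrite mulrDr [K * (e / K)]mulrC divfK ?gt_eqF// EFinD.
Qed.

Theorem mainTheorem1 (R : realType)
  (d d' : measure_display) (S : measurableType d) (S' : measurableType d')
  (mu : {measure set S -> \bar R}) (nu : {measure set S' -> \bar R})
  (p0 p1 q0 q1 : \bar R)
  (U0 U1 : S -> R) (V0 V1 : S' -> R)
  (hp0 : (1 <= p0)%E) (hp1 : (1 <= p1)%E)
  (hq0 : (1 <= q0)%E) (hq1 : (1 <= q1)%E)
  (hU0 : weight U0) (hU1 : weight U1) (hV0 : weight V0) (hV1 : weight V1) :
  let X := Lp_couple mu p0 p1 U0 U1 in
  let Y := Lp_couple nu q0 q1 V0 V1 in
  let r0 : \bar R := ((maxe (q0^-1 - p0^-1) 0)^-1)%E in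
  let r1 : \bar R := ((maxe (q1^-1 - p1^-1) 0)^-1)%E in
  forall a : X, csum X a ->
  let phi := fun s t : R => fine (Kfun X s t a) in
  Phi0 phi ->
  forall (q : R) (J : set int) (t : int -> R),
    1 < q -> balanced (phi 1) q J t ->
    eq_normed_space
      (Orb X a Y) (Orb_norm X a Y)
      (phi_space (phi 1) J t Y r0 r1) (phi_space_norm (phi 1) J t Y r0 r1).
Proof.
move=> X Y r0 r1 a ca phi hphi q J t q1' bal.
have [limy lim0] := Phi0_limits hphi.
have [[_ _ qc] _ _] := hphi.
have KE s : 0 < s -> Kfun X 1 s a = (phi 1 s)%:E.
  by move=> s0; rewrite /phi fineK//; apply: Kfun_fin.
have [Q [W [B [C [C0 gQW QWJ bB]]]]] :=
  block_decomposition_exists hp0 hp1 hU0 hU1 qc q1' bal KE limy lim0.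
have [[J0 iJ] [t0 _] _ _ _] := bal.
have KQ n : J n -> Kfun X 1 (t n) a = (Q n)%:E.
  by move=> Jn; have [-> _] := QWJ n Jn; rewrite KE//; exact: t0.
have toPhi := orbit_in_phi (nu := nu) hp0 hp1 hU0 hU1 hq0 hq1 hV0 hV1 ca J0 iJ q1' C0 gQW bB t0 QWJ.
have [K0 K00 toOrb] := phi_in_orbit nu hp0 hp1 hU0 hU1 hq0 hq1 hV0 hV1 ca J0 iJ q1' C0 gQW bB t0 QWJ KQ.
set K1 := orbit_const q C in toPhi.
have K10 : 0 < K1.
  have q0' : 0 < q by rewrite (lt_trans _ q1').
  have D0 := tail_const_gt0 q1' C0.
  have l1 : 0 < 1 - q^-1 by rewrite subr_gt0 invf_lt1.
  by apply: mulr_gt0 => //; apply: addr_gt0 => //; apply: divr_gt0.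
have X00 : csum X 0 by apply: csum0.
have opn0 (T : X -> Y) : (0 <= opnorm (cnorm0 X) (cnorm0 Y) T)%E.
  apply: (@le_trans _ _ (cnorm0 Y (T 0))); first exact: wLnorm_ge0.
  by apply: ereal_sup_ubound; exists 0 => //=; rewrite wLnorm0.
have opn1 (T : X -> Y) : (0 <= opnorm (cnorm1 X) (cnorm1 Y) T)%E.
  apply: (@le_trans _ _ (cnorm1 Y (T 0))); first exact: wLnorm_ge0.
  by apply: ereal_sup_ubound; exists 0 => //=; rewrite wLnorm0.
have lpos (r : \bar R) (u : int -> \bar R) : (0 < r)%E -> (0 <= lnorm J r u)%E.
  case: r => [e| |]//= _; first exact: poweR_ge0.
  have [j Jj] := J0; apply: (@le_trans _ _ (`|u j|)%E); first exact: abse_ge0.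
  by apply: ereal_sup_ubound; exists j.
have r00 : (0 < r0)%E by apply: (multiplier_exponent_gt0 hp0 hq0).
have maxfin (u v : \bar R) : (0 <= u)%E -> (u < +oo)%E -> (v < +oo)%E ->
    (0 <= maxe u v)%E /\ (maxe u v < +oo)%E.
  by move=> u0 uy vy; rewrite le_max u0 gt_max uy vy.
have maxle (u v : \bar R) (A : R) : (maxe u v <= A%:E)%E -> (u <= A%:E)%E /\ (v <= A%:E)%E.
  by rewrite ge_max => /andP[].
have bound (k : \bar R) : (0 <= k)%E -> (k < +oo)%E -> exists2 A : R, 0 < A & (k <= A%:E)%E.
  move=> k0 ky; exists (fine k + 1); first by rewrite ltr_wpDl// fine_ge0.
  by rewrite -[leLHS]fineK ?ge0_fin_numE// lee_fin lerDl.
have Orb_phi x : Orb X a Y x -> phi_space (phi 1) J t Y r0 r1 x.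
  move=> [T [opT ->]]; have [_ _ h0 h1] := opT.
  have [m0 my] := maxfin _ _ (opn0 T) h0 h1.
  have [A A0 /maxle[kA0 kA1]] := bound _ m0 my.
  by have [w [rep _ _]] := toPhi T A opT A0 kA0 kA1; exists w.
have phi_Orb x : phi_space (phi 1) J t Y r0 r1 x -> Orb X a Y x.
  move=> [w rep]; have [_ _ _ h0 h1] := rep.
  have [m0 my] := maxfin _ _ (lpos _ _ r00 : (0 <= phi_norm0 J r0 w)%E) h0 h1.
  have [A A0 /maxle[kA0 kA1]] := bound _ m0 my.
  by have [T [opT xE _ _]] := toOrb x w A rep A0 kA0 kA1; exists T.
split; first by apply/seteqP; split => x; [exact: Orb_phi|exact: phi_Orb].
(* [K0] bounds the orbit norm by the phi-norm, so its inverse is the lower constant; [K1] bounds the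
   phi-norm by the orbit norm. *)
exists K0^-1, K1; split => //; first by rewrite invr_gt0.
move=> x xO; have xP := Orb_phi _ xO; split.
  rewrite muleC lee_pdivrMr//.
  rewrite muleC; apply: ereal_inf_bound => //.
  - by have [w rep] := xP; exists (maxe (phi_norm0 J r0 w) (phi_norm1 J t r1 w)); exists w.
  - move=> _ [w [_ _ _ h0 h1] <-].
    exact: (maxfin _ _ (lpos _ _ r00 : (0 <= phi_norm0 J r0 w)%E) h0 h1).
  - move=> A A0 [_ [w rep <-] /maxle[kA0 kA1]].
    have [T [opT xE T0 T1]] := toOrb x w A rep A0 kA0 kA1.
    apply: (@le_trans _ _ (maxe (opnorm (cnorm0 X) (cnorm0 Y) T) (opnorm (cnorm1 X) (cnorm1 Y) T))).
      by apply: ereal_inf_lbound; exists T.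
    by rewrite ge_max T0 T1.
apply: ereal_inf_bound => //.
- have [T [opT xE]] := xO; eexists; exists T; split; [exact: opT|exact: xE|reflexivity].
- move=> _ [T [[_ _ h0 h1] _ ->]]; exact: (maxfin _ _ (opn0 T) h0 h1).
- move=> A A0 [_ [T [opT -> ->]] /maxle[kA0 kA1]].
  have [w [rep P0 P1]] := toPhi T A opT A0 kA0 kA1.
  apply: (@le_trans _ _ (maxe (phi_norm0 J r0 w) (phi_norm1 J t r1 w))).
    by apply: ereal_inf_lbound; exists w.
  by rewrite ge_max P0 P1.
Qed.
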